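(* Let $\alpha>0$ and $\rho\in(0,1)$. Consider the symmetric exclusion process with a slow bond $\{\eta_{tn^2}:t\ge0\}$ started from $\nu^u_\rho(\cdot)=\nu_\rho(\,\cdot\,|\,\eta(\lfloor un\rfloor)=1)$, and let $X^n_u(t)$ denote the displacement, at time $tn^2$, of the tagged particle initially at site $\lfloor un\rfloor$ (its position at time $tn^2$ minus $\lfloor un\rfloor$). Then, for all $\beta\in[0,+\infty]$, every $u\in\mathbb R$ and $t\ge0$, as $n\to+\infty$, $$\frac{X^n_u(t)}{\sqrt n}\longrightarrow X_u(t)$$ in the sense of finite-dimensional distributions, where $X_u(t)=J_u(t)/\rho$ in law and $J_u(t)$ is the Gaussian process which is the limit of the rescaled current, described in the context. In particular, the covariances of the process $X_u(t)$ are given by $E[X_u(t)X_u(s)]=\rho^{-2}E[J_u(t)J_u(s)]$.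
   Context: **Model.** $\Omega=\{0,1\}^{\mathbb Z}$. For $n\in\mathbb N$ put $\xi^n_{-1,0}=\alpha n^{-\beta}$ (equal to $0$ for $\beta=+\infty$) and $\xi^n_{x,x+1}=1$ for $x\ne-1$. The generator acts on local functions by $(\mathcal L_nf)(\eta)=\sum_{x\in\mathbb Z}\xi^n_{x,x+1}[f(\eta^{x,x+1})-f(\eta)]$, where $\eta^{x,x+1}$ is $\eta$ with the values at $x$ and $x+1$ exchanged. $\{\eta_{tn^2}:t\ge0\}$ is the Markov process with generator $n^2\mathcal L_n$. $\nu_\rho$ is the product measure on $\Omega$ with $\nu_\rho\{\eta(x)=1\}=\rho$ for all $x$; $\chi(\rho)=\rho(1-\rho)$. An exchange across a bond whose two sites are both occupied moves no particle, so the order of the particles (including the tagged one) is preserved in time. **The process $J_u$.** $J_u(t)$ is the limit in finite-dimensional distributions, under the process started from $\nu_\rho$, of $J^n_u(t)/\sqrt n$, where $J^n_u(t)$ is the current through the bond $\{\lfloor un\rfloor-1,\lfloor un\rfloor\}$ (jumps from left to right minus jumps from right to left) during $[0,tn^2]$. It is (mean-zero) Gaussian with covariances $E[J_u(t)J_u(s)]=\chi(\rho)(V(t)+V(s)-V(t-s))$ for $0\le s\le t$, where, with $\Phi_{2t}(x)=\int_x^{+\infty}\frac{e^{-v^2/(4t)}}{\sqrt{4\pi t}}\,dv$, $V(0)=0$ and for $\tau>0$: - if $\beta\in[0,1)$, $V(\tau)=\sqrt{\tau/\pi}$; - if $\beta=1$, $V(\tau)=\sqrt{\tau/\pi}+\frac{1}{2\alpha}\Phi_{2\tau}(2u+4\alpha\tau)\,e^{4\alpha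 u+4\alpha^2\tau}-\frac1{2\alpha}\Phi_{2\tau}(2u)$; - if $\beta\in(1,+\infty]$, $V(\tau)=\sqrt{\tau/\pi}\,[1-e^{-u^2/\tau}]+2u\,\Phi_{2\tau}(2u)$.
   Formalization: In the covariances of J_u, V is taken with |u| in place of u: for u<0 and β≥1 the printed V(τ) is negative for small τ (for β>1 it tends to 2u), so no process has those covariances; by the reflection symmetry of the model V depends only on |u|. *)

(* Defs.v *)
From HB Require Import structures.
From mathcomp Require Import all_boot all_order all_algebra.
From mathcomp Require Import finmap.
From mathcomp Require Import all_classical all_reals all_analysis.

Set Implicit Arguments.
Unset Strict Implicit.
Unset Printing Implicit Defensive.

Import Order.TTheory GRing.Theory Num.Theory.
Import numFieldNormedType.Exports.

Local Open Scope classical_set_scope.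
Local Open Scope ring_scope.

Definition config : Type := {ptws int -> bool}.

Definition configM :=
  g_sigma_algebraType [set B : set config | exists x, B = [set e | e x]].

Definition exchange (x : int) (e : config) : config :=
  fun y => if y == x then e (x + 1) else if y == x + 1 then e x else e y.

Definition local_fun (R : realType) (f : config -> R) : Prop :=
  exists A : {fset int},
    forall e e' : config, (forall x, x \in A -> e x = e' x) -> f e = f e'.

(* [nu] is the Bernoulli product measure of density [rho]. *)
Definition is_nu (R : realType) (rho : R) (nu : probability configM R) : Prop :=
  forall (A : {fset int}) (z : config),
    nu [set e | forall x, x \in A -> e x = z x] =
    (\prod_(x <- A) (if z x then rho else 1 - rho))%:E.

(* nu( . | e(x) = 1) *)
Definition nu_cond (R : realType) (nu : probability configM R) (x : int)
    (B : set config) : \bar R :=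
  (fine (nu (B `&` [set e | e x])) / fine (nu [set e | e x]))%:E.

(* [rate alpha beta n x] is the exchange rate of the bond {x, x+1}. *)
Definition rate (R : realType) (alpha : R) (beta : \bar R) (n : nat) (x : int)
    : R :=
  if x == -1 then
    match beta with b%:E => alpha * n%:R `^ (- b) | _ => 0 end
  else 1.

(* For a local [f] only finitely many terms are nonzero, which is what makes
   the finitely supported sum meaningful. *)
Definition generator (R : realType) (alpha : R) (beta : \bar R) (n : nat)
    (f : config -> R) (e : config) : R :=
  \sum_(x \in [set: int]) rate alpha beta n x * (f (exchange x e) - f e).

(* Markov (Feller) semigroup on C({0,1}^Z); [S t f] is only relevant for
   [0 <= t] and continuous [f]. *)
Record markov_semigroup (R : realType) (S : R -> (config -> R) -> config -> R)
    : Prop := MarkovSemigroup {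
  semigroup_continuous : forall t (f : config -> R), 0 <= t -> continuous f ->
    continuous (S t f) ;
  semigroup_linear : forall t a (f g : config -> R), 0 <= t ->
    continuous f -> continuous g -> forall e,
    S t (fun e => a * f e + g e) e = a * S t f e + S t g e ;
  semigroup0 : forall (f : config -> R), continuous f -> forall e, S 0 f e = f e ;
  semigroupD : forall s t (f : config -> R), 0 <= s -> 0 <= t ->
    continuous f -> forall e, S (s + t) f e = S s (S t f) e ;
  semigroup1 : forall t, 0 <= t -> forall e, S t (fun=> 1) e = 1 ;
  semigroup_ge0 : forall t (f : config -> R), 0 <= t -> continuous f ->
    (forall e, 0 <= f e) -> forall e, 0 <= S t f e ;
  semigroup_right_continuous : forall t (f : config -> R), 0 <= t ->
    continuous f -> forall eps, 0 < eps ->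
    \forall s \near t^'+, forall e, `|S s f e - S t f e| <= eps }.

(* The generator of [S] is [L] on local functions: (S_t f - f)/t -> L f
   uniformly as t decreases to 0. Local functions being a core, this determines
   [S] for the exclusion dynamics. *)
Definition has_generator (R : realType) (S : R -> (config -> R) -> config -> R)
    (L : (config -> R) -> config -> R) : Prop :=
  forall f, local_fun f -> forall eps, 0 < eps ->
    \forall t \near 0^'+, forall e, `|(S t f e - f e) / t - L f e| <= eps.

(* Left limits are taken for the discrete topology of [A]. *)
Definition left_lim (R : realType) (A : Type) (g : R -> A) (t : R) (a : A)
    : Prop :=
  \forall s \near t^'-, g s = a.

Definition cadlag (R : realType) (A : Type) (g : R -> A) : Prop :=
  (forall t, 0 <= t -> \forall s \near t^'+, g s = g t) /\
  (forall t, 0 < t -> exists a, left_lim g t a).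

Definition past (R : realType) (T : Type) (eta : R -> T -> config) (s : R)
    : set (set T) :=
  <<s [set A | exists r x, 0 <= r <= s /\ A = [set w | eta r w x]] >>.

(* [eta] is, under [P], a cadlag Markov process with semigroup [S] and initial
   law [mu]. *)
Record markov_process (R : realType) (S : R -> (config -> R) -> config -> R)
    (mu : set config -> \bar R) (d : measure_display) (T : measurableType d)
    (P : probability T R) (eta : R -> T -> config) : Prop := MarkovProcess {
  process_measurable : forall t x, 0 <= t -> measurable [set w | eta t w x] ;
  process_cadlag : forall w x, cadlag (fun t => eta t w x) ;
  process_initial : forall B : set configM, measurable B ->
    P [set w | B (eta 0 w)] = mu B ;
  process_markov : forall s t (f : config -> R), 0 <= s -> 0 <= t ->
    continuous f -> forall A, past eta s A ->
    (\int[P]_(w in A) (f (eta (s + t) w))%:E =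
     \int[P]_(w in A) (S t f (eta s w))%:E)%E }.

(* A particle moves from [x] to [y] at time [t] along the path [g]: [x] is
   occupied and [y] empty just before [t], and conversely at [t]. *)
Definition jump (R : realType) (g : R -> config) (x y : int) (t : R) : Prop :=
  [/\ left_lim (g^~ x) t true, left_lim (g^~ y) t false,
      g t x = false & g t y = true].

(* Net number of particles crossing the bond {x-1, x} from left to right
   during [0, t]; for cadlag paths both sets are finite. *)
Definition current (R : realType) (g : R -> config) (x : int) (t : R) : int :=
  #|` fset_set [set s | 0 < s <= t /\ jump g (x - 1) x s]|%:Z -
  #|` fset_set [set s | 0 < s <= t /\ jump g x (x - 1) s]|%:Z.

(* [Y] is the trajectory of the particle of [g] which is initially at [a]: it
   sits on a particle at all times, and can only change its position by a jump
   of that particle to a neighbouring empty site. *)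
Definition tagged_path (R : realType) (g : R -> config) (a : int)
    (Y : R -> int) : Prop :=
  [/\ Y 0 = a, cadlag Y, forall t, 0 <= t -> g t (Y t) = true &
      forall t y, 0 < t -> left_lim Y t y ->
        Y t = y \/ ((Y t = y + 1 \/ Y t = y - 1) /\ jump g y (Y t) t)].

Definition tagged_particle (R : realType) (d : measure_display)
    (T : measurableType d) (P : probability T R) (eta : R -> T -> config)
    (a : int) (Y : R -> T -> int) : Prop :=
  (forall t k, 0 <= t -> measurable [set w | Y t w = k]) /\
  {ae P, forall w, tagged_path (eta^~ w) a (Y^~ w)}.

(* Convergence in law of (Y^n_{t_1}, ..., Y^n_{t_k}), for all times
   t_1, ..., t_k >= 0, each Y^n living on its own probability space. *)
Definition fdd_cvg (R : realType) (d : nat -> measure_display)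
    (T : forall n, measurableType (d n)) (P : forall n, probability (T n) R)
    (Y : forall n, R -> T n -> R) (d' : measure_display)
    (T' : measurableType d') (P' : probability T' R) (Z : R -> T' -> R)
    : Prop :=
  forall (k : nat) (t : 'I_k -> R), (forall i, 0 <= t i) ->
  forall g : 'rV[R]_k -> R, continuous g -> (exists M, forall v, `|g v| <= M) ->
  'E_(P n)[fun w => g (\row_i Y n (t i) w)]%E @[n --> \oo] -->
  'E_P'[fun w => g (\row_i Z (t i) w)]%E.

Definition fdd_eq (R : realType) (d : measure_display) (T : measurableType d)
    (P : probability T R) (Y : R -> T -> R) (d' : measure_display)
    (T' : measurableType d') (P' : probability T' R) (Z : R -> T' -> R)
    : Prop :=
  forall (k : nat) (t : 'I_k -> R), (forall i, 0 <= t i) ->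
  forall B : set (k.-tuple R), measurable B ->
  P [set w | B [tuple Y (t i) w | i < k]] =
  P' [set w | B [tuple Z (t i) w | i < k]].

Definition random_process (R : realType) (d : measure_display)
    (T : measurableType d) (Y : R -> T -> R) : Prop :=
  forall t, 0 <= t -> measurable_fun [set: T] (Y t).

(* Point masses are Gaussian; they are listed apart because the library's
   [normal_prob m 0] is not [\d_m]. *)
Definition gaussian_variable (R : realType) (d : measure_display)
    (T : measurableType d) (P : probability T R) (Y : T -> R) : Prop :=
  exists m s : R, forall B : set R, measurable B ->
    P (Y @^-1` B) = if s == 0 then \d_m B else normal_prob m s B.

Definition gaussian_process (R : realType) (d : measure_display)
    (T : measurableType d) (P : probability T R) (Y : R -> T -> R) : Prop :=
  forall (k : nat) (t c : 'I_k -> R), (forall i, 0 <= t i) ->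
    gaussian_variable P (fun w => \sum_(i < k) c i * Y (t i) w).

(* Phi t x is the probability that a centered Gaussian variable of variance
   [2 * t] exceeds [x]. *)
Definition Phi (R : realType) (t x : R) : R :=
  \int[lebesgue_measure]_(v in `[x, +oo[)
    (expR (- v ^+ 2 / (4 * t)) / Num.sqrt (4 * pi * t)).

(* The formulas are those for [0 <= u]. The reflection x |-> -1 - x of Z
   preserves the dynamics and changes [u] into [- u], so that V depends on [u]
   through its absolute value only (with a negative [u],
   sqrt(tau/pi) * (1 - exp(-u^2/tau)) + 2 * u * Phi tau (2 * u) is negative and
   cannot be half of a variance). *)
Definition V (R : realType) (alpha : R) (beta : \bar R) (u tau : R) : R :=
  let a := `|u| in
  if tau == 0 then 0
  else if (beta < 1)%E then Num.sqrt (tau / pi)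
  else if beta == 1%E then
    Num.sqrt (tau / pi)
    + (2 * alpha)^-1 * Phi tau (2 * a + 4 * alpha * tau)
      * expR (4 * alpha * a + 4 * alpha ^+ 2 * tau)
    - (2 * alpha)^-1 * Phi tau (2 * a)
  else
    Num.sqrt (tau / pi) * (1 - expR (- a ^+ 2 / tau))
    + 2 * a * Phi tau (2 * a).

Definition chi (R : realType) (rho : R) : R := rho * (1 - rho).

(* [J] is the process J_u: the limit of the rescaled current through the bond
   {floor(u n) - 1, floor(u n)} for the processes [eta n] (started from the
   Bernoulli product measure). *)
Record limit_current (R : realType) (alpha rho : R) (beta : \bar R) (u : R)
    (d : nat -> measure_display) (T : forall n, measurableType (d n))
    (P : forall n, probability (T n) R) (eta : forall n, R -> T n -> config)
    (d' : measure_display) (T' : measurableType d') (P' : probability T' R)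
    (J : R -> T' -> R) : Prop := LimitCurrent {
  limit_current_process : random_process J ;
  limit_current_cvg :
    fdd_cvg P (fun n t w =>
      (current ((eta n)^~ w) (Num.floor (u * n%:R)) t)%:~R / Num.sqrt n%:R)
      P' J ;
  limit_current_gaussian : gaussian_process P' J ;
  limit_current_mean : forall t, 0 <= t -> ('E_P'[J t] = 0)%E ;
  limit_current_cov : forall s t, 0 <= s <= t ->
    ('E_P'[J t \* J s] =
     (chi rho * (V alpha beta u t + V alpha beta u s
                 - V alpha beta u (t - s)))%:E)%E }.

(* Main.v *)
(* Since particles keep their order, the current J through {a - 1, a}, with
   a = floor(u n), is the signed number of particles between a and the tagged
   particle at time t. If the particle density at time t is close to rho on the
   scale sqrt n, then J is close to rho times the displacement. It remains to pass
   from nu_rho, for which the limit of J is known, to nu_rho conditioned on a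
   particle at a.

   For this, the semigroup is approximated by convex combinations of compositions
   of exchanges of neighbouring sites, with weights that do not depend on the
   initial law. Hence, for a function of the configurations at finitely many
   times, conditioning the initial law on the occupation of one site costs at most
   the effect of flipping one site of each configuration. The current is not
   determined by these configurations, but it is, up to the mean of the currents
   through N bonds, which is small in L^2 for large N: the martingale parts of the
   currents are orthogonal and their drifts telescope. The law of large numbers
   for the density at time t follows from the stationarity of nu_rho, as
   conditioning multiplies second moments by at most 1/rho. *)
Require Import Defs.
From mathcomp Require Import all_boot all_order all_algebra.
From mathcomp Require Import finmap.
From mathcomp Require Import all_classical all_reals all_analysis.
From mathcomp Require Import measurable_realfun.
From mathcomp Require Import ring lra zify.
Set Implicit Arguments.
Unset Strict Implicit.
Unset Printing Implicit Defensive.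
Import Order.TTheory GRing.Theory Num.Theory.
Import numFieldNormedType.Exports.
Local Open Scope classical_set_scope.
Local Open Scope ring_scope.

(** * Paths of the exclusion process *)

Section paths.
Context {R : realType}.

(** The dynamics is given only by a semigroup, its generator on local functions and the Markov
    property, each process on its own space: there is neither a graphical construction nor a
    coupling. Even the fact that paths change only by exchanges must be proved: in time [h] a window
    undergoes anything else with probability o(h), and a union bound over fine partitions leaves a
    null set. The pathwise identities then hold exactly, almost surely. The averaging length N is
    free, because one flip per configuration moves the averaged count by at most 2 whatever N is,
    negligible against sqrt n. This pays for crude bounds: with rates and drift of order n^2, N =
    n^4 makes the mean square error of the rescaled current O(1/n). The cross terms of the currents
    are bounded directly, without constructing martingales. The limit J supplies the rest: its tails
    give tightness of the current under the conditioned law, which keeps the tagged particle within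
    O(sqrt n) sites, so that the density is needed at finitely many points only. Tightness also
    reduces bounded continuous test functions to compactly supported ones. *)

Definition one_change (A : Type) (g : R -> A) (s s' : R) : Prop :=
  exists tau, (forall r, s <= r <= s' -> r < tau -> g r = g s) /\
              (forall r, s <= r <= s' -> tau <= r -> g r = g s').

(** Near each [x] the path has one value on the left of [x] and one from [x] on, so any short
    interval close to [x] has its switch at [x]; compactness of [[0, t]] makes the length uniform. A
    switching time outside the interval stands for a constant path. *)
Lemma cadlag_one_change (A : Type) (g : R -> A) (t : R) : cadlag g ->
  exists2 delta, 0 < delta & forall s s', 0 <= s -> s <= s' -> s' <= t ->
    s' - s < delta -> one_change g s s'.
Proof.
move=> [gr gl].
have := @segment_compact R 0 t => /compact_near_coveringP/(_ R 0^'+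
  (fun d x => forall s s', 0 <= s -> s <= s' -> s' <= t -> `|x - s| < d ->
     s' - s < d -> one_change g s s')).
move=> /(_ (at_right_proper_filter 0)) [].
  move=> x /=; rewrite in_itv/= => /andP[x0 xt].
  have [e e0 [a He]] : exists2 e, 0 < e & exists a,
      (forall r, x < r < x + e -> g r = g x) /\
      (forall r, 0 <= r -> x - e < r < x -> g r = a).
    have /nbhs_ballP[e1 /= e10 H1] := gr x x0.
    have H1' r : x < r < x + e1 -> g r = g x.
      move=> /andP[xr re]; apply: H1 => //=.
      by rewrite /ball/= ltr_distlC; apply/andP; split; lra.
    move: x0; rewrite le_eqVlt => /orP[/eqP x0|x0].
      exists e1 => //; exists (g x); split => // r r0 /andP[h1 h2]; exfalso; lra.
    have [a /nbhs_ballP[e2 /= e20 H2]] := gl x x0.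
    exists (Num.min e1 e2); first by rewrite lt_min e10.
    exists a; split => r.
      move=> /andP[xr re]; apply: H1'; rewrite xr/=.
      by rewrite (lt_le_trans re)// lerD2l ge_min lexx.
    move=> r0 /andP[xr re]; apply: H2 => //=.
    have : Num.min e1 e2 <= e2 by rewrite ge_min lexx orbT.
    by move=> h; rewrite /ball/= ltr_distlC; apply/andP; split; lra.
  near=> x' d => s s' s0 ss' s't /= xs ssd.
  have xx' : `|x - x'| < e / 3.
    by near: x'; apply/nbhs_ballP; exists (e / 3) => //=; rewrite divr_gt0.
  have de : d < e / 3.
    near: d; apply: nbhs_right_lt; by rewrite divr_gt0.
  move: xx' xs; rewrite !ltr_distlC => /andP[h1 h2] /andP[h3 h4].
  exists x; split => r /andP[r1 r2] h5.
    by rewrite (He.2 r) ?(He.2 s) //; try (apply/andP; split); lra.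
  have E r' : x <= r' <= s' -> g r' = g x.
    rewrite le_eqVlt => /andP[/orP[/eqP -> //|h6] h7].
    by apply: He.1; apply/andP; split; lra.
  by rewrite (E r) ?(E s') ?h5 ?lexx ?andbT//; apply: le_trans r2.
move=> /= e e0 He.
exists (e / 2); first by rewrite divr_gt0.
move=> s s' s0 ss' s't d.
have e20 : 0 < e / 2 by rewrite divr_gt0.
apply: (He (e / 2) _ e20 s) => //=.
- by rewrite sub0r normrN gtr0_norm//; lra.
- by rewrite in_itv/= s0/=; apply: le_trans s't.
- by rewrite subrr normr0.
Unshelve. all: by end_near. Qed.

Lemma ex_fine_partition (A : Type) (g : R -> A) (t : R) : 0 <= t -> cadlag g ->
  exists m0, forall m i, (m0 <= m)%N -> (i < m)%N ->
    one_change g (t * i%:R / m%:R) (t * i.+1%:R / m%:R).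
Proof.
move=> t0 /(@cadlag_one_change _ _ t)[d d0 H].
exists (Num.truncn (t / d)).+1 => m i mm im.
have m0 : (0 : R) < m%:R by rewrite ltr0n; lia.
apply: H.
- by rewrite divr_ge0 ?mulr_ge0.
- by rewrite ler_pM2r ?invr_gt0// ler_wpM2l// ler_nat.
- by rewrite ler_pdivrMr// ler_wpM2l// ler_nat.
- rewrite -mulrBl -mulrBr -natrB// subSnn mulr1 ltr_pdivrMr// mulrC.
  rewrite -ltr_pdivrMr//; apply: (lt_le_trans (truncnS_gt _)).
  by rewrite ler_nat.
Qed.

(** This is how pathwise identities are proved later: a quantity built from the path is followed
    through its jumps. In a step of a fine partition the only possible switch is excluded, since the
    value at [tau] equals the values just before it. *)
Lemma locally_constant (A : Type) (D : R -> A) :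
  (forall t, 0 <= t -> \forall s \near t^'+, D s = D t) ->
  (forall t, 0 < t -> \forall s \near t^'-, D s = D t) ->
  forall t, 0 <= t -> D t = D 0.
Proof.
move=> Dr Dl t t0.
have cD : cadlag D by split => // s s0; exists (D s); exact: Dl.
have [m0 /(_ m0.+1) H] := ex_fine_partition t0 cD.
have step i : (i < m0.+1)%N ->
    D (t * i.+1%:R / m0.+1%:R) = D (t * i%:R / m0.+1%:R).
  move=> im; have [//|tau [H1 H2]] := H i _ im.
  set s := t * i%:R / _ in H1 H2 *; set s' := t * _ / _ in H1 H2 *.
  have s0 : 0 <= s by rewrite divr_ge0 ?mulr_ge0.
  have ss' : s <= s' by rewrite ler_pM2r ?invr_gt0// ler_wpM2l// ler_nat.
  have [ts|st] := leP tau s; first by rewrite (H2 s)// lexx ss'.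
  have [ts'|st'] := leP tau s'; last by rewrite (H1 s')// ss' lexx.
  have /Dl : 0 < tau by exact: le_lt_trans st.
  move=> /nbhs_ballP[e /= e0 He].
  have [r /andP[sr rt] re] : exists2 r, s <= r < tau & tau - r < e.
    exists (Num.max s (tau - e / 2)).
      by rewrite le_max lexx gt_max st/= ltrBlDr ltrDl divr_gt0.
    have : tau - e / 2 <= Num.max s (tau - e / 2) by rewrite le_max lexx orbT.
    lra.
  rewrite -(H2 tau) ?lexx ?ts' ?(ltW st)//.
  rewrite -(He r)//=; last by rewrite /ball/= gtr0_norm ?subr_gt0.
  by apply: H1; rewrite // sr/= (le_trans (ltW rt)).
have E i : (i <= m0.+1)%N -> D (t * i%:R / m0.+1%:R) = D 0.
  elim: i => [|i IH] im; first by rewrite mulr0 mul0r.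
  by rewrite step// IH// ltnW.
by have := E m0.+1 (leqnn _); rewrite mulfK// pnatr_eq0.
Qed.

(** The current through [{x - 1, x}] read off from two snapshots; it is exact when at most one
    change of the two sites occurs between them. *)
Definition phi (x : int) (e e' : config) : int :=
  [&& e (x - 1), ~~ e x, ~~ e' (x - 1) & e' x]%:Z -
  [&& e x, ~~ e (x - 1), ~~ e' x & e' (x - 1)]%:Z.

(** In a step with one change a jump can only happen at the switching time, and it does happen
    exactly when the end values show it. Finiteness is part of the conclusion because [fset_set] of
    an infinite set is empty. *)
Lemma jump_count (g : R -> config) (x y : int) (t : nat -> R) n :
  t 0%N = 0 -> (forall i, (i < n)%N -> t i <= t i.+1) ->
  (forall i, (i < n)%N ->
    one_change (fun s => (g s x, g s y)) (t i) (t i.+1)) ->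
  let A := [set s | 0 < s <= t n /\ jump g x y s] in
  finite_set A /\
  #|` fset_set A| = (\sum_(i < n)
    [&& g (t i) x, ~~ g (t i) y, ~~ g (t i.+1) x & g (t i.+1) y])%N.
Proof.
move=> t0; elim: n => [|n IH] tS oc /=.
  have -> : [set s | 0 < s <= t 0%N /\ jump g x y s] = set0.
    by rewrite t0 -subset0 => s /= [/andP[]]; lra.
  by rewrite fset_set0 big_ord0 cardfs0.
have [||fA cA] := IH.
- by move=> i ni; apply: tS; exact: ltnW.
- by move=> i ni; apply: oc; exact: ltnW.
have tn0 : 0 <= t n.
  have : forall k, (k <= n.+1)%N -> 0 <= t k.
    elim => [|k IHk] kn; first by rewrite t0.
    by apply: (le_trans (IHk (ltnW kn))); exact: tS.
  by apply.
set b := [&& g (t n) x, ~~ g (t n) y, ~~ g (t n.+1) x & g (t n.+1) y].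
set B := [set s | t n < s <= t n.+1 /\ jump g x y s].
have tnS := tS n (ltnSn n).
have [tau [H1 H2]] := oc n (ltnSn n).
have AB : [set s | 0 < s <= t n.+1 /\ jump g x y s] =
    [set s | 0 < s <= t n /\ jump g x y s] `|` B.
  apply/seteqP; split => s /= [].
    move=> /andP[s0 sn] js; have [sn'|ns] := leP s (t n).
      by left; rewrite s0.
    by right; rewrite /B/= ns.
  - by move=> [/andP[-> sn] js]; split=> //=; exact: le_trans tnS.
  - by move=> [/andP[s1 ->] js]; split=> //=; rewrite (le_lt_trans tn0 s1).
have near_left (s : R) (Q : R -> Prop) : t n < s ->
    (\forall r \near s^'-, Q r) -> exists r, t n <= r < s /\ Q r.
  move=> ns /nbhs_ballP[e /= e0 He].
  exists (Num.max (t n) (s - e / 2)).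
  have h : s - e / 2 <= Num.max (t n) (s - e / 2) by rewrite le_max lexx orbT.
  have h' : Num.max (t n) (s - e / 2) < s.
    by rewrite gt_max ns/= ltrBlDr ltrDl divr_gt0.
  split; first by rewrite h' le_max lexx.
  by apply: He => //=; rewrite /ball/= gtr0_norm ?subr_gt0//; lra.
have Bb : B = if b then [set tau] else set0.
  have js s : B s -> s = tau /\ b.
    move=> [/andP[s1 s2] [jx jy gx gy]].
    have [r [/andP[r1 r2] [rx ry]]] := near_left _ _ s1 (filterI jx jy).
    have r3 : t n <= r <= t n.+1 by rewrite r1/= (le_trans (ltW r2)).
    have s3 : t n <= s <= t n.+1 by rewrite (ltW s1).
    have rt : r < tau.
      rewrite ltNge; apply/negP => tr; have [e1 _] := H2 r r3 tr.
      have [e2 _] := H2 s s3 (le_trans tr (ltW r2)).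
      by move: rx; rewrite e1 -e2 gx.
    have ts : tau <= s.
      rewrite leNgt; apply/negP => st; have [e1 _] := H1 s s3 st.
      by have [e2 _] := H1 r r3 rt; move: rx; rewrite e2 -e1 gx.
    have [e1 e2] := H1 _ r3 rt; have [e3 e4] := H2 _ s3 ts.
    have bT : b by rewrite /b -e1 -e2 -e3 -e4 rx ry gx gy.
    (* If [s] came after [tau], the configuration just before [s] would already be the final one, in
       which [x] is empty. *)
    split => //; apply/eqP; rewrite eq_le ts andbT leNgt; apply/negP => lts.
    have [|r' [/andP[r'1 r'2] [r'x [_ tr']]]] :=
        near_left s (fun r => g r x = true /\ g r y = false /\ tau < r) s1.
      near=> r'.
      have a1 : g r' x = true by near: r'; exact: jx.
      have a2 : g r' y = false by near: r'; exact: jy.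
      have a3 : tau < r' by near: r'; exact: nbhs_left_gt.
      by [].
    have r'3 : t n <= r' <= t n.+1 by rewrite r'1/= (le_trans (ltW r'2)).
    by have [e5 _] := H2 _ r'3 (ltW tr'); move: r'x; rewrite e5 -e3 gx.
  case: ifPn => [bT|/negP bF]; apply/seteqP; split => s //=.
  - by move=> /js[].
  - move=> ->; move: bT; rewrite /b => /and4P[b1 /negbTE b2 /negbTE b3 b4].
    (* The two ends of the step differ at [x], so the switch lies strictly after [t n] and not after
       [t n.+1]. *)
    have nt : t n < tau.
      rewrite ltNge; apply/negP => h.
      have n3 : t n <= t n <= t n.+1 by rewrite lexx.
      by have [e1 _] := H2 _ n3 h; move: b1; rewrite e1 b3.
    have tn' : tau <= t n.+1.
      rewrite leNgt; apply/negP => h.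
      have n3 : t n <= t n.+1 <= t n.+1 by rewrite lexx andbT.
      have [e1 _] := H1 _ n3 h.
      by move: b1; rewrite -e1 b3.
    have t3 : t n <= tau <= t n.+1 by rewrite (ltW nt).
    have [e1 e2] := H2 _ t3 (lexx _).
    rewrite /B/= nt tn'; split => //; split; rewrite ?e1 ?e2//.
      near=> r; have rt : r < tau by near: r; exact: nbhs_left_lt.
      have r3 : t n <= r <= t n.+1.
        apply/andP; split; first by near: r; exact: nbhs_left_ge.
        exact: le_trans (ltW rt) tn'.
      by have [-> _] := H1 _ r3 rt.
    near=> r; have rt : r < tau by near: r; exact: nbhs_left_lt.
    have r3 : t n <= r <= t n.+1.
      apply/andP; split; first by near: r; exact: nbhs_left_ge.
      exact: le_trans (ltW rt) tn'.
    by have [_ ->] := H1 _ r3 rt.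
  - by move=> /js[].
have fB : finite_set B by rewrite Bb; case: ifP => _; [exact: finite_set1|].
rewrite AB; split; first by rewrite finite_setU.
rewrite fset_setU// cardfsU.
have -> : (fset_set [set s | 0 < s <= t n /\ jump g x y s] `&` fset_set B)%fset
    = fset0.
  rewrite -fset_setI//.
  have -> : [set s | 0 < s <= t n /\ jump g x y s] `&` B = set0;
    last exact: fset_set0.
  by rewrite -subset0 => s [/= [/andP[_ h1] _] [/andP[h2 _] _]]; lra.
rewrite cardfs0 subn0 cA big_ord_recr/= -/b; congr addn.
by rewrite Bb; case: (b); rewrite ?fset_set0 ?cardfs0// fset_set1 cardfs1.
Unshelve. all: by end_near. Qed.

Lemma one_change_comp (A B : Type) (f : A -> B) (g : R -> A) s s' :
  one_change g s s' -> one_change (f \o g) s s'.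
Proof.
by move=> [tau [H1 H2]]; exists tau; split => r rs rt /=;
  congr f; [exact: H1|exact: H2].
Qed.

Lemma current_partition (g : R -> config) (x : int) (t : nat -> R) n :
  t 0%N = 0 -> (forall i, (i < n)%N -> t i <= t i.+1) ->
  (forall i, (i < n)%N ->
    one_change (fun s => (g s (x - 1), g s x)) (t i) (t i.+1)) ->
  current g x (t n) = \sum_(i < n) phi x (g (t i)) (g (t i.+1)).
Proof.
move=> t0 tS oc.
have [_ e1] := jump_count t0 tS oc.
have oc' i : (i < n)%N ->
    one_change (fun s => (g s x, g s (x - 1))) (t i) (t i.+1).
  by move=> /oc/(one_change_comp (fun p => (p.2, p.1))).
have [_ e2] := jump_count t0 tS oc'.
by rewrite /current e1 e2 !(big_morph Posz PoszD (erefl _)) -sumrB.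
Qed.

Lemma cadlag_pair (A B : Type) (f : R -> A) (g : R -> B) :
  cadlag f -> cadlag g -> cadlag (fun t => (f t, g t)).
Proof.
move=> [fr fl] [gr gl]; split => t t0.
  by apply: filterS2 (fr t t0) (gr t t0) => s -> ->.
have [a Ha] := fl t t0; have [b Hb] := gl t t0.
by exists (a, b); apply: filterS2 Ha Hb => s -> ->.
Qed.

Lemma cadlag_seq (I A : Type) (f : I -> R -> A) (l : seq I) :
  (forall i, cadlag (f i)) -> cadlag (fun t => [seq f i t | i <- l]).
Proof.
move=> fc; elim: l => [|i l [IHr IHl]] /=.
  by split=> t t0; [exact: nearW|exists [::]; exact: nearW].
have [fr fl] := fc i; split=> t t0.
  by apply: filterS2 (fr t t0) (IHr t t0) => s -> ->.
have [a Ha] := fl t t0; have [b Hb] := IHl t t0.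
by exists (a :: b); apply: filterS2 Ha Hb => s -> ->.
Qed.

Variables (g : R -> config) (gc : forall x, cadlag (g^~ x)).

Lemma current_fine_partition (x : int) (t : R) : 0 <= t ->
  exists m0, forall m, (m0 <= m)%N -> (0 < m)%N ->
    current g x t =
    \sum_(i < m) phi x (g (t * i%:R / m%:R)) (g (t * i.+1%:R / m%:R)).
Proof.
move=> t0.
have [m0 H] := ex_fine_partition t0 (cadlag_pair (gc (x - 1)) (gc x)).
exists m0 => m mm m_gt0.
have mR : (0 : R) < m%:R by rewrite ltr0n.
have := @current_partition g x (fun i => t * i%:R / m%:R) m.
rewrite mulfK ?gt_eqF//; apply.
- by rewrite mulr0 mul0r.
- by move=> i im; rewrite ler_pM2r ?invr_gt0// ler_wpM2l// ler_nat.
- by move=> i im; exact: H.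
Qed.

(** The partition of [[0, s]] is extended by the single step from [s] to [s'], so that
    [current_partition] applies at both times. *)
Lemma current_step (x : int) (s s' : R) : 0 <= s -> s <= s' ->
  one_change (fun s => (g s (x - 1), g s x)) s s' ->
  current g x s' = current g x s + phi x (g s) (g s').
Proof.
move=> s0 ss' oc.
have [m0 H] := ex_fine_partition s0 (cadlag_pair (gc (x - 1)) (gc x)).
pose m := m0.+1.
have mR : (0 : R) < m%:R by rewrite ltr0n.
pose t i : R := if (i <= m)%N then s * i%:R / m%:R else s'.
have tm : t m = s by rewrite /t leqnn mulfK ?gt_eqF.
have tmS : t m.+1 = s' by rewrite /t ltnn.
have t_0 : t 0%N = 0 by rewrite /t mulr0 mul0r.
have tS i : (i < m)%N -> t i <= t i.+1.
  move=> im; rewrite /t im (ltnW im).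
  by rewrite ler_pM2r ?invr_gt0// ler_wpM2l// ler_nat.
have toc i : (i < m)%N ->
    one_change (fun s => (g s (x - 1), g s x)) (t i) (t i.+1).
  by move=> im; rewrite /t im (ltnW im); exact: H.
rewrite -{1}tmS (@current_partition g x t m.+1)//.
- by rewrite big_ord_recr/= -(@current_partition g x t m)// tm tmS.
- move=> i; rewrite ltnS leq_eqVlt => /orP[/eqP ->|]; last exact: tS.
  by rewrite tm tmS.
- move=> i; rewrite ltnS leq_eqVlt => /orP[/eqP ->|]; last exact: toc.
  by rewrite tm tmS.
Qed.

Lemma current0 x : current g x 0 = 0.
Proof.
have [//|m0 /(_ m0.+1 (leqnSn _) isT) ->] := @current_fine_partition x 0.
apply: big1 => i _; rewrite !mul0r /phi.
by case: (g 0 x); case: (g 0 (x - 1)).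
Qed.

Lemma phi_id x (e : config) : phi x e e = 0.
Proof. by rewrite /phi; case: (e x); case: (e (x - 1)). Qed.

Lemma near_right_window (t : R) (l : seq int) : 0 <= t ->
  \forall s \near t^'+, forall x, x \in l -> g s x = g t x.
Proof.
move=> t0; elim: l => [|y l IH]; first exact: nearW.
have [H _] := gc y; apply: filterS2 (H t t0) IH => s h1 h2 x.
by rewrite inE => /orP[/eqP ->|/h2].
Qed.

Lemma near_left_window (t : R) (e : config) (l : seq int) :
  (forall x, left_lim (g^~ x) t (e x)) ->
  \forall s \near t^'-, forall x, x \in l -> g s x = e x.
Proof.
move=> t0; elim: l => [|y l IH]; first exact: nearW.
apply: filterS2 (t0 y) IH => s h1 h2 x.
by rewrite inE => /orP[/eqP ->|/h2].
Qed.

Lemma ex_left_config (t : R) : 0 < t ->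
  exists e : config, forall x, left_lim (g^~ x) t (e x).
Proof.
move=> t0.
have /choice[e He] : forall x, exists b, left_lim (g^~ x) t b.
  by move=> x; have [_ /(_ t t0)] := gc x.
by exists e.
Qed.

Lemma current_right (x : int) (t : R) : 0 <= t ->
  \forall s \near t^'+, current g x s = current g x t.
Proof.
move=> t0.
have := near_right_window [:: x - 1; x] t0.
move=> /nbhs_ballP[e /= e0 He].
have E r : t <= r < t + e -> g r (x - 1) = g t (x - 1) /\ g r x = g t x.
  rewrite le_eqVlt => /andP[/orP[/eqP <- //|tr] re].
  have h : ball t e r by rewrite /ball/= ltr0_norm; lra.
  by split; apply: (He r h) => //; rewrite !inE eqxx ?orbT.
apply/nbhs_ballP; exists e => //= s; rewrite /ball/= => ts' ts.
have ste : s < t + e by move: ts'; rewrite ltr0_norm; lra.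
have [E1 E2] : g s (x - 1) = g t (x - 1) /\ g s x = g t x.
  by apply: E; rewrite (ltW ts).
rewrite (@current_step x t s)//; [|exact: ltW|].
  by rewrite /phi E1 E2; case: (g t x); case: (g t (x - 1)); rewrite addr0.
exists t; split => r /andP[r1 r2] h; first by exfalso; lra.
by have [|-> ->] := E r; [lra|rewrite E1 E2].
Qed.

Lemma current_left (x : int) (t : R) (e : config) : 0 < t ->
  (forall x, left_lim (g^~ x) t (e x)) ->
  \forall s \near t^'-, current g x t = current g x s + phi x e (g t).
Proof.
move=> t0 eP.
have [e1 /= e10 He1] : \forall s \near t^'-, forall y,
  y \in [:: x - 1; x] -> g s y = e y by exact: near_left_window.
have E r : t - e1 < r < t -> g r (x - 1) = e (x - 1) /\ g r x = e x.
  move=> /andP[h1 h2].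
  have h : ball t e1 r by rewrite /ball/= gtr0_norm; lra.
  by split; apply: (He1 r h) => //; rewrite !inE eqxx ?orbT.
near=> s.
have s0 : 0 <= s by near: s; exact: nbhs_left_ge.
have st : s < t by near: s; exact: nbhs_left_lt.
have se : t - e1 < s.
  by near: s; apply: nbhs_left_gt; rewrite ltrBlDr ltrDl.
have [E1 E2] : g s (x - 1) = e (x - 1) /\ g s x = e x.
  by apply: E; rewrite se st.
rewrite (@current_step x s t s0 (ltW st)); first by rewrite /phi E1 E2.
exists t; split => r /andP[r1 r2] h.
  by have [|-> ->] := E r; [lra|rewrite E1 E2].
by have -> : r = t by lra.
Unshelve. all: by end_near. Qed.

End paths.

(** * Exchanges and signed counts of particles *)

Definition swap (b x : int) : int :=
  if x == b then b + 1 else if x == b + 1 then b else x.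

Lemma exchangeE b (e : config) x : exchange b e x = e (swap b x).
Proof. by rewrite /exchange /swap; case: ifP => // _; case: ifP. Qed.

Lemma swapK b : involutive (swap b).
Proof.
move=> x; rewrite /swap; case: (eqVneq x b) => [->|xb].
  by rewrite eqxx; case: eqVneq => //; lia.
case: (eqVneq x (b + 1)) => [->|xb1]; first by rewrite eqxx.
by rewrite (negbTE xb) (negbTE xb1).
Qed.

Definition exchanged (e e' : config) : Prop :=
  e' =1 e \/ exists b, e' =1 exchange b e.

Lemma phi_exchange (x b : int) (e : config) :
  phi x e (exchange b e) =
  if b == x - 1 then (e (x - 1))%:Z - (e x)%:Z else 0.
Proof.
rewrite /phi !exchangeE /swap.
have [->|bx] := eqVneq b (x - 1).
  rewrite subrK !eqxx; case: eqVneq => [|_]; first lia.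
  by case: (e x); case: (e (x - 1)).
have [xb|xb] := eqVneq x b.
  have -> : (x - 1 == b + 1) = false by apply/eqP; lia.
  by case: (e (x - 1)); case: (e x); rewrite ?andbF.
have -> : (x == b + 1) = false by apply: contra_neqF bx => /eqP; lia.
by case: (e x); case: (e (x - 1)); rewrite ?andbF.
Qed.

Lemma eq_phi x (e1 e2 e1' e2' : config) :
  e1 (x - 1) = e2 (x - 1) -> e1 x = e2 x ->
  e1' (x - 1) = e2' (x - 1) -> e1' x = e2' x -> phi x e1 e1' = phi x e2 e2'.
Proof. by rewrite /phi => -> -> -> ->. Qed.

(** Local conservation of particles: what enters through [{x - 1, x}] and does not leave through
    [{x, x + 1}] stays at [x]. *)
Lemma phi_exchanged x (e e' : config) : exchanged e e' ->
  phi x e e' - phi (x + 1) e e' = (e' x)%:Z - (e x)%:Z.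
Proof.
move=> [ee'|[b ee']].
  rewrite !(@eq_phi _ e e e' e)// !phi_id ee'; lia.
rewrite !(@eq_phi _ e e e' (exchange b e))// !phi_exchange ee' exchangeE /swap.
rewrite addrK; have [->|bx] := eqVneq b (x - 1).
  have -> : (x - 1 == x) = false by apply/eqP; lia.
  have -> : (x == x - 1) = false by apply/eqP; lia.
  by rewrite subrK eqxx; lia.
have [->|xb] := eqVneq b x; first lia.
have -> : (x == b + 1) = false by apply: contra_neqF bx => /eqP; lia.
lia.
Qed.

(* The signed number of particles in [a, a + k): for [k < 0] it is minus the
   number of particles in [a + k, a). *)
Definition scount (e : config) (a k : int) : int :=
  match k with
  | Posz n => \sum_(i < n) (e (a + i%:Z))%:Z
  | Negz n => - \sum_(i < n.+1) (e (a - 1 - i%:Z))%:Z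
  end.

Lemma scountS e a k : scount e a (k + 1) = scount e a k + (e (a + k))%:Z.
Proof.
case: k => [n|[|n]].
- by rewrite -PoszD addn1/= big_ord_recr.
- by rewrite /= big_ord0 big_ord_recr big_ord0/= add0r subr0 addNr.
- have -> : Negz n.+1 + 1 = Negz n by rewrite !NegzE; lia.
  rewrite /= [in RHS]big_ord_recr/= opprD.
  have -> : a - 1 - n.+1%:Z = a + Negz n.+1 by rewrite NegzE; lia.
  by rewrite subrK.
Qed.

Lemma int_funD_eq (F G : int -> int) : F 0 = G 0 ->
  (forall k, F (k + 1) - F k = G (k + 1) - G k) -> F =1 G.
Proof.
move=> FG0 FG; case=> n; elim: n => [|n IH].
- exact: FG0.
- have -> : n.+1%:Z = n%:Z + 1 by lia.
  by apply: (addIr (- F n%:Z)); rewrite FG IH.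
- by have := FG (-1); rewrite addNr FG0 => /addrI/oppr_inj.
- have := FG (Negz n.+1).
  have -> : Negz n.+1 + 1 = Negz n by rewrite !NegzE; lia.
  by rewrite IH => /addrI/oppr_inj.
Qed.

Lemma scount0 e a : scount e a 0 = 0.
Proof. by rewrite /= big_ord0. Qed.

(** The count changes only if the exchanged bond straddles one of the two ends of the interval; the
    signed formula covers negative [k] as well. *)
Lemma scount_exchange e b a k :
  scount (exchange b e) a k = scount e a k +
  ((e (b + 1))%:Z - (e b)%:Z) * ((a + k == b + 1)%:Z - (a == b + 1)%:Z).
Proof.
move: k; apply: int_funD_eq; first by rewrite !scount0 addr0; lia.
move=> k; rewrite !scountS exchangeE /swap addrA.
have -> : (a + k + 1 == b + 1) = (a + k == b) by apply/eqP/eqP; lia.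
have [->|_] := eqVneq (a + k) b.
  have -> : (b == b + 1) = false by apply/eqP; lia.
  by case: (a == b + 1); lia.
by case: eqVneq => [->|_]; lia.
Qed.

Definition scount_sites (a k : int) : seq int :=
  [seq a + i%:Z | i <- iota 0 `|k|] ++ [seq a - 1 - i%:Z | i <- iota 0 `|k|].

Lemma eq_scount (e e' : config) a k :
  (forall x, x \in scount_sites a k -> e x = e' x) ->
  scount e a k = scount e' a k.
Proof.
rewrite /scount_sites; case: k => n H /=.
  apply: eq_bigr => i _; rewrite H// mem_cat; apply/orP; left.
  by apply/mapP; exists (i : nat) => //; rewrite mem_iota/=.
congr (- _); apply: eq_bigr => i _; rewrite H// mem_cat; apply/orP; right.
by apply/mapP; exists (i : nat) => //; rewrite mem_iota/=.
Qed.

(** The local form of the identity between the current through [{a - 1, a}] and the particles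
    between [a] and the tagged one. If the tagged particle stays at [y], an exchange touching [y]
    meets another particle and changes nothing; if it moves, the exchanged bond is the one between
    [y] and [y']. *)
Lemma tagged_step (a y y' : int) (e e' : config) :
  exchanged e e' -> e y -> e' y' ->
  y' = y \/ (y' = y + 1 \/ y' = y - 1) /\ ~~ e y' /\ ~~ e' y ->
  phi a e e' = scount e' a (y' - a) - scount e a (y - a).
Proof.
move=> [ee'|[b ee']] ey ey'.
  move=> [->|[_ [h1 h2]]]; last by move: ey'; rewrite ee' (negbTE h1).
  rewrite (@eq_phi _ e e e' e)// phi_id (@eq_scount e' e) ?subrr//.
move=> H.
rewrite (@eq_phi _ e e e' (exchange b e))// phi_exchange.
rewrite (@eq_scount e' (exchange b e))//.
have -> : (b == a - 1) = (a == b + 1) by apply/eqP/eqP; lia.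
move: ey'; rewrite ee' exchangeE => ey'.
have P : (if a == b + 1 then (e (a - 1))%:Z - (e a)%:Z else 0) =
         - ((e (b + 1))%:Z - (e b)%:Z) * (a == b + 1)%:Z.
  by case: eqVneq => [->|_]; [rewrite addrK|]; lia.
rewrite P; case: H => [yy'|[H [ey'F e'yF]]].
  rewrite {}yy' in ey' *; rewrite scount_exchange.
  have -> : a + (y - a) = y by lia.
  move: ey'; rewrite /swap; case: (eqVneq y b) => [->|yb].
    have -> : (b == b + 1) = false by apply/eqP; lia.
    by case: (a == b + 1); lia.
  case: (eqVneq y (b + 1)) => [yb1 eb|_ _]; last by case: (a == b + 1); lia.
  by rewrite -yb1 ey eb; case: (a == y); lia.
move: e'yF; rewrite ee' exchangeE => e'yF.
(* Both [y] and [y'] change their occupation, so both belong to the exchanged bond. *)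
have yb : b = y \/ b = y - 1.
  move: e'yF; rewrite /swap; case: (eqVneq y b) => [->|_]; first by left.
  by case: (eqVneq y (b + 1)) => [->|_]; [right; lia|rewrite ey].
have y'b : b = y' \/ b = y' - 1.
  move: ey'; rewrite /swap; case: (eqVneq y' b) => [->|_]; first by left.
  by case: (eqVneq y' (b + 1)) => [->|_]; [right; lia|rewrite (negbTE ey'F)].
case: H => y'E; rewrite {}y'E in ey' ey'F y'b *.
  have -> : y + 1 - a = y - a + 1 by lia.
  have bE : b = y by lia.
  rewrite bE in ey' e'yF *.
  rewrite scountS scount_exchange exchangeE.
  have -> : a + (y - a) = y by lia.
  rewrite (negbTE e'yF) ey (negbTE ey'F).
  have -> : (y == y + 1) = false by apply/eqP; lia.
  by case: (a == y + 1); lia.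
have bE : b = y - 1 by lia.
have := scountS (exchange b e) a (y - 1 - a).
have -> : y - 1 - a + 1 = y - a by lia.
rewrite bE in ey' e'yF *.
rewrite subrK scount_exchange exchangeE.
have -> : a + (y - 1 - a) = y - 1 by lia.
have -> : a + (y - a) = y by lia.
have -> : y - 1 + 1 = y by lia.
by rewrite ey' ey (negbTE ey'F) eqxx; case: (a == y); lia.
Qed.

Section good_paths.
Context {R : realType} (g : R -> config) (gc : forall x, cadlag (g^~ x)).

(** Not part of the notion of a Markov process with the given semigroup; it is shown to hold almost
    surely in [good_path_ae]. *)
Definition good_path : Prop := forall t (e : config), 0 < t ->
  (forall x, left_lim (g^~ x) t (e x)) -> exchanged e (g t).

Hypothesis gg : good_path.

Lemma current_next x t : 0 <= t ->
  current g x t - current g (x + 1) t = (g t x)%:Z - (g 0 x)%:Z.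
Proof.
move=> t0.
suff : current g x t - current g (x + 1) t - (g t x)%:Z = - (g 0 x)%:Z by lia.
have := @locally_constant R int
  (fun t => current g x t - current g (x + 1) t - (g t x)%:Z).
move=> -> //; first by rewrite !current0//; lia.
  move=> s s0; have h := near_right_window gc [:: x] s0.
  near=> r; rewrite (near (current_right gc x s0) r)//.
  rewrite (near (current_right gc (x + 1) s0) r)//.
  by rewrite (near h r)// mem_head.
move=> s s0; have [e eP] := ex_left_config gc s0.
have h := near_left_window [:: x] eP.
near=> r; rewrite (near (current_left gc x s0 eP) r)//.
rewrite (near (current_left gc (x + 1) s0 eP) r)//.
rewrite (near h r) ?mem_head//.
by have := phi_exchanged x (gg s0 eP); lia.
Unshelve. all: by end_near. Qed.

Lemma current_add x n t : 0 <= t ->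
  current g x t = current g (x + n%:Z) t +
                  \sum_(i < n) ((g t (x + i%:Z))%:Z - (g 0 (x + i%:Z))%:Z).
Proof.
move=> t0; elim: n => [|n IH]; first by rewrite big_ord0 !addr0.
rewrite big_ord_recr/= -(current_next (x + n%:Z) t0) IH.
have -> : x + n.+1%:Z = x + n%:Z + 1 by lia.
ring.
Qed.

(** Exact on every good path: the difference of the two sides starts at 0, and no jump changes it,
    by [tagged_step]. *)
Lemma current_tagged a (Y : R -> int) t : tagged_path g a Y -> 0 <= t ->
  current g a t = scount (g t) a (Y t - a).
Proof.
move=> [Y0 [Yr Yl] Yocc Yjump] t0.
suff : current g a t - scount (g t) a (Y t - a) = 0 by lia.
have := @locally_constant R int
  (fun t => current g a t - scount (g t) a (Y t - a)).
move=> -> //; first by rewrite !current0// Y0 subrr scount0.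
  move=> s s0; have h := near_right_window gc (scount_sites a (Y s - a)) s0.
  near=> r; rewrite (near (current_right gc a s0) r)//.
  rewrite (near (Yr s s0) r)//; congr (_ - _).
  by apply: eq_scount => x; exact: (near h r).
move=> s s0; have [e eP] := ex_left_config gc s0.
have [y yP] := Yl s s0.
(* The left limit is occupied at [y] because the tagged particle sits at [y] just before [s]. *)
have ey : e y = true.
  have [r [r0 ry re]] : exists r, [/\ 0 < r, Y r = y & g r y = e y].
    near (s^'-)%R => r; exists r; split; last by near: r; exact: eP.
      by near: r; exact: nbhs_left_gt.
    by near: r; exact: yP.
  by rewrite -re -ry; apply: Yocc; exact: ltW.
have h := near_left_window (scount_sites a (y - a)) eP.
have S : phi a e (g s) = scount (g s) a (Y s - a) - scount e a (y - a).
  apply: tagged_step => //; [exact: gg|exact/Yocc/ltW|].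
  case: (Yjump s y s0 yP) => [->|[H [j1 j2 j3 j4]]]; first by left.
  right; split=> //; rewrite j3; split=> //.
  have [r [r1 r2]] : exists r, g r (Y s) = e (Y s) /\ g r (Y s) = false.
    near (s^'-)%R => r; exists r; split; near: r; [exact: eP|exact: j2].
  by rewrite -r1 r2.
near=> r; rewrite (near (current_left gc a s0 eP) r)//.
have -> : Y r = y by near: r; exact: yP.
rewrite (@eq_scount (g r) e); first lia.
by move=> x; exact: (near h r).
Unshelve. all: by end_near. Qed.

End good_paths.

(** * The semigroup as a limit of mixtures of exchanges *)

Definition agree (L : nat) (e e' : config) : Prop :=
  forall x : int, - L%:Z <= x < L%:Z -> e x = e' x.

(** The half-open window [[-L, L)] has exactly [2 * L] sites, the length of the tuples used by
    [pat]. *)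
Definition local_in (A : Type) (L : nat) (f : config -> A) : Prop :=
  forall e e', agree L e e' -> f e = f e'.

Definition flip (y : int) (e : config) : config :=
  fun x => if x == y then ~~ e x else e x.

Definition exchs (s : seq int) (e : config) : config := foldr exchange e s.

Lemma exchs_cat s s' e : exchs (s ++ s') e = exchs s (exchs s' e).
Proof. by rewrite /exchs foldr_cat. Qed.

Lemma agree_leq L L' e e' : (L <= L')%N -> agree L' e e' -> agree L e e'.
Proof. by move=> LL' H x xL; apply: H; lia. Qed.

Lemma local_in_leq (A : Type) L L' (f : config -> A) :
  (L <= L')%N -> local_in L f -> local_in L' f.
Proof. by move=> LL' fL e e' ee'; apply: fL; exact: agree_leq LL' ee'. Qed.

Definition window (L : nat) : seq int := [seq i%:Z - L%:Z | i <- iota 0 (2 * L)].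

Lemma mem_window L x : (x \in window L) = (- L%:Z <= x < L%:Z).
Proof.
apply/mapP/idP => [[i]|xL]; first by rewrite mem_iota => iL ->; lia.
exists (absz (x + L%:Z)); first by rewrite mem_iota; lia.
lia.
Qed.

Lemma agree_exchange L b e e' :
  agree L.+1 e e' -> agree L (exchange b e) (exchange b e').
Proof.
move=> ee' x xL; rewrite !exchangeE; apply: ee'.
by rewrite /swap; case: ifP; [lia|case: ifP; lia].
Qed.

Lemma agree_exchs L s e e' :
  agree (L + size s) e e' -> agree L (exchs s e) (exchs s e').
Proof.
elim: s L => [|b s IH] L /=; first by rewrite addn0.
by rewrite addnS -addSn => /IH; exact: agree_exchange.
Qed.

Lemma local_in_exchange (A : Type) L b (f : config -> A) :
  - L%:Z <= b < L%:Z - 1 -> local_in L f -> local_in L (f \o exchange b).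
Proof.
move=> bL fL e e' ee'; apply: fL => x xL; rewrite !exchangeE; apply: ee'.
by rewrite /swap; case: ifP; [lia|case: ifP; lia].
Qed.

(** A discrepancy at one site is carried by an exchange to one site, so it never multiplies. The
    comparison of the two initial laws rests on this. *)
Lemma exchange_flip b y e : exchange b (flip y e) = flip (swap b y) (exchange b e).
Proof.
apply/funext => x; rewrite !exchangeE /flip !exchangeE.
by rewrite -[in X in _ = if X then _ else _](inj_eq (inv_inj (swapK b))) swapK.
Qed.

Section local_functions.
Context {R : realType}.

Lemma local_funP (f : config -> R) : local_fun f <-> exists L, local_in L f.
Proof.
split=> [[A HA]|[L fL]].
  exists (\max_(x <- A) `|x|.+1)%N => e e' ee'; apply: HA => x xA; apply: ee'.
  suff : (`|x|.+1 <= \max_(x <- A) `|x|.+1)%N by lia.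
  by rewrite (big_rem _ xA)/= leq_maxl.
exists [fset x in window L]%fset => e e' H; apply: fL => x xL; apply: H.
by rewrite inE/= mem_window.
Qed.

Lemma near_agree L (e : config) : \forall e' \near e, agree L e' e.
Proof.
suff : \forall e' \near e, forall x, x \in window L -> e' x = e x.
  by apply: filterS => e' H x xL; apply: H; rewrite mem_window.
elim: (window L) => [|x l IH]; 
  first by apply: (@nearW config (nbhs e)) => e' x; rewrite in_nil.
have H : \forall e' \near e, e' x = e x.
  exact: (@proj_continuous int (fun=> bool) x e [set e x] (discrete_set1 _)).
apply: filterS2 H IH => e' /= h1 h2 y; rewrite inE => /orP[/eqP -> //|/h2 //].
Qed.

Lemma local_in_continuous L (f : config -> R) : local_in L f -> continuous f.
Proof.
move=> fL e; apply: cvg_near_cst.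
by apply: filterS (near_agree L e) => e' ee'; exact: fL.
Qed.

End local_functions.

Section semigroup.
Context {R : realType} (S : R -> (config -> R) -> config -> R).
Hypothesis Sm : markov_semigroup S.

Lemma semigroup_scaleD t a (f g : config -> R) e :
  0 <= t -> continuous f -> continuous g ->
  S t (fun e => a * f e + g e) e = a * S t f e + S t g e.
Proof. by move=> *; exact: semigroup_linear. Qed.

Lemma semigroupB t (f g : config -> R) e :
  0 <= t -> continuous f -> continuous g ->
  S t (fun e => f e - g e) e = S t f e - S t g e.
Proof.
move=> t0 cf cg.
have -> : (fun e => f e - g e) = (fun e => -1 * g e + f e).
  by apply/funext => x; ring.
by rewrite semigroup_scaleD//; ring.
Qed.

Lemma semigroup_cst t (a : R) e : 0 <= t -> S t (fun=> a) e = a.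
Proof.
move=> t0; have c1 : continuous (fun _ : config => 1 : R) by move=> x; exact: cvg_cst.
have -> : (fun=> a) = (fun x : config => (a - 1) * (fun=> 1) x + (fun=> 1) x).
  by apply/funext => x; ring.
by rewrite semigroup_scaleD// semigroup1//; ring.
Qed.

Lemma semigroup_sum t (I : Type) (l : seq I) (c : I -> R)
    (F : I -> config -> R) e : 0 <= t -> (forall i, continuous (F i)) ->
  S t (fun e => \sum_(i <- l) c i * F i e) e = \sum_(i <- l) c i * S t (F i) e.
Proof.
move=> t0 Fc; elim: l e => [|i l IH] e.
  rewrite big_nil -[RHS](@semigroup_cst t 0 e t0); congr S.
  by apply/funext => x; rewrite big_nil.
rewrite big_cons -IH -semigroup_scaleD//.
  by congr S; apply/funext => x; rewrite big_cons.
elim: l {IH} => [|j l IHl].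
  rewrite (_ : (fun _ => _) = fun=> 0); first by move=> x; exact: cvg_cst.
  by apply/funext => x; rewrite big_nil.
rewrite (_ : (fun _ => _) =
  (fun x => c j * F j x + \sum_(i <- l) c i * F i x)).
  move=> x; apply: cvgD; last exact: IHl.
  by apply: cvgM; [exact: cvg_cst|exact: Fc].
by apply/funext => x; rewrite big_cons.
Qed.

Lemma semigroup_le t (f g : config -> R) e :
  0 <= t -> continuous f -> continuous g ->
  (forall e, f e <= g e) -> S t f e <= S t g e.
Proof.
move=> t0 cf cg fg; rewrite -subr_ge0 -semigroupB//.
apply: semigroup_ge0 => //; last by move=> x; rewrite subr_ge0.
by move=> x; apply: cvgB; [exact: cg|exact: cf].
Qed.

Lemma semigroup_norm_le t (f : config -> R) M e :
  0 <= t -> continuous f -> (forall e, `|f e| <= M) -> `|S t f e| <= M.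
Proof.
move=> t0 cf fM; rewrite ler_norml -{1}(@semigroup_cst t (- M) e)//.
rewrite -{2}(@semigroup_cst t M e)//; apply/andP; split; apply: semigroup_le => //;
  try (by move=> x; exact: cvg_cst); move=> x; have := fM x;
  by rewrite ler_norml => /andP[].
Qed.

End semigroup.

Section mixtures.
Context {R : realType}.

Definition mixture (A : eqType) (q : seq (R * A)) : Prop :=
  (forall p, p \in q -> 0 <= p.1) /\ \sum_(p <- q) p.1 = 1.

Definition mix (q : seq (R * seq int)) (f : config -> R) (e : config) : R :=
  \sum_(p <- q) p.1 * f (exchs p.2 e).

Lemma mix_norm_le q f M e : mixture q -> (forall e, `|f e| <= M) ->
  `|mix q f e| <= M.
Proof.
move=> [q0 q1] fM; apply: (le_trans (ler_norm_sum _ _ _)).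
rewrite -[leRHS]mul1r -q1 mulr_suml big_seq [leRHS]big_seq.
by apply: ler_sum => p /q0 p0; rewrite normrM ger0_norm// ler_wpM2l.
Qed.

Lemma mixture_id : mixture [:: (1, [::] : seq int)].
Proof.
split; last by rewrite big_seq1.
by move=> p; rewrite inE => /eqP ->.
Qed.

(** In [mix q1 (mix q2 f)] the exchanges of [q1] act on the configuration first; since [exchs] lets
    the last element of a list act first, they are put last. *)
Definition mix_comp (q1 q2 : seq (R * seq int)) : seq (R * seq int) :=
  [seq (p1.1 * p2.1, p2.2 ++ p1.2) | p1 <- q1, p2 <- q2].

Lemma mix_compE q1 q2 f e : mix (mix_comp q1 q2) f e = mix q1 (mix q2 f) e.
Proof.
rewrite /mix /mix_comp big_allpairs_dep; apply: eq_bigr => p1 _.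
rewrite mulr_sumr; apply: eq_bigr => p2 _ /=.
by rewrite exchs_cat mulrA.
Qed.

Lemma mixture_comp q1 q2 : mixture q1 -> mixture q2 -> mixture (mix_comp q1 q2).
Proof.
move=> [q10 q11] [q20 q21]; split.
  by move=> p /allpairsP[[p1 p2] /= [/q10 h1 /q20 h2 ->]] /=; rewrite mulr_ge0.
rewrite big_allpairs_dep/= -[RHS]q11; apply: eq_bigr => p1 _.
by rewrite -mulr_sumr q21 mulr1.
Qed.

End mixtures.

Section generators.
Context {R : realType} (S : R -> (config -> R) -> config -> R).
Hypothesis Sm : markov_semigroup S.
Variables (r : int -> R) (c : R).
Hypothesis rc : forall b, 0 <= r b <= c.

Definition gen (f : config -> R) (e : config) : R :=
  \sum_(x \in [set: int]) r x * (f (exchange x e) - f e).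

Hypothesis Sg : has_generator S gen.

Definition bonds (L : nat) : seq int :=
  [seq i%:Z - L%:Z | i <- iota 0 (2 * L).-1].

Lemma mem_bonds L x : (x \in bonds L) = (- L%:Z <= x < L%:Z - 1).
Proof.
apply/mapP/idP => [[i]|xL]; first by rewrite mem_iota => iL ->; lia.
exists (absz (x + L%:Z)); first by rewrite mem_iota; lia.
lia.
Qed.

Lemma bonds_uniq L : uniq (bonds L).
Proof. by rewrite map_inj_uniq ?iota_uniq// => i j; lia. Qed.

(** [bonds] lists the bonds with both ends in the window; the two added ones cross its boundary, and
    every other bond leaves functions of the window unchanged. *)
Definition bonds1 L : seq int := [:: - L%:Z - 1, L%:Z - 1 & bonds L].

Lemma genE L f e : (0 < L)%N -> local_in L f ->
  gen f e = \sum_(b <- bonds1 L) r b * (f (exchange b e) - f e).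
Proof.
move=> L0 fL; rewrite /gen (fsbigE (bonds1 L))//=.
- by apply: eq_bigl => b; rewrite in_setT.
- by rewrite !inE !mem_bonds bonds_uniq andbT; lia.
- move=> b _; rewrite !inE mem_bonds => bL.
  rewrite (fL (exchange b e) e) ?subrr ?mulr0// => x xL.
  rewrite exchangeE; congr e; rewrite /swap.
  by case: ifP; [lia|case: ifP; lia].
Qed.

(** An Euler step of length [h] that ignores the two boundary bonds: the window does not grow under
    iteration, so that all the iterates are functions of the same window. *)
Definition avg (L : nat) (h : R) (f : config -> R) (e : config) : R :=
  f e + h * \sum_(b <- bonds L) r b * (f (exchange b e) - f e).

(** The identity gets the weight that is left, which the condition on [h] makes nonnegative. *)
Lemma avg_mix L h : 0 <= h -> h * \sum_(b <- bonds L) r b <= 1 ->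
  exists2 q, mixture q & forall f e, avg L h f e = mix q f e.
Proof.
move=> h0; rewrite /avg; move: (bonds L) => l h1.
exists ((1 - h * \sum_(b <- l) r b, [::]) :: [seq (h * r b, [:: b]) | b <- l]).
  split.
    move=> p; rewrite inE => /orP[/eqP ->|/mapP[b _ ->]] /=; first lra.
    by rewrite mulr_ge0//; have /andP[] := rc b.
  by rewrite big_cons big_map/= -mulr_sumr subrK.
move=> f e; rewrite /mix big_cons big_map/=.
rewrite (eq_bigr (fun b => r b * f (exchange b e) - r b * f e)); last first.
  by move=> b _; rewrite mulrBr.
rewrite sumrB -mulr_suml mulrBr mulrBl mul1r.
rewrite [X in _ = _ + X](eq_bigr (fun b => h * (r b * f (exchange b e))));
  last first.
  by move=> b _; rewrite mulrA.
by rewrite -mulr_sumr; ring.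
Qed.

Lemma iter_avg_mix L h k : 0 <= h -> h * \sum_(b <- bonds L) r b <= 1 ->
  exists2 q, mixture q & forall f e, iter k (avg L h) f e = mix q f e.
Proof.
move=> h0 h1; have [q qm qE] := avg_mix h0 h1.
elim: k => [|k [q' q'm q'E]].
  exists [:: (1, [::])]; first exact: mixture_id.
  by move=> f e; rewrite /mix big_seq1 mul1r.
exists (mix_comp q q'); first exact: mixture_comp.
move=> f e; rewrite mix_compE/= qE; apply: eq_bigr => p _.
by rewrite q'E.
Qed.

Lemma local_in_avg L h f : local_in L f -> local_in L (avg L h f).
Proof.
move=> fL e e' ee'; rewrite /avg (fL _ _ ee'); congr (_ + _ * _).
rewrite big_seq [RHS]big_seq; apply: eq_bigr => b; rewrite mem_bonds => bL.
by have /(_ _ _ ee')/= -> := local_in_exchange bL fL.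
Qed.

Definition osc (w : int -> R) (f : config -> R) : Prop :=
  forall y e, `|f (flip y e) - f e| <= w y.

Lemma sum_touching L y : \sum_(b <- bonds L)
  ((b == y)%:R + (b == y - 1)%:R) <= 2 :> R.
Proof.
have H z : \sum_(b <- bonds L) (b == z)%:R <= 1 :> R.
  have -> : \sum_(b <- bonds L) (b == z)%:R = (count_mem z (bonds L))%:R :> R.
    rewrite -sum1_count natr_sum [RHS]big_mkcond/=.
    by apply: eq_bigr => b _; case: eqP.
  by rewrite lern1 count_uniq_mem ?bonds_uniq// leq_b1.
rewrite big_split/= -[leRHS]/(1 + 1); exact: lerD.
Qed.

(** A step leaves the flipped site in place or moves it along one of the two bonds that touch it.
    Each such move has rate at most [c] and at most doubles the weight, hence the growth
    [2 * c * h]. *)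
Lemma osc_avg L h w f : 0 <= h -> h * \sum_(b <- bonds L) r b <= 1 ->
  (forall y, 0 <= w y) -> (forall b y, w (swap b y) <= 2 * w y) ->
  osc w f -> osc (fun y => (1 + 2 * c * h) * w y) (avg L h f).
Proof.
move=> h0 h1 w0 w2 fw y e.
have c0 : 0 <= c by have /andP[] := rc 0; exact: le_trans.
have E : avg L h f (flip y e) - avg L h f e =
    (1 - h * \sum_(b <- bonds L) r b) * (f (flip y e) - f e) +
    h * \sum_(b <- bonds L) r b *
      (f (flip (swap b y) (exchange b e)) - f (exchange b e)).
  rewrite /avg mulrBl mul1r -mulrA mulr_suml.
  rewrite opprD addrACA -mulrBr -sumrB -[RHS]addrA; congr (_ + _).
  rewrite addrC -mulrBr -sumrB; congr (_ * _); apply: eq_bigr => b _.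
  by rewrite exchange_flip; ring.
have h1' : 0 <= 1 - h * \sum_(b <- bonds L) r b by lra.
rewrite E; apply: (le_trans (ler_normD _ _)).
rewrite normrM (ger0_norm h1') [X in _ + X]normrM (ger0_norm h0).
apply: (@le_trans _ _ ((1 - h * \sum_(b <- bonds L) r b) * w y +
   h * \sum_(b <- bonds L) r b * w (swap b y))).
  apply: lerD; first exact: ler_wpM2l.
  rewrite ler_wpM2l//; apply: (le_trans (ler_norm_sum _ _ _)).
  apply: ler_sum => b _; have /andP[rb0 _] := rc b.
  by rewrite normrM ger0_norm// ler_wpM2l.
rewrite (_ : (1 - _) * _ + _ = w y +
    h * \sum_(b <- bonds L) r b * (w (swap b y) - w y)); last first.
  rewrite [in RHS](eq_bigr (fun b => r b * w (swap b y) - r b * w y)); last first.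
    by move=> b _; rewrite mulrBr.
  by rewrite sumrB -mulr_suml; ring.
rewrite mulrDl mul1r lerD2l.
apply: (@le_trans _ _ (h * \sum_(b <- bonds L)
   (c * w y) * ((b == y)%:R + (b == y - 1)%:R))).
  rewrite ler_wpM2l//; apply: ler_sum => b _.
  have /andP[rb0 rbc] := rc b; have wy := w0 y; have w2y := w2 b y.
  have [tb|ntb] := boolP ((b == y) || (b == y - 1)).
    have : 1 <= (b == y)%:R + (b == y - 1)%:R :> R.
      by case/orP: tb => ->; rewrite ?lerDl ?lerDr.
    move=> t1; apply: (@le_trans _ _ (c * w y)).
      apply: (@le_trans _ _ (r b * w y)); last exact: ler_wpM2r.
      by rewrite ler_wpM2l//; lra.
    by rewrite ler_peMr// mulr_ge0.
  have -> : swap b y = y.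
    by move: ntb; rewrite /swap negb_or; case: ifP; [lia|case: ifP; lia].
  by rewrite subrr mulr0 !mulr_ge0 ?addr_ge0.
rewrite -mulr_sumr; have := sum_touching L y; set s := \sum_(b <- _) _ => s2.
have cw : 0 <= c * w y by rewrite mulr_ge0.
have -> : 2 * c * h * w y = h * ((c * w y) * 2) by ring.
by rewrite ler_wpM2l// ler_wpM2l.
Qed.

Definition pat (L : nat) (e : config) : (2 * L).-tuple bool :=
  [tuple e (i%:Z - L%:Z) | i < 2 * L].

Definition ext (L : nat) (z : (2 * L).-tuple bool) : config :=
  fun x => if - L%:Z <= x < L%:Z then nth false z (absz (x + L%:Z)) else false.

Lemma ext_pat L e : agree L (ext (pat L e)) e.
Proof.
move=> x xL; rewrite /ext xL /pat.
have kL : (absz (x + L%:Z)%R < 2 * L)%N by lia.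
rewrite -[absz _]/(nat_of_ord (Ordinal kL)) -tnth_nth tnth_mktuple/=.
congr e; lia.
Qed.

Lemma eq_pat L e e' : agree L e e' -> pat L e = pat L e'.
Proof. by move=> H; apply: eq_mktuple => i; apply: H; have := ltn_ord i; lia. Qed.

Lemma local_in_sum L (f : config -> R) e : local_in L f ->
  f e = \sum_(z : (2 * L).-tuple bool) f (ext z) * (pat L e == z)%:R.
Proof.
move=> fL; rewrite (bigD1 (pat L e))//= eqxx mulr1 big1 ?addr0.
  by rewrite (fL _ _ (ext_pat e)).
by move=> z zp; rewrite eq_sym (negbTE zp) mulr0.
Qed.

Lemma local_in_pat L z : local_in L (fun e => (pat L e == z)%:R : R).
Proof. by move=> e e' /eq_pat ->. Qed.

(* Local functions with a given window form a finite-dimensional space. *)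
Lemma generator_uniform L M eps : (0 < L)%N -> 0 <= M -> 0 < eps ->
  exists2 delta, 0 < delta & forall h f, 0 < h < delta -> local_in L f ->
    (forall e, `|f e| <= M) ->
    forall e, `|S h f e - f e - h * gen f e| <= h * eps.
Proof.
move=> L0 M0 eps0.
pose I := ((2 * L).-tuple bool : finType).
pose N : R := #|I|%:R * M + 1.
have N0 : 0 < N by rewrite ltr_pwDr// mulr_ge0.
pose ind (z : I) e : R := (pat L e == z)%:R.
(* Finitely many patterns: one threshold serves all their indicators. A function of the window
   bounded by [M] is a combination of them with coefficients at most [M], whence the share [eps / N]
   of each. *)
have : \forall t \near 0^'+, forall z e,
    `|(S t (ind z) e - ind z e) / t - gen (ind z) e| <= eps / N.
  apply: filter_forall => z; apply: Sg; last by rewrite divr_gt0.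
  by apply/local_funP; exists L; exact: local_in_pat.
move=> [d /= d0 Hd]; exists d => // h f /andP[h0 hd] fL fM e.
have {}Hd z : `|S h (ind z) e - ind z e - h * gen (ind z) e| <= h * (eps / N).
  have := Hd h; rewrite /ball/= sub0r normrN gtr0_norm// => /(_ hd h0 z e).
  set a := S h _ _ - _ => H.
  have -> : a - h * gen (ind z) e = h * (a / h - gen (ind z) e).
    by rewrite mulrBr mulrCA divff ?mulr1// gt_eqF.
  by rewrite normrM gtr0_norm// ler_wpM2l// ltW.
have fE : f = fun e => \sum_z f (ext z) * ind z e.
  by apply/funext => x; exact: local_in_sum.
have SfE : S h f e = \sum_z f (ext z) * S h (ind z) e.
  rewrite {1}fE; apply: (semigroup_sum Sm) => //; first exact: ltW.
  by move=> z; apply: (local_in_continuous (L := L)); exact: local_in_pat.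
have gfE : gen f e = \sum_z f (ext z) * gen (ind z) e.
  rewrite (genE _ L0 fL).
  rewrite [RHS](eq_bigr (fun z => \sum_(b <- bonds1 L)
     f (ext z) * (r b * (ind z (exchange b e) - ind z e)))); last first.
    move=> z _; rewrite (genE _ L0) ?mulr_sumr//; exact: local_in_pat.
  rewrite exchange_big; apply: eq_bigr => b _.
  rewrite (local_in_sum (exchange b e) fL) (local_in_sum e fL) -sumrB mulr_sumr.
  by apply: eq_bigr => z _; rewrite /ind; ring.
rewrite SfE (local_in_sum e fL) gfE mulr_sumr -!sumrB.
apply: (le_trans (ler_norm_sum _ _ _)).
apply: (@le_trans _ _ (\sum_(z : I) M * (h * (eps / N)))).
  apply: ler_sum => z _.
  rewrite [X in `|X|](_ : _ =
    f (ext z) * (S h (ind z) e - ind z e - h * gen (ind z) e)); last first.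
    by rewrite /ind; ring.
  by rewrite normrM ler_pM.
rewrite sumr_const -[leLHS]mulr_natl.
have -> : #|I|%:R * (M * (h * (eps / N))) = (h * eps) * ((#|I|%:R * M) / N).
  by ring.
rewrite ler_piMr//; first by rewrite mulr_ge0 ?ltW.
by rewrite ler_pdivrMr// mul1r /N lerDl.
Qed.

(** Through a boundary bond only the inner site is seen: the exchange either leaves it as it is or
    flips it, so the oscillation at that site controls the bond. *)
Lemma exchange_right_boundary L (f : config -> R) e b : local_in L f -> b = L%:Z - 1 ->
  f (exchange b e) = f e \/ f (exchange b e) = f (flip b e).
Proof.
move=> fL bE.
have [E|E] := eqVneq (e (b + 1)) (e b).
  left; apply: fL => x xL; rewrite exchangeE /swap.
  by case: eqVneq => [->//|_]; case: eqVneq => // xb; lia.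
right; apply: fL => x xL; rewrite exchangeE /swap /flip.
case: eqVneq => [->|_]; first by move: E; case: (e _); case: (e _).
by case: eqVneq => // xb; lia.
Qed.

Lemma exchange_left_boundary L (f : config -> R) e b : local_in L f -> b = - L%:Z - 1 ->
  f (exchange b e) = f e \/ f (exchange b e) = f (flip (b + 1) e).
Proof.
move=> fL bE.
have [E|E] := eqVneq (e (b + 1)) (e b).
  left; apply: fL => x xL; rewrite exchangeE /swap.
  case: eqVneq => [xb|_]; first lia.
  by case: eqVneq => [->|//]; rewrite E.
right; apply: fL => x xL; rewrite exchangeE /swap /flip.
case: eqVneq => [xb|_]; first lia.
by case: eqVneq => // ->; move: E; case: (e _); case: (e _).
Qed.

Lemma c_ge0 : 0 <= c.
Proof. by have /andP[h1 h2] := rc 0; exact: le_trans h2. Qed.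

(** Only the two boundary bonds separate [gen] from [avg]; each acts as a flip of an outermost site,
    [L] or [- L.+1], or not at all. *)
Lemma gen_avg_le L h f w W e : 0 <= h -> local_in L.+1 f -> osc w f ->
  w L%:Z <= W -> w (- L.+1%:Z) <= W ->
  `|f e + h * gen f e - avg L.+1 h f e| <= h * (2 * c * W).
Proof.
move=> h0 fL fw w1 w2; rewrite (genE _ _ fL)// /bonds1 !big_cons /avg.
set A := \sum_(b <- _) _; set a1 := _ * (_ - _); set a2 := _ * (_ - _).
have -> : f e + h * (a1 + (a2 + A)) - (f e + h * A) = h * (a1 + a2) by ring.
rewrite normrM ger0_norm// ler_wpM2l//.
have W0 : 0 <= W by apply: (le_trans _ w1); apply: le_trans (fw _ e).
have c0 := c_ge0.
apply: (le_trans (ler_normD _ _)).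
have -> : 2 * c * W = c * W + c * W by ring.
apply: lerD; rewrite /a1 /a2 normrM; set b := (_ - 1);
    have /andP[rb0 rbc] := rc b; rewrite (ger0_norm rb0);
    apply: ler_pM => //.
- have [->|->] := exchange_left_boundary e fL (erefl b).
    by rewrite subrr normr0.
  apply: le_trans (fw _ _) _.
  by have -> : b + 1 = - L.+1%:Z by rewrite /b; lia.
- have [->|->] := exchange_right_boundary e fL (erefl b).
    by rewrite subrr normr0.
  apply: le_trans (fw _ _) _.
  by have -> : b = L%:Z by rewrite /b; lia.
Qed.

(* [S t] is compared with m steps of the Euler scheme 1 + (t/m) L restricted to
   the bonds of a large box, which is a mixture of exchanges. The sensitivity of
   the iterates to a flip at [y] stays of order 2^-|y|, so that the bonds outside
   of the box contribute little. *)
Lemma mixture_approx t L M eps : 0 <= t -> 0 <= M -> 0 < eps ->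
  exists2 q : seq (R * seq int), mixture q &
    forall f, local_in L f -> (forall e, `|f e| <= M) ->
    forall e, `|S t f e - mix q f e| <= eps.
Proof.
move=> + M0 eps0; rewrite le_eqVlt => /orP[/eqP <-|t0].
  exists [:: (1, [::])]; first exact: mixture_id.
  move=> f fL _ e; rewrite (semigroup0 Sm); last exact: local_in_continuous fL.
  by rewrite /mix big_seq1 mul1r subrr normr0 ltW.
have c0 := c_ge0.
(* With the profile [w] below, this constant gives [w y >= 2 * M] on the original window, the
   trivial oscillation bound. *)
pose C : R := 2 * M * 2 ^+ L.
have C0 : 0 <= C by rewrite !mulr_ge0.
(* Bounds [(1 + 2 * c * h) ^+ k] for all [k <= m], uniformly in the number [m] of steps. *)
pose A := expR (2 * c * t).
have A0 : 0 < A by exact: expR_gt0.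
(* Boundary error accumulated over time [t] before the factor [2 ^- L'], relative to the tolerated
   [eps / 2]; the box is then taken so large that [2 ^+ L'] exceeds it. *)
pose K := t * (2 * c * (A * C)) / (eps / 2).
have K0 : 0 <= K by rewrite !mulr_ge0 ?invr_ge0 ?mulr_ge0// ltW.
pose L' := maxn L (Num.truncn K).+1.
have KL : K <= 2 ^+ L'.
  apply: (@le_trans _ _ (Num.truncn K).+1%:R); first exact/ltW/truncnS_gt.
  rewrite -natrX ler_nat; apply: (@leq_trans L'); first by rewrite leq_maxr.
  exact/ltnW/ltn_expl.
(* Halving from one site to the next meets the condition of [osc_avg] and makes the sensitivity at
   the boundary of the box of order [2 ^- L']. *)
pose w (y : int) : R := C * 2 ^- absz y.
have w0 y : 0 <= w y by rewrite mulr_ge0// invr_ge0 exprn_ge0.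
have w2 b y : w (swap b y) <= 2 * w y.
  rewrite /w mulrCA ler_wpM2l//.
  have -> : 2 * 2 ^- absz y = (2 ^+ absz y / 2)^-1 :> R.
    by rewrite invfM invrK mulrC.
  rewrite lef_pV2 ?posrE ?exprn_gt0 ?divr_gt0 ?exprn_gt0//.
  rewrite ler_pdivrMr// -exprSr ler_eXn2l ?ltr1n//.
  by rewrite /swap; case: ifP; [lia|case: ifP; lia].
pose W := A * (C * 2 ^- L').
have [d d0 Hd] := generator_uniform (ltn0Sn L') M0
  (divr_gt0 eps0 (mulr_gt0 (ltr0Sn _ 1) t0)).
pose rs := \sum_(b <- bonds L'.+1) r b.
have rs0 : 0 <= rs by apply: sumr_ge0 => b _; have /andP[] := rc b.
(* Two demands on the mesh: [h < d] for the expansion of the semigroup, and [h * rs <= 1] for the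
   Euler steps to be mixtures. *)
pose m := (Num.truncn (t / d + t * rs)).+1.
have mP : t / d + t * rs < m%:R by exact: truncnS_gt.
have m0 : 0 < m%:R :> R by rewrite ltr0n.
pose h := t / m%:R.
have h0 : 0 < h by rewrite divr_gt0.
have hd : h < d.
  rewrite /h ltr_pdivrMr// mulrC -ltr_pdivrMr//; apply: le_lt_trans mP.
  by rewrite lerDl mulr_ge0// ltW.
have hr : h * rs <= 1.
  rewrite /h mulrAC ler_pdivrMr// mul1r; apply/ltW/(le_lt_trans _ mP).
  by rewrite lerDr divr_ge0// ltW.
have [q qm qE] := iter_avg_mix m (ltW h0) hr.
exists q => // f fL fM e; rewrite -qE.
have fL' : local_in L'.+1 f by apply: local_in_leq fL; rewrite leqW// leq_maxl.
have fw : osc w f.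
  move=> y x; have [yL|yL] := boolP (- L%:Z <= y < L%:Z); last first.
    rewrite (fL (flip y x) x) ?subrr ?normr0// => z zL; rewrite /flip.
    by case: eqVneq => // zy; move: yL; rewrite -zy zL.
  apply: (@le_trans _ _ (2 * M)).
    rewrite [2 * M]mulrDl !mul1r; apply: (le_trans (ler_normB _ _)).
    exact: lerD.
  rewrite /w /C -(mulrA (2 * M)) ler_peMr ?mulr_ge0//.
  rewrite ler_pdivlMr ?exprn_gt0// mul1r ler_eXn2l ?ltr1n//.
  by move: yL; clear; lia.
have IL k : local_in L'.+1 (iter k (avg L'.+1 h) f).
  by elim: k => [//|k IH]; exact: local_in_avg.
have IM k x : `|iter k (avg L'.+1 h) f x| <= M.
  have [q' q'm ->] := iter_avg_mix k (ltW h0) hr; exact: mix_norm_le.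
have Iw k : osc (fun y => (1 + 2 * c * h) ^+ k * w y) (iter k (avg L'.+1 h) f).
  have p0 : 0 <= 1 + 2 * c * h by rewrite addr_ge0 ?mulr_ge0// ltW.
  elim: k => [|k IH]; first by move=> y x; rewrite expr0 mul1r; exact: fw.
  move=> y x; rewrite exprS -mulrA.
  apply: (osc_avg (w := fun y => (1 + 2 * c * h) ^+ k * w y)) => //.
  - exact: ltW.
  - by move=> z; rewrite mulr_ge0 ?exprn_ge0.
  - by move=> b z; rewrite [leRHS]mulrCA ler_wpM2l ?exprn_ge0.
(* Error per unit of time: the expansion of the semigroup, then the omitted boundary bonds. *)
pose E := eps / (2 * t) + 2 * c * W.
have step k x : (k <= m)%N -> `|S h (iter k (avg L'.+1 h) f) x -
    avg L'.+1 h (iter k (avg L'.+1 h) f) x| <= h * E.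
  move=> km; set g := iter k _ f.
  have pA : (1 + 2 * c * h) ^+ k <= A.
    apply: (@le_trans _ _ (expR (2 * c * h) ^+ k)).
      rewrite lerXn2r ?nnegrE ?expR_ge0//.
      - by rewrite addr_ge0 ?mulr_ge0// ltW.
      - by apply: expR_ge1Dx.
    rewrite -expRM_natl ler_expR /h mulrCA ler_wpM2l ?mulr_ge0//.
    by rewrite mulrCA ger_pMr// ler_pdivrMr// mul1r ler_nat.
  have H1 := Hd h g (introT andP (conj h0 hd)) (IL k) (IM k) x.
  have H2 : `|g x + h * gen g x - avg L'.+1 h g x| <= h * (2 * c * W).
    apply: (gen_avg_le x (ltW h0) (IL k) (Iw k)); rewrite /W /w.
      rewrite /w absz_nat; apply: ler_wpM2r => //.
      by rewrite mulr_ge0// invr_ge0 exprn_ge0.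
    rewrite abszN absz_nat; apply: ler_pM => //.
    - by rewrite exprn_ge0// addr_ge0 ?mulr_ge0// ltW.
    - by rewrite mulr_ge0// invr_ge0 exprn_ge0.
    rewrite ler_wpM2l// lef_pV2 ?posrE ?exprn_gt0// ler_eXn2l ?ltr1n//.
  rewrite [X in `|X|](_ : _ = (S h g x - g x - h * gen g x) +
    (g x + h * gen g x - avg L'.+1 h g x)); last by ring.
  by apply: (le_trans (ler_normD _ _)); rewrite mulrDr; exact: lerD.
have cI k : continuous (iter k (avg L'.+1 h) f).
  exact: local_in_continuous (IL k).
have acc k x : (k <= m)%N ->
    `|S (k%:R * h) f x - iter k (avg L'.+1 h) f x| <= k%:R * (h * E).
  elim: k x => [|k IH] x km.
    by rewrite !mul0r (semigroup0 Sm)//= ?subrr ?normr0//; exact: (cI 0%N).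
  have kh0 : 0 <= k%:R * h by rewrite mulr_ge0// ltW.
  rewrite -natr1 mulrDl mul1r [k%:R * h + h]addrC.
  rewrite (semigroupD Sm (ltW h0) kh0 (cI 0%N)).
  set g := iter k (avg L'.+1 h) f.
  have cS : continuous (S (k%:R * h) f).
    apply: (semigroup_continuous Sm); last exact: (cI 0%N).
    by rewrite mulr_ge0// ltW.
  (* Telescoping: the error so far is contracted by [S h], and one local error is added. *)
  rewrite [X in `|X|](_ : _ = S h (fun y => S (k%:R * h) f y - g y) x +
    (S h g x - avg L'.+1 h g x)); last first.
    by rewrite (semigroupB Sm) ?ltW//=; [ring|exact: cI].
  apply: (le_trans (ler_normD _ _)); rewrite mulrDl mul1r; apply: lerD; last first.
    by apply: step; exact: ltnW.
  apply: (semigroup_norm_le Sm) => //; first exact: ltW.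
    by move=> y; apply: cvgB; [exact: cS|exact: cI].
  by move=> y; apply: IH; exact: ltnW.
have := acc m e (leqnn m).
have -> : m%:R * h = t by rewrite /h mulrC divfK// gt_eqF.
move=> /le_trans; apply.
rewrite mulrA (_ : m%:R * h = t); last by rewrite /h mulrC divfK// gt_eqF.
rewrite /E mulrDr (_ : t * (eps / (2 * t)) = eps / 2); last first.
  by field; rewrite gt_eqF.
rewrite [leRHS]splitr lerD2l /W.
move: KL; rewrite /K ler_pdivrMr ?divr_gt0// => KL.
rewrite (_ : t * _ = t * (2 * c * (A * C)) / 2 ^+ L'); last by ring.
by rewrite ler_pdivrMr ?exprn_gt0// [leRHS]mulrC.
Qed.

End generators.

(** * Expectations and the Markov property *)

Section expectations.
Context d (T : measurableType d) {R : realType} (P : probability T R).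

(** A real number, so that field tactics apply; [fine] loses nothing on bounded measurable
    functions, the predicate [bmf], by [expectation_Ex]. *)
Definition Ex (F : T -> R) : R := fine ('E_P[F])%E.

Definition bmf (F : T -> R) : Prop :=
  measurable_fun [set: T] F /\ exists M, forall w, `|F w| <= M.

Lemma bmf_integrable F : bmf F -> P.-integrable [set: T] (EFin \o F).
Proof.
move=> [mF [M FM]]; apply: measurable_bounded_integrable => //.
  exact: (le_lt_trans (probability_le1 P measurableT) (ltry _)).
exists M; split; first exact: num_real.
by move=> x Mx w _; exact: le_trans (FM w) (ltW Mx).
Qed.

Lemma ExE F : Ex F = (\int[P]_(w in [set: T]) F w)%R.
Proof. by rewrite /Ex unlock. Qed.

Lemma expectation_Ex F : bmf F -> ('E_P[F] = (Ex F)%:E)%E.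
Proof.
move=> bF; rewrite /Ex fineK// unlock.
by apply: integrable_fin_num => //; exact: bmf_integrable.
Qed.

Lemma bmf_cst a : bmf (fun=> a).
Proof. by split; [exact: measurable_cst|exists `|a|]. Qed.

Lemma bmfD F G : bmf F -> bmf G -> bmf (fun w => F w + G w).
Proof.
move=> [mF [M FM]] [mG [N GN]]; split; first exact: measurable_funD.
by exists (M + N) => w; apply: (le_trans (ler_normD _ _)); exact: lerD.
Qed.

Lemma bmfM F G : bmf F -> bmf G -> bmf (fun w => F w * G w).
Proof.
move=> [mF [M FM]] [mG [N GN]]; split; first exact: measurable_funM.
by exists (M * N) => w; rewrite normrM; exact: ler_pM.
Qed.

Lemma bmfZ a F : bmf F -> bmf (fun w => a * F w).
Proof. by move=> bF; apply: bmfM => //; exact: bmf_cst. Qed.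

Lemma bmfN F : bmf F -> bmf (fun w => - F w).
Proof.
move=> bF; rewrite (_ : (fun _ => _) = (fun w => -1 * F w)); first exact: bmfZ.
by apply/funext => w; rewrite mulN1r.
Qed.

Lemma bmfB F G : bmf F -> bmf G -> bmf (fun w => F w - G w).
Proof. by move=> bF bG; apply: bmfD => //; exact: bmfN. Qed.

Lemma bmf_norm F : bmf F -> bmf (fun w => `|F w|).
Proof.
move=> [mF [M FM]]; split; first exact: measurableT_comp.
by exists M => w; rewrite normr_id.
Qed.

Lemma bmfX F n : bmf F -> bmf (fun w => F w ^+ n).
Proof.
move=> bF; elim: n => [|n IH]; first exact: bmf_cst.
rewrite (_ : (fun _ => _) = (fun w => F w * F w ^+ n)); first exact: bmfM.
by apply/funext => w; rewrite exprS.
Qed.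

Lemma bmf_sum (I : Type) (l : seq I) (F : I -> T -> R) :
  (forall i, bmf (F i)) -> bmf (fun w => \sum_(i <- l) F i w).
Proof.
move=> bF; elim: l => [|i l IH].
  rewrite (_ : (fun _ => _) = fun=> 0); first exact: bmf_cst.
  by apply/funext => w; rewrite big_nil.
rewrite (_ : (fun _ => _) = (fun w => F i w + \sum_(j <- l) F j w)).
  exact: bmfD.
by apply/funext => w; rewrite big_cons.
Qed.

Lemma bmf_bool (b : T -> bool) : measurable [set w | b w] ->
  bmf (fun w => (b w)%:R).
Proof.
move=> mb; split; last first.
  by exists 1 => w; case: (b w); rewrite ?normr1 ?normr0.
rewrite (_ : (fun _ => _) = \1_[set w | b w]); first exact: measurable_indic.
apply/funext => w; rewrite indicE; congr (nat_of_bool _)%:R.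
by apply/idP/idP; rewrite inE.
Qed.

Lemma Ex_cst a : Ex (fun=> a) = a.
Proof. by rewrite /Ex (_ : (fun=> a) = cst a)// expectation_cst. Qed.

Lemma ExD F G : bmf F -> bmf G -> Ex (fun w => F w + G w) = Ex F + Ex G.
Proof. by move=> bF bG; rewrite !ExE RintegralD//; exact: bmf_integrable. Qed.

Lemma ExB F G : bmf F -> bmf G -> Ex (fun w => F w - G w) = Ex F - Ex G.
Proof. by move=> bF bG; rewrite !ExE RintegralB//; exact: bmf_integrable. Qed.

Lemma ExZ a F : bmf F -> Ex (fun w => a * F w) = a * Ex F.
Proof. by move=> bF; rewrite !ExE RintegralZl//; exact: bmf_integrable. Qed.

Lemma Ex_sum (I : Type) (l : seq I) (F : I -> T -> R) :
  (forall i, bmf (F i)) ->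
  Ex (fun w => \sum_(i <- l) F i w) = \sum_(i <- l) Ex (F i).
Proof.
move=> bF; elim: l => [|i l IH].
  rewrite big_nil -[RHS]Ex_cst; congr Ex.
  by apply/funext => w; rewrite big_nil.
rewrite big_cons -IH -ExD//; last exact: bmf_sum.
by congr Ex; apply/funext => w; rewrite big_cons.
Qed.

Lemma Ex_le F G : bmf F -> bmf G -> (forall w, F w <= G w) -> Ex F <= Ex G.
Proof.
by move=> bF bG FG; rewrite !ExE le_Rintegral//; exact: bmf_integrable.
Qed.

Lemma Ex_norm F : bmf F -> `|Ex F| <= Ex (fun w => `|F w|).
Proof.
by move=> bF; rewrite !ExE le_normr_Rintegral//; exact: bmf_integrable.
Qed.

Lemma Ex_norm_le F c : bmf F -> (forall w, `|F w| <= c) -> `|Ex F| <= c.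
Proof.
move=> bF Fc; apply: (le_trans (Ex_norm bF)); rewrite -[leRHS]Ex_cst.
by apply: Ex_le => //; [exact: bmf_norm|exact: bmf_cst].
Qed.

Lemma Ex_bool (b : T -> bool) : measurable [set w | b w] ->
  Ex (fun w => (b w)%:R) = fine (P [set w | b w]).
Proof.
move=> mb; rewrite /Ex unlock (_ : (fun w => _) = (fun w => (\1_[set w | b w] w)%:E)).
  by rewrite integral_indic// setIT.
apply/funext => w; rewrite indicE; congr ((nat_of_bool _)%:R)%:E.
by apply/idP/idP; rewrite inE.
Qed.

Lemma measurable_norm_gt (F : T -> R) x : measurable_fun [set: T] F ->
  measurable [set w | x < `|F w|].
Proof.
move=> mF; have : measurable_fun [set: T] (fun w => `|F w|).
  exact: measurableT_comp.
move=> /(_ measurableT `]x, +oo[%classic (measurable_itv _)); rewrite setTI.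
rewrite (_ : _ @^-1` _ = [set w | x < `|F w|])//.
by apply/seteqP; split=> w /=; rewrite in_itv/= andbT.
Qed.

(** Chebyshev's inequality: [x ^+ 2] times the indicator of the event is at most [F w ^+ 2]. *)
Lemma prob_norm_gt_le F x : bmf F -> 0 < x ->
  (P [set w | (x < `|F w|)%R] <= (Ex (fun w => F w ^+ 2) / x ^+ 2)%:E)%E.
Proof.
move=> bF x0; have mFx := measurable_norm_gt x bF.1.
rewrite -(fineK (fin_num_measure P _ mFx)) lee_fin -(Ex_bool mFx).
rewrite ler_pdivlMr ?exprn_gt0// mulrC -ExZ; last exact: bmf_bool.
apply: Ex_le; [by apply: bmfZ; exact: bmf_bool|exact: bmfX|].
move=> w; have [xF|_] := boolP (x < _); last by rewrite mulr0 sqr_ge0.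
by rewrite mulr1 -[leRHS]real_normK ?num_real// lerXn2r ?nnegrE// ltW.
Qed.

Lemma countvar_measurable d' (U : measurableType d') (K : countType)
    (H : T -> K) (G : K -> U) :
  (forall k, measurable [set w | H w = k]) -> measurable_fun [set: T] (G \o H).
Proof.
move=> mH _ B mB; rewrite setTI.
(* A preimage is a countable union of level sets of [H], enumerated through [unpickle]. *)
rewrite (_ : _ @^-1` B = \bigcup_n
  (if @choice.unpickle K n is Some k then [set w | H w = k /\ B (G k)] else set0)).
  apply: bigcupT_measurable => n; case: choice.unpickle => [k|]; last exact: measurable0.
  have [BGk|nBGk] := pselect (B (G k)).
    by rewrite (_ : [set w | _] = [set w | H w = k])//; apply/seteqP; split=> w // [].
  rewrite (_ : [set w | _] = set0); first exact: measurable0.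
  by apply/seteqP; split=> w // [].
apply/seteqP; split => w /=.
  by move=> BGH; exists (choice.pickle (H w)) => //; rewrite choice.pickleK.
by move=> [n _]; case: choice.unpickle => // k [->].
Qed.

Lemma finvar_bmf (K : finType) (H : T -> K) (G : K -> R) :
  (forall k, measurable [set w | H w = k]) -> bmf (G \o H).
Proof.
move=> mH; split; first exact: countvar_measurable.
exists (\sum_k `|G k|) => w /=; rewrite (bigD1 (H w))//= lerDl.
by apply: sumr_ge0 => k _.
Qed.

End expectations.

Lemma measurable_pat d (T : measurableType d) (X : T -> config) L
    (z : (2 * L).-tuple bool) :
  (forall x, measurable [set w | X w x]) ->
  measurable [set w | pat L (X w) = z].
Proof.
move=> mX.
rewrite (_ : [set w | _] =
  \bigcap_(i in [set: 'I_(2 * L)]) [set w | X w (i%:Z - L%:Z) = tnth z i]).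
  apply: fin_bigcap_measurable; first exact: finite_finset.
  move=> i _; have := mX (i%:Z - L%:Z); case: (tnth z i) => [//|mi].
  rewrite (_ : [set w | _] = ~` [set w | X w (i%:Z - L%:Z)]).
    exact: measurableC.
  by apply/seteqP; split => w /=; case: (X w _).
apply/seteqP; split=> w /=.
  by move=> <- i _ /=; rewrite tnth_mktuple.
by move=> H; apply: eq_from_tnth => i; rewrite tnth_mktuple H.
Qed.

Section markov_property.
Context {R : realType} (S : R -> (config -> R) -> config -> R).
Hypothesis Sm : markov_semigroup S.
Variables (r : int -> R) (c : R).
Hypothesis rc : forall b, 0 <= r b <= c.
Hypothesis Sg : has_generator S (gen r).
Context (mu : set config -> \bar R) d (T : measurableType d)
  (P : probability T R) (eta : R -> T -> config).
Hypothesis etaP : markov_process S mu P eta.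

Lemma measurable_eta t x : 0 <= t -> measurable [set w | eta t w x].
Proof. exact: (process_measurable etaP). Qed.

Lemma measurable_eta_pat t L z : 0 <= t -> measurable [set w | pat L (eta t w) = z].
Proof. by move=> t0; apply: measurable_pat => x; exact: measurable_eta. Qed.

Lemma past_measurable s A : past eta s A -> measurable A.
Proof.
apply: smallest_sub; first exact: sigma_algebra_measurable.
by move=> B [t [x [/andP[t0 _] ->]]]; exact: measurable_eta.
Qed.

Let G s := [set A | exists t x, 0 <= t <= s /\ A = [set w | eta t w x]].

(** [measurable_pat] is applied to [T] equipped with the sigma-algebra generated by the past. *)
Lemma past_pat s t L z : 0 <= t <= s -> past eta s [set w | pat L (eta t w) = z].
Proof.
move=> ts.
have := @measurable_pat _ (g_sigma_algebraType (G s)) (eta t) L z; apply.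
by move=> x; apply: sub_sigma_algebra; exists t, x.
Qed.

Lemma pastI s A B : past eta s A -> past eta s B -> past eta s (A `&` B).
Proof. exact: (@measurableI _ (g_sigma_algebraType (G s))). Qed.

Lemma bmf_local t L (f : config -> R) : 0 <= t -> local_in L f ->
  bmf (fun w => f (eta t w)).
Proof.
move=> t0 fL.
rewrite (_ : (fun _ => _) = (f \o @ext L) \o (fun w => pat L (eta t w))).
  by apply: finvar_bmf => z; exact: measurable_eta_pat.
apply/funext => w /=; apply: fL => x xL; exact/esym/ext_pat.
Qed.

Lemma local_in_bounded L (f : config -> R) : local_in L f ->
  exists2 M, 0 <= M & forall e, `|f e| <= M.
Proof.
move=> fL; exists (\sum_(z : (2 * L).-tuple bool) `|f (ext z)|).
  by apply: sumr_ge0.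
move=> e; rewrite (fL e (ext (pat L e))).
  by rewrite (bigD1 (pat L e))//= lerDl sumr_ge0.
by move=> x xL; exact/esym/ext_pat.
Qed.

Lemma local_in_mix L q (f : config -> R) : local_in L f ->
  exists L', local_in L' (mix q f).
Proof.
move=> fL; elim: q => [|p q [L' IH]].
  by exists 0%N => e e' _; rewrite /mix !big_nil.
exists (maxn L' (L + size p.2)) => e e' ee'.
have := IH e e' (agree_leq (leq_maxl _ _) ee'); rewrite /mix !big_cons => ->.
rewrite (fL (exchs p.2 e) (exchs p.2 e'))//.
by apply: agree_exchs; apply: agree_leq ee'; exact: leq_maxr.
Qed.

(** [S t f] need not be local; it is the uniform limit of the local functions [mix q f], which gives
    measurability. *)
Lemma bmf_semigroup s t L (f : config -> R) : 0 <= s -> 0 <= t ->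
  local_in L f -> bmf (fun w => S t f (eta s w)).
Proof.
move=> s0 t0 fL; have [M M0 fM] := local_in_bounded fL.
split; last first.
  by exists M => w; apply: (semigroup_norm_le Sm) => //; exact: local_in_continuous fL.
have /choice[q qP] : forall n : nat, exists q : seq (R * seq int),
    forall e, `|S t f e - mix q f e| <= n.+1%:R^-1.
  move=> n; have n0 : 0 < n.+1%:R^-1 :> R by rewrite invr_gt0.
  by have [q _ H] := mixture_approx Sm rc Sg L t0 M0 n0; exists q => e; exact: H.
apply: (measurable_fun_cvg
  (h := fun n w => mix (q n) f (eta s w))).
  move=> n; have [L' qL'] := local_in_mix (q n) fL.
  by have [] := bmf_local s0 qL'.
move=> w _; apply/cvgrPdist_le => eps eps0.
near=> n; apply: (le_trans (qP n _)).
rewrite invf_ple ?posrE//; apply: (@le_trans _ _ (Num.truncn eps^-1).+1%:R).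
  exact/ltW/truncnS_gt.
rewrite ler_nat ltnS; near: n; exact: nbhs_infty_ge.
Unshelve. all: by end_near. Qed.

Lemma bmf_semigroup_hist s t (K : finType) (H : T -> K)
    (F : K -> config -> R) L :
  0 <= s -> 0 <= t -> (forall k, measurable [set w | H w = k]) ->
  (forall k, local_in L (F k)) -> bmf (fun w => S t (F (H w)) (eta s w)).
Proof.
move=> s0 t0 mH FL.
rewrite (_ : (fun _ => _) =
    (fun w => \sum_k (H w == k)%:R * S t (F k) (eta s w))).
  apply: bmf_sum => k; apply: bmfM; last exact: bmf_semigroup (FL k).
  apply: bmf_bool; rewrite (_ : [set w | _] = [set w | H w = k])//.
  by apply/seteqP; split=> w /= /eqP.
apply/funext => w; rewrite (bigD1 (H w))//= eqxx mul1r big1 ?addr0// => k kH.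
by rewrite eq_sym (negbTE kH) mul0r.
Qed.

(** The Markov property is given for one function at a time; when the function depends on the past
    through finitely many values, it is applied on each event [H w = k]. *)
Lemma markov_hist s t (K : finType) (H : T -> K) (F : K -> config -> R) L :
  0 <= s -> 0 <= t -> (forall k, past eta s [set w | H w = k]) ->
  (forall k, local_in L (F k)) ->
  Ex P (fun w => F (H w) (eta (s + t) w)) =
  Ex P (fun w => S t (F (H w)) (eta s w)).
Proof.
move=> s0 t0 pH FL; have st0 : 0 <= s + t by rewrite addr_ge0.
have mH k : measurable [set w | H w = k] by exact: past_measurable (pH k).
have mHb k : measurable [set w | H w == k].
  by rewrite (_ : [set w | _] = [set w | H w = k])//; apply/seteqP; split=> w /= /eqP.
have D (X : K -> T -> R) w : X (H w) w = \sum_k (H w == k)%:R * X k w.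
  rewrite (bigD1 (H w))//= eqxx mul1r big1 ?addr0// => k kH.
  by rewrite eq_sym (negbTE kH) mul0r.
under eq_fun do rewrite (D (fun k w => F k (eta (s + t) w))).
under [in RHS]eq_fun do rewrite (D (fun k w => S t (F k) (eta s w))).
have bH k : bmf (fun w => (H w == k)%:R : R) by exact: bmf_bool.
have b1 k : bmf (fun w => F k (eta (s + t) w)) by exact: bmf_local (FL k).
have b2 k : bmf (fun w => S t (F k) (eta s w)) by exact: bmf_semigroup (FL k).
rewrite !Ex_sum; [|by move=> k; exact: bmfM..].
apply: eq_bigr => k _.
have E (f : T -> R) : Ex P (fun w => (H w == k)%:R * f w) =
    fine (\int[P]_(w in [set w | H w = k]) (f w)%:E)%E.
  rewrite /Ex unlock [in RHS]integral_mkcond; congr fine.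
  apply: eq_integral => w _; rewrite patchE.
  have [Hk|Hk] := eqVneq (H w) k; first by rewrite mem_set//= mul1r.
  by rewrite memNset ?mul0r//= => /eqP; rewrite (negbTE Hk).
rewrite !E; congr fine.
apply: (process_markov etaP) => //; exact: local_in_continuous (FL k).
Qed.

End markov_property.

(** [E] lies in the liminf of the [A m], an increasing union of the sets [F k]. This passes bounds
    on partition events to path events, where the fineness needed depends on the path. *)
Lemma prob_liminf_le d (T : measurableType d) (R : realType)
    (P : probability T R) (A : nat -> set T) (E : set T) (kappa : R) m0 :
  (forall m, measurable (A m)) -> measurable E ->
  (forall w, E w -> exists k, forall m, (k <= m)%N -> A m w) ->
  (forall m, (m0 <= m)%N -> (P (A m) <= kappa%:E)%E) ->
  (P E <= kappa%:E)%E.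
Proof.
move=> mA mE EA Ak.
pose F k := \bigcap_(m in [set m | (k <= m)%N]) A m.
have mF k : measurable (F k) by apply: bigcap_measurableType.
have mUF : measurable (\bigcup_k F k) by apply: bigcupT_measurable.
apply: (@le_trans _ _ (P (\bigcup_k F k))).
  apply: le_measure; rewrite ?inE//.
  by move=> w /EA[k Hk]; exists k.
have Fnd : {homo F : n m / (n <= m)%N >-> (n <= m)%O}.
  move=> n m nm; apply/subsetPset => w Fw k /= mk; apply: Fw => /=.
  exact: leq_trans mk.
have C := @nondecreasing_cvg_mu _ _ _ P F mF mUF Fnd.
rewrite -(cvg_lim _ C)//.
apply: lime_le.
  by apply/cvg_ex; eexists; exact: C.
apply: nearW => k /=; pose m := maxn k m0.
apply: (le_trans _ (Ak m (leq_maxr _ _))).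
apply: le_measure; rewrite ?inE//.
by move=> w; apply => /=; exact: leq_maxl.
Qed.

(** * Jumps of almost every path are exchanges *)

Definition exchanged_in (L : nat) (e e' : config) : Prop :=
  agree L e' e \/ exists b, agree L e' (exchange b e).

Lemma agree_sym L e e' : agree L e e' -> agree L e' e.
Proof. by move=> H x xL; rewrite H. Qed.

Lemma agree_trans L e e' e'' : agree L e e' -> agree L e' e'' -> agree L e e''.
Proof. by move=> H H' x xL; rewrite H// H'. Qed.

(** One more site on each side is needed at the start: an exchange may bring a particle in from
    outside the window. *)
Lemma agree_okL L e1 e2 e1' e2' : agree L.+1 e1 e2 -> agree L e1' e2' ->
  exchanged_in L e1 e1' -> exchanged_in L e2 e2'.
Proof.
move=> H H' [h|[b h]].
  left; apply: agree_trans (agree_trans (agree_sym H') h) _.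
  exact: agree_leq H.
right; exists b; apply: agree_trans (agree_trans (agree_sym H') h) _.
exact: agree_exchange.
Qed.

(** The bond may depend on the window. A site [y] where the configurations differ leaves only two
    candidates; if both failed, at [x1] and [x2], a window containing the three sites would
    contradict the hypothesis. *)
Lemma exchanged_in_exchanged e e' : (forall L, exchanged_in L e e') -> exchanged e e'.
Proof.
move=> ok; have [|ne] := pselect (e' =1 e); first by left.
have [y yP] : exists y, e' y != e y.
  apply: contrapT => /forallNP H; apply: ne => y.
  by have /negP/negPn/eqP := H y.
right; apply: contrapT => nb.
have nb' b : exists x, e' x != exchange b e x.
  apply: contrapT => /forallNP H; apply: nb; exists b => x.
  by have /negP/negPn/eqP := H x.
have [x1 x1P] := nb' y; have [x2 x2P] := nb' (y - 1).
pose L := (absz x1 + absz x2 + absz y).+2.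
have yL : - L%:Z <= y < L%:Z by rewrite /L; clear; lia.
have x1L : - L%:Z <= x1 < L%:Z by rewrite /L; clear; lia.
have x2L : - L%:Z <= x2 < L%:Z by rewrite /L; clear; lia.
have [H|[b H]] := ok L; first by move: yP; rewrite (H _ yL) eqxx.
have [by_|by_] : b = y \/ b = y - 1.
  move: yP; rewrite (H _ yL) exchangeE /swap.
  have [->|_] := eqVneq y b; first by left.
  by have [->|_] := eqVneq y (b + 1); [right; lia|rewrite eqxx].
- by move: x1P; rewrite (H _ x1L) by_ eqxx.
- by move: x2P; rewrite (H _ x2L) by_ eqxx.
Qed.

Section path_bad.
Context {R : realType} (g : R -> config) (gc : forall x, cadlag (g^~ x)).

(** Once the window changes at most once per step, the step containing the jump goes from the left
    limit to the new value, as far as the window can tell. *)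
Lemma bad_jump_partition L t tau e : 0 < tau <= t ->
  (forall x, left_lim (g^~ x) tau (e x)) -> ~ exchanged_in L e (g tau) ->
  exists m0, forall m, (m0 <= m)%N -> (0 < m)%N -> exists2 i, (i < m)%N &
    ~ exchanged_in L (g (t * i%:R / m%:R)) (g (t * i.+1%:R / m%:R)).
Proof.
move=> /andP[tau0 taut] eP nok.
have t0 : 0 <= t by rewrite (le_trans _ taut)// ltW.
have [m0 H] := ex_fine_partition t0 (cadlag_seq (window L.+1) gc).
exists m0 => m mm m_gt0.
have mR : (0 : R) < m%:R by rewrite ltr0n.
have exk : exists k, tau <= t * k%:R / m%:R by exists m; rewrite mulfK ?gt_eqF.
(* The least grid point at or after [tau] is the right end of the step containing it. *)
case: (ex_minnP exk) => -[|i] ti imin; first by move: ti; rewrite mulr0 mul0r; lra.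
have im : (i < m)%N by apply: imin; rewrite mulfK ?gt_eqF.
exists i => //; have := H m i mm im.
set s := t * i%:R / m%:R; set s' := t * i.+1%:R / m%:R.
have st : s < tau by rewrite ltNge; apply/negP => /imin; rewrite ltnn.
have winE r r' : [seq g r x | x <- window L.+1] = [seq g r' x | x <- window L.+1]
    <-> agree L.+1 (g r) (g r').
  split=> [/eq_in_map E x xL|E]; first by apply: E; rewrite mem_window.
  by apply/eq_in_map => x; rewrite mem_window; exact: E.
move=> [tau' [H1 H2]].
have [r [/andP[sr rt] re]] : exists r, s <= r < tau /\ agree L.+1 (g r) e.
  near (tau^'-)%R => r; exists r; split.
    apply/andP; split; near: r; [exact: nbhs_left_ge|exact: nbhs_left_lt].
  move=> x xL; have xW : x \in window L.+1 by rewrite mem_window.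
  by move: x xW {xL}; near: r; exact: near_left_window.
have rs' : s <= r <= s' by rewrite sr (le_trans (ltW rt)).
have taus' : s <= tau <= s' by rewrite (ltW st).
have nag : ~ agree L.+1 (g tau) e.
  by move=> h; apply: nok; left; exact: agree_leq h.
have rtau' : r < tau'.
  rewrite ltNge; apply/negP => h; apply: nag.
  have /winE h1 := H2 _ rs' h; have /winE h2 := H2 _ taus' (le_trans h (ltW rt)).
  exact: agree_trans h2 (agree_trans (agree_sym h1) re).
have /winE h1 := H1 _ rs' rtau'.
have tau't : tau' <= tau.
  rewrite leNgt; apply/negP => /(H1 _ taus')/winE h2; apply: nag.
  exact: agree_trans h2 (agree_trans (agree_sym h1) re).
have /winE h2 := H2 _ taus' tau't.
move=> ok; apply: nok; apply: agree_okL ok.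
  exact: agree_trans (agree_sym h1) re.
by apply: agree_sym; exact: agree_leq h2.
Unshelve. all: by end_near. Qed.

End path_bad.

Section almost_sure_paths.
Context {R : realType} (S : R -> (config -> R) -> config -> R).
Hypothesis Sm : markov_semigroup S.
Variables (r : int -> R) (c : R).
Hypothesis rc : forall b, 0 <= r b <= c.
Hypothesis Sg : has_generator S (gen r).
Context (mu : set config -> \bar R) d (T : measurableType d)
  (P : probability T R) (eta : R -> T -> config).
Hypothesis etaP : markov_process S mu P eta.

Let bad L e e' : bool := ~~ `[< exchanged_in L e e' >].

Lemma agree_bad L e1 e2 e1' e2' : agree L.+1 e1 e2 -> agree L e1' e2' ->
  bad L e1 e1' = bad L e2 e2'.
Proof.
move=> H H'; congr (~~ _); apply/asboolP/asboolP; apply: agree_okL => //;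
  exact: agree_sym.
Qed.

Lemma measurable_eta2 (U : Type) L s s' (G : config -> config -> U) (B : set U) :
  0 <= s -> 0 <= s' ->
  (forall e1 e2 e1' e2', agree L e1 e2 -> agree L e1' e2' ->
     G e1 e1' = G e2 e2') ->
  measurable [set w | B (G (eta s w) (eta s' w))].
Proof.
move=> s0 s'0 GL.
pose H w := (pat L (eta s w), pat L (eta s' w)).
have mH k : measurable [set w | H w = k].
  case: k => k1 k2; rewrite (_ : [set w | _] =
    [set w | pat L (eta s w) = k1] `&` [set w | pat L (eta s' w) = k2]).
    by apply: measurableI; exact: (measurable_eta_pat etaP).
  by apply/seteqP; split=> w; rewrite /H/=; [case=> -> ->|move=> [-> ->]].
have := @countvar_measurable _ T _ bool _ H
  (fun k => `[< B (G (ext k.1) (ext k.2)) >]) mH.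
move=> /(_ measurableT [set true]) /(_ I); rewrite setTI.
rewrite (_ : _ @^-1` _ = [set w | B (G (eta s w) (eta s' w))])//.
have E w : G (ext (H w).1) (ext (H w).2) = G (eta s w) (eta s' w).
  by apply: GL; exact: ext_pat.
by apply/seteqP; split => w /=; rewrite E => /asboolP.
Qed.

Lemma bmf_eta2 L s s' (G : config -> config -> R) : 0 <= s -> 0 <= s' ->
  (forall e1 e2 e1' e2', agree L e1 e2 -> agree L e1' e2' ->
     G e1 e1' = G e2 e2') ->
  bmf (fun w => G (eta s w) (eta s' w)).
Proof.
move=> s0 s'0 GL.
pose H w := (pat L (eta s w), pat L (eta s' w)).
have mH k : measurable [set w | H w = k].
  case: k => k1 k2; rewrite (_ : [set w | _] =
    [set w | pat L (eta s w) = k1] `&` [set w | pat L (eta s' w) = k2]).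
    by apply: measurableI; exact: (measurable_eta_pat etaP).
  by apply/seteqP; split=> w; rewrite /H/=; [case=> -> ->|move=> [-> ->]].
rewrite (_ : (fun _ => _) = (fun k => G (ext k.1) (ext k.2)) \o H).
  exact: finvar_bmf.
apply/funext => w /=; apply: GL; apply: agree_sym; exact: ext_pat.
Qed.

(** Seen from [e], the indicator of a bad transition vanishes at [e] and at every exchange of it.
    The generator therefore gives 0 there, and the probability is o(h) uniformly in [e]. *)
Lemma bad_small L eps : (0 < L)%N -> 0 < eps -> exists2 delta, 0 < delta &
  forall h s, 0 < h < delta -> 0 <= s ->
    Ex P (fun w => (bad L (eta s w) (eta (s + h) w))%:R) <= h * eps.
Proof.
move=> L0 eps0.
have [dl dl0 Hd] := generator_uniform Sm Sg L0 (ler01 : 0 <= 1 :> R) eps0.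
exists dl => // h s hd s0; have /andP[h0 _] := hd.
pose F (z : (2 * L.+1).-tuple bool) e : R := (bad L (ext z) e)%:R.
have FL z : local_in L (F z).
  by move=> e e' ee'; rewrite /F (agree_bad (e2 := ext z) _ ee').
rewrite (_ : (fun w => _) = (fun w => F (pat L.+1 (eta s w)) (eta (s + h) w))).
  rewrite (markov_hist Sm rc Sg etaP s0 (ltW h0) _ FL); last first.
    by move=> k; apply: past_pat; rewrite s0 lexx.
  apply: le_trans (ler_norm _) _; apply: Ex_norm_le.
    apply: (bmf_semigroup_hist Sm rc Sg etaP s0 (ltW h0) _ FL) => k.
    exact: (measurable_eta_pat etaP).
  move=> w; set z := pat _ _; set e := eta s w.
  have ez : agree L.+1 (ext z) e by exact: ext_pat.
  have F0 : F z e = 0.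
    rewrite /F (agree_bad (e2 := e) (e2' := e) ez)// /bad.
    by rewrite (_ : `[< _ >] = true)//; apply/asboolP; left.
  have F1 x : F z (exchange x e) = 0.
    rewrite /F (agree_bad (e2 := e) (e2' := exchange x e) ez)// /bad.
    by rewrite (_ : `[< _ >] = true)//; apply/asboolP; right; exists x.
  have g0 : gen r (F z) e = 0.
    by rewrite /gen fsbig1// => x _; rewrite F0 F1 subrr mulr0.
  have /(_ _ e) := Hd h (F z) hd (FL z); rewrite F0 g0 mulr0 !subr0; apply.
  by move=> e'; rewrite /F; case: (bad _ _ _); rewrite ?normr1 ?normr0.
apply/funext => w; rewrite /F; congr (nat_of_bool _)%:R.
by apply: agree_bad => //; apply: agree_sym; exact: ext_pat.
Qed.

(** For large [m], each of the [m] steps fails with probability at most [(t / m) * eps], hence some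
    step fails with probability at most [t * eps]; a jump that is no exchange makes a step fail in
    every fine partition. *)
Lemma good_path_window L t : (0 < L)%N -> 0 < t ->
  {ae P, forall w, forall tau e, 0 < tau <= t ->
    (forall x, left_lim ((eta^~ w)^~ x) tau (e x)) -> exchanged_in L e (eta tau w)}.
Proof.
move=> L0 t0.
pose b m i w := bad L (eta (t * i%:R / m%:R) w) (eta (t * i.+1%:R / m%:R) w).
pose B m := \bigcup_(i in [set i | (i < m)%N]) [set w | b m i w].
have tm0 m i : 0 <= t * i%:R / m%:R by rewrite divr_ge0 ?mulr_ge0// ltW.
have mb m i : measurable [set w | b m i w].
  apply: (@measurable_eta2 _ L.+1 _ _ (bad L) id) => //.
  by move=> e1 e2 e1' e2' h1 h2; apply: agree_bad => //; exact: agree_leq h2.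
have mB m : measurable (B m) by apply: bigcup_measurable.
pose E := \bigcup_k \bigcap_(m in [set m | (k <= m)%N]) B m.
have mE : measurable E.
  by apply: bigcupT_measurable => k; apply: bigcap_measurableType.
have PB eps : 0 < eps -> exists m0, forall m, (m0 <= m)%N ->
    (P (B m) <= (t * eps)%:E)%E.
  move=> eps0; have [dl dl0 Hd] := bad_small L0 eps0.
  exists (Num.truncn (t / dl)).+1 => m mm.
  have m0 : 0 < m%:R :> R by rewrite ltr0n; apply: leq_trans mm.
  have hd : 0 < t / m%:R < dl.
    rewrite divr_gt0//= ltr_pdivrMr// mulrC -ltr_pdivrMr//.
    by apply: (lt_le_trans (truncnS_gt _)); rewrite ler_nat.
  have Bm : (P (B m) <= \sum_(i < m) P [set w | b m i w])%E.
    rewrite /B bigcup_mkord.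
    by have := @Boole_inequality _ _ _ P (fun i => [set w | b m i w]) m; exact.
  apply: (le_trans Bm); apply: (@le_trans _ _ (\sum_(i < m) (t / m%:R * eps)%:E)%E).
    apply: lee_sum => i _; rewrite -(fineK (fin_num_measure P _ (mb m i))) lee_fin.
    rewrite -Ex_bool//.
    have := Hd _ (t * i%:R / m%:R) hd (tm0 m i).
    congr (Ex P _ <= _); apply/funext => w; congr (nat_of_bool (bad L _ (eta _ w)))%:R.
    by rewrite -mulrDl -[i.+1]addn1 natrD mulrDr mulr1.
  rewrite sumEFin lee_fin sumr_const card_ord -[X in X <= _]mulr_natl.
  rewrite (_ : m%:R * _ = t * eps)//.
  by field; rewrite gt_eqF.
have PE : P E = 0.
  apply/eqP; rewrite eq_le measure_ge0 andbT.
  apply/lee_addgt0Pr => eps eps0; rewrite add0e.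
  have [m0 Hm] := PB (eps / t) (divr_gt0 eps0 t0).
  apply: (prob_liminf_le (A := B) (m0 := m0)) => //.
  - by move=> w [k _ Hk]; exists k => m km; exact: Hk.
  - by move=> m /Hm; rewrite mulrCA divff ?mulr1// gt_eqF.
exists E; split => // w /= /existsNP[tau /existsNP[e /not_implyP[tt /not_implyP[eP nok]]]].
have [m0 Hm] := bad_jump_partition (process_cadlag etaP w) tt eP nok.
exists m0.+1 => // m /= mm.
have [||i im Hi] := Hm m; [exact: ltnW|exact: leq_trans mm|].
by exists i => //=; rewrite /b /bad; apply/asboolP.
Qed.

(** Countably many windows and time horizons suffice; the windows are then removed by
    [exchanged_in_exchanged]. *)
Lemma good_path_ae : {ae P, forall w, good_path (eta^~ w)}.
Proof.
have : {ae P, forall w, forall L N : nat, forall tau e, 0 < tau <= N.+1%:R ->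
    (forall x, left_lim ((eta^~ w)^~ x) tau (e x)) -> exchanged_in L.+1 e (eta tau w)}.
  by apply/ae_foralln => L; apply/ae_foralln => N; apply: good_path_window.
apply: filterS => w H tau e tau0 eP; apply: exchanged_in_exchanged => L.
have := H L (Num.truncn tau) tau e; rewrite tau0 (ltW (truncnS_gt _)) => /(_ isT eP).
case=> [h|[b h]]; [left|right; exists b]; exact: agree_leq h.
Qed.

End almost_sure_paths.

(** * The current averaged over many bonds *)

Section flux.
Context {R : realType}.

(** Since [phi x] concerns [{x - 1, x}], the bonds are [{a + i, a + i + 1}], those of the rates
    [r (a + i)]. *)
Definition flux (a : int) (N : nat) (e e' : config) : R :=
  \sum_(i < N) (phi (a + 1 + i%:Z) e e')%:~R.

Lemma fluxE a N e e' :
  flux a N e e' = (\sum_(i < N) phi (a + 1 + i%:Z) e e')%:~R.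
Proof. by rewrite /flux raddf_sum. Qed.

(** The flux is an integer. First absolute moments are thereby bounded by second moments, which are
    of order [h] over a short step. *)
Lemma norm_flux_le a N e e' : `|flux a N e e'| <= flux a N e e' ^+ 2.
Proof.
rewrite fluxE -intr_norm -rmorphXn ler_int; set k := \sum_(i < N) _.
by case: k => n; nia.
Qed.

Lemma flux_id a N e : flux a N e e = 0.
Proof. by rewrite /flux big1// => i _; rewrite phi_id. Qed.

Definition flux_window (a : int) (N : nat) : nat := (absz a + N).+2.

Lemma agree_flux a N e1 e2 e1' e2' :
  agree (flux_window a N) e1 e2 -> agree (flux_window a N) e1' e2' ->
  flux a N e1 e1' = flux a N e2 e2'.
Proof.
move=> H H'; apply: eq_bigr => i _; congr (_%:~R).
have iN := ltn_ord i.
by apply: eq_phi; [apply: H|apply: H|apply: H'|apply: H']; rewrite /flux_window; lia.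
Qed.

Lemma flux_exchange a N e b : flux a N e (exchange b e) =
  if a <= b < a + N%:Z then (e b)%:R - (e (b + 1))%:R else 0.
Proof.
rewrite /flux; under eq_bigr do rewrite phi_exchange.
case: ifPn => bN.
  have iN : (absz (b - a)%R < N)%N by lia.
  rewrite (bigD1 (Ordinal iN))//= big1 ?addr0.
    have -> : a + 1 + `|b - a|%N - 1 = b by lia.
    have -> : a + 1 + `|b - a|%N = b + 1 by lia.
    by rewrite eqxx rmorphB.
  move=> i /eqP/val_eqP/= ib.
  by have -> : (b == a + 1 + i%:Z - 1) = false by apply/eqP; move: ib; lia.
rewrite big1// => i _; have iN := ltn_ord i.
by have -> : (b == a + 1 + i%:Z - 1) = false by apply/eqP; lia.
Qed.

(** With [f] the identity this is the drift of the total current, with [f] the square the rate of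
    its quadratic variation. The flux from [e] to itself is 0, and one exchange contributes one
    difference of occupations. *)
Lemma gen_flux (r : int -> R) (f : R -> R) a N e : f 0 = 0 ->
  gen r (fun e' => f (flux a N e e')) e =
  \sum_(i < N) r (a + i%:Z) * f ((e (a + i%:Z))%:R - (e (a + i%:Z + 1))%:R).
Proof.
move=> f0; rewrite /gen (fsbigE [seq a + i%:Z | i <- iota 0 N])//=.
- under eq_bigl do rewrite in_setT.
  rewrite big_map -[RHS](big_mkord xpredT (fun i : nat =>
    r (a + i%:Z) * f ((e (a + i%:Z))%:R - (e (a + i%:Z + 1))%:R))).
  rewrite /index_iota subn0; apply: eq_big_seq => i; rewrite mem_iota => iN.
  rewrite flux_exchange flux_id f0 subr0.
  by have -> : a <= a + i%:Z < a + N%:Z by lia.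
- by rewrite map_inj_uniq ?iota_uniq// => i j; lia.
- move=> b _ bN; rewrite flux_exchange flux_id.
  rewrite ifN; first by rewrite subrr mulr0.
  apply: contra bN => bN; apply/mapP; exists (absz (b - a)); last lia.
  by rewrite mem_iota; lia.
Qed.

End flux.

Section flux_process.
Context {R : realType} (S : R -> (config -> R) -> config -> R).
Hypothesis Sm : markov_semigroup S.
Variables (r : int -> R) (c : R).
Hypothesis rc : forall b, 0 <= r b <= c.
Hypothesis Sg : has_generator S (gen r).
Context (mu : set config -> \bar R) d (T : measurableType d)
  (P : probability T R) (eta : R -> T -> config).
Hypothesis etaP : markov_process S mu P eta.
Variables (a : int) (N : nat) (D : R).
(* The drift of the total current; it telescopes where the rates are constant,
   so that the bound [D] can be taken independent of [N]. *)
Hypothesis rD : forall e : config,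
  `|\sum_(i < N) r (a + i%:Z) * ((e (a + i%:Z))%:R - (e (a + i%:Z + 1))%:R)| <= D.

Local Notation L := (flux_window a N).
Local Notation fl := (@flux R a N).

Lemma flux_bound e e' : `|fl e e'| <= N%:R.
Proof.
rewrite /flux; apply: (le_trans (ler_norm_sum _ _ _)).
rewrite -[leRHS]mulr1 mulr_natl -[X in _ *+ X](card_ord N) -sumr_const.
apply: ler_sum => i _; rewrite -intr_norm -[1]/(1%:~R) ler_int /phi.
by case: (e (_ - 1)); case: (e _); case: (e' (_ - 1)); case: (e' _).
Qed.

Lemma bmf_flux s s' : 0 <= s -> 0 <= s' ->
  bmf (fun w => fl (eta s w) (eta s' w)).
Proof.
by move=> s0 s'0; apply: (bmf_eta2 etaP (L := L)) => //; exact: agree_flux.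
Qed.

Lemma flux_ext (z : (2 * L).-tuple bool) e : z = pat L e -> fl (ext z) = fl e.
Proof.
by move=> ->; apply/funext => e'; apply: agree_flux => //; exact: ext_pat.
Qed.

Lemma semigroupZ t k (f : config -> R) e : 0 <= t -> continuous f ->
  S t (fun e => k * f e) e = k * S t f e.
Proof.
move=> t0 cf; have c0 : continuous (fun _ : config => 0 : R).
  by move=> x; exact: cvg_cst.
rewrite -[RHS]addr0 -[X in _ = _ + X](semigroup_cst Sm 0 e t0).
rewrite -(semigroup_scaleD Sm)//.
by congr S; apply/funext => x; rewrite addr0.
Qed.

Lemma local_in_flux (f : R -> R) e : local_in L (fun e' => f (fl e e')).
Proof. by move=> e1 e2 H; congr f; exact: agree_flux. Qed.

Lemma semigroup_flux (f : R -> R) : f 0 = 0 ->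
  (exists M, forall x, `|x| <= N%:R -> `|f x| <= M) ->
  forall eps, 0 < eps -> exists2 delta, 0 < delta &
  forall h e, 0 < h < delta ->
    `|S h (fun e' => f (fl e e')) e -
      h * \sum_(i < N) r (a + i%:Z) *
          f ((e (a + i%:Z))%:R - (e (a + i%:Z + 1))%:R)| <= h * eps.
Proof.
move=> f0 [M fM] eps eps0.
have M0 : 0 <= M by apply: le_trans (fM 0 _); rewrite ?normr0.
have [dl dl0 Hd] := generator_uniform Sm Sg (ltn0Sn _ : (0 < L)%N) M0 eps0.
exists dl => // h e hd.
rewrite -(gen_flux r a N e f0).
have := Hd h (fun e' => f (fl e e')) hd (@local_in_flux f e).
move=> /(_ _ e); rewrite flux_id f0 subr0; apply.
by move=> e'; apply: fM; exact: flux_bound.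
Qed.

Lemma markov_flux (f : R -> R) s h : 0 <= s -> 0 <= h ->
  bmf (fun w => S h (fun e' => f (fl (eta s w) e')) (eta s w)) /\
  Ex P (fun w => f (fl (eta s w) (eta (s + h) w))) =
  Ex P (fun w => S h (fun e' => f (fl (eta s w) e')) (eta s w)).
Proof.
move=> s0 h0; pose F (z : (2 * L).-tuple bool) e' := f (fl (ext z) e').
have FL z : local_in L (F z) by exact: local_in_flux.
have E : (fun w => S h (fun e' => f (fl (eta s w) e')) (eta s w)) =
    (fun w => S h (F (pat L (eta s w))) (eta s w)).
  by apply/funext => w; rewrite /F (flux_ext (erefl (pat L (eta s w)))).
rewrite E; split.
  apply: (bmf_semigroup_hist Sm rc Sg etaP s0 h0 _ FL) => k.
  exact: (measurable_eta_pat etaP).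
rewrite -(markov_hist Sm rc Sg etaP s0 h0 _ FL); last first.
  by move=> k; apply: past_pat; rewrite s0 lexx.
congr Ex; apply/funext => w.
by rewrite /F (flux_ext (erefl (pat L (eta s w)))).
Qed.

(** Each bond contributes at most [c] to the generator of the squared flux; the added 1 absorbs the
    uniform error of the expansion, taken with [eps = 1]. *)
Lemma flux_sq_small : exists2 delta, 0 < delta & forall h s, 0 < h < delta ->
  0 <= s -> Ex P (fun w => fl (eta s w) (eta (s + h) w) ^+ 2) <=
            h * (c * N%:R + 1).
Proof.
have [||dl dl0 Hd] := @semigroup_flux (fun x => x ^+ 2) _ _ 1 ltr01.
- by rewrite expr0n.
- by exists (N%:R ^+ 2) => x xN; rewrite normrX lerXn2r ?nnegrE.
exists dl => // h s hd s0; have /andP[h0 _] := hd.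
have [b ->] := @markov_flux (fun x => x ^+ 2) s h s0 (ltW h0).
rewrite -[leRHS](Ex_cst P); apply: Ex_le => //; first exact: bmf_cst.
move=> w; have := Hd h (eta s w) hd; rewrite ler_distl => /andP[_ /le_trans]; apply.
rewrite mulr1 mulrDr mulr1 lerD2r ler_wpM2l ?(ltW h0)//.
rewrite mulr_natr -[X in _ *+ X](card_ord N) -sumr_const.
apply: ler_sum => i _; have /andP[r0 rc'] := rc (a + i%:Z).
rewrite -[leRHS]mulr1 ler_pM ?sqr_ge0//.
by case: (eta s w _); case: (eta s w _); rewrite ?subrr ?subr0 ?sub0r ?sqrrN ?expr1n ?expr0n.
Qed.

(** Given the past up to [s], the later increment has mean at most [h * (D + 1)] in absolute value;
    the earlier one is bounded in L^1 by its second moment, by [norm_flux_le]. *)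
Lemma flux_cross_small : exists2 delta, 0 < delta & forall h s1 s,
  0 < h < delta -> 0 <= s1 -> s1 + h <= s ->
  Ex P (fun w => fl (eta s1 w) (eta (s1 + h) w) * fl (eta s w) (eta (s + h) w))
    <= h * (c * N%:R + 1) * (h * (D + 1)).
Proof.
have [dl1 dl10 H1] := flux_sq_small.
have [||dl2 dl20 H2] := @semigroup_flux id _ _ 1 ltr01 => //.
  by exists N%:R.
exists (Num.min dl1 dl2); first by rewrite lt_min dl10.
move=> h s1 s; rewrite lt_min => /andP[h0 /andP[hd1 hd2]] s10 s1s.
have s1h0 : 0 <= s1 + h by rewrite addr_ge0// ltW.
have s0 : 0 <= s by apply: le_trans s1s.
have D1 : 0 <= D + 1.
  by rewrite addr_ge0//; apply: le_trans (rD (fun=> true)).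
pose K := ((2 * L).-tuple bool * (2 * L).-tuple bool * (2 * L).-tuple bool)%type.
pose H w : K := (pat L (eta s1 w), pat L (eta (s1 + h) w), pat L (eta s w)).
pose F (k : K) e' := fl (ext k.1.1) (ext k.1.2) * fl (ext k.2) e'.
have FL k : local_in L (F k).
  by move=> e1 e2 ee; rewrite /F; congr (_ * _); exact: agree_flux.
have pH k : past eta s [set w | H w = k].
  case: k => [[k1 k2] k3]; rewrite (_ : [set w | _] =
    [set w | pat L (eta s1 w) = k1] `&` [set w | pat L (eta (s1 + h) w) = k2] `&`
    [set w | pat L (eta s w) = k3]); last first.
    by apply/seteqP; split=> w; rewrite /H/=; [case=> -> -> ->|move=> [[-> ->] ->]].
  apply: pastI; [apply: pastI|]; apply: past_pat.
  - by rewrite s10/=; apply: le_trans s1s; rewrite lerDl ltW.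
  - by rewrite s1h0.
  - by rewrite s0 lexx.
have mH k : measurable [set w | H w = k] by exact: (past_measurable etaP (pH k)).
have E1 w : F (H w) = fun e' => fl (eta s1 w) (eta (s1 + h) w) * fl (eta s w) e'.
  apply/funext => e'; rewrite /F /H/=.
  rewrite (flux_ext (erefl (pat L (eta s1 w)))).
  rewrite (flux_ext (erefl (pat L (eta s w)))); congr (_ * _).
  by apply: agree_flux => //; exact: ext_pat.
under eq_fun => w do rewrite -[_ * _]/((fun e' =>
  fl (eta s1 w) (eta (s1 + h) w) * fl (eta s w) e') (eta (s + h) w)) -E1.
rewrite (markov_hist Sm rc Sg etaP s0 (ltW h0) pH FL).
have bfl : bmf (fun w => fl (eta s1 w) (eta (s1 + h) w)) by exact: bmf_flux.
apply: le_trans (ler_norm _) _; apply: le_trans (Ex_norm P _) _.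
  exact: (bmf_semigroup_hist Sm rc Sg etaP s0 (ltW h0) mH FL).
apply: (@le_trans _ _ (Ex P (fun w => h * (D + 1) *
    fl (eta s1 w) (eta (s1 + h) w) ^+ 2))).
  apply: Ex_le.
  - apply: bmf_norm.
    exact: (bmf_semigroup_hist Sm rc Sg etaP s0 (ltW h0) mH FL).
  - by apply: bmfZ; exact: bmfX.
  move=> w; rewrite E1 semigroupZ; [|exact: ltW|]; last first.
    exact: (local_in_continuous (@local_in_flux id (eta s w))).
  rewrite normrM mulrC; apply: ler_pM => //; last exact: norm_flux_le.
  have := H2 h (eta s w); rewrite h0 hd2 => /(_ isT).
  rewrite mulr1 => /(fun x => le_trans (ler_normD _ _) (lerD x (lexx _))).
  set X := S h _ _; set Y := h * _ => H3.
  have : `|X| <= h + `|Y|.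
    rewrite -[X](subrK Y); apply: le_trans (ler_normD _ _) _; rewrite lerD2r.
    by have := H2 h (eta s w); rewrite h0 hd2 => /(_ isT); rewrite mulr1.
  move=> /le_trans; apply; rewrite mulrDr mulr1 addrC lerD2r.
  by rewrite /Y normrM gtr0_norm// ler_wpM2l ?(ltW h0).
rewrite ExZ ?bmfX//; last exact: bmfX.
rewrite mulrC ler_wpM2r//; first by rewrite mulr_ge0// ltW.
by apply: H1; rewrite // h0.
Qed.

(** With [h = t / m], the [m] diagonal terms add up to at most [t * A] and the bound on cross terms,
    counted for all [m ^ 2] pairs, to [t ^+ 2 * A * (D + 1)]. *)
Lemma flux_sum_sq t : 0 < t -> exists m0, forall m, (m0 <= m)%N -> (0 < m)%N ->
  Ex P (fun w => (\sum_(i < m)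
    fl (eta (t * i%:R / m%:R) w) (eta (t * i.+1%:R / m%:R) w)) ^+ 2) <=
  (c * N%:R + 1) * (t + t ^+ 2 * (D + 1)).
Proof.
move=> t0; have [dl1 dl10 H1] := flux_sq_small.
have [dl2 dl20 H2] := flux_cross_small.
have D1 : 0 <= D + 1.
  by rewrite addr_ge0//; apply: le_trans (rD (fun=> true)).
have c0 : 0 <= c by exact: c_ge0 rc.
set A := c * N%:R + 1.
have A0 : 0 <= A by rewrite addr_ge0// mulr_ge0.
pose dl := Num.min dl1 dl2.
have dl0 : 0 < dl by rewrite lt_min dl10.
exists (Num.truncn (t / dl)).+1 => m mm m_gt0.
have mR : (0 : R) < m%:R by rewrite ltr0n.
pose h := t / m%:R.
have h0 : 0 < h by rewrite divr_gt0.
have : h < dl.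
  rewrite ltr_pdivrMr// mulrC -ltr_pdivrMr//.
  by apply: (lt_le_trans (truncnS_gt _)); rewrite ler_nat.
rewrite lt_min => /andP[hd1 hd2].
pose s (i : nat) := t * i%:R / m%:R.
have s0 i : 0 <= s i by rewrite divr_ge0 ?mulr_ge0// ltW.
have sS i : s i.+1 = s i + h.
  by rewrite /s /h -mulrDl -[i.+1]addn1 natrD mulrDr mulr1.
have sle i j : (i <= j)%N -> s i <= s j.
  by move=> ij; rewrite ler_pM2r ?invr_gt0// ler_pM2l// ler_nat.
pose psi (i : nat) w := fl (eta (s i) w) (eta (s i.+1) w).
have bpsi i : bmf (psi i) by exact: bmf_flux.
rewrite (_ : (fun w => _) = (fun w => \sum_(i < m) \sum_(j < m) psi i w * psi j w));
  last first.
  apply/funext => w; rewrite expr2 mulr_suml; apply: eq_bigr => i _.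
  by rewrite mulr_sumr.
rewrite Ex_sum; last by move=> i; apply: bmf_sum => j; exact: bmfM.
have cross i j : (i < j)%N -> Ex P (fun w => psi i w * psi j w) <=
    h * A * (h * (D + 1)).
  move=> ij; rewrite /psi !sS; apply: H2; rewrite ?h0//.
  by rewrite -sS; exact: sle.
have Eij i j : Ex P (fun w => psi i w * psi j w) <=
    (i == j)%:R * (h * A) + h * A * (h * (D + 1)).
  have X0 : 0 <= h * A * (h * (D + 1)) by rewrite !mulr_ge0// ltW.
  case: (ltngtP i j) => [ij|ji|->].
  - by rewrite mul0r add0r; exact: cross.
  - rewrite mul0r add0r; under eq_fun do rewrite mulrC; exact: cross.
  - rewrite mul1r; apply: ler_wpDr => //.
    by rewrite /psi !sS; under eq_fun do rewrite -expr2; apply: H1; rewrite ?h0.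
apply: (@le_trans _ _ (\sum_(i < m) \sum_(j < m)
    ((i == j)%:R * (h * A) + h * A * (h * (D + 1))))).
  apply: ler_sum => i _; rewrite Ex_sum; last by move=> j; exact: bmfM.
  by apply: ler_sum => j _; exact: Eij.
rewrite (eq_bigr (fun=> h * A + m%:R * (h * A * (h * (D + 1))))); last first.
  move=> i _; rewrite big_split/= sumr_const card_ord mulr_natl; congr (_ + _).
  rewrite (bigD1 i)//= eqxx mul1r big1 ?addr0// => j ji.
  by rewrite eq_sym (negbTE ji) mul0r.
rewrite sumr_const card_ord -[X in X <= _]mulr_natl mulrDr.
have mh : m%:R * h = t by rewrite /h mulrC divfK// gt_eqF.
rewrite mulrA mh.
rewrite (_ : m%:R * _ = (m%:R * h) * A * ((m%:R * h) * (D + 1))); last by ring.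
by rewrite mh (_ : _ + _ = A * (t + t ^+ 2 * (D + 1)))//; ring.
Qed.

Lemma measurable_current x t : 0 <= t ->
  measurable_fun [set: T] (fun w => (current (eta^~ w) x t)%:~R : R).
Proof.
move=> t0.
have s0 m i : 0 <= t * i%:R / m%:R by rewrite divr_ge0 ?mulr_ge0.
apply: (measurable_fun_cvg (h := fun m w => \sum_(i < m)
  (phi x (eta (t * i%:R / m%:R) w) (eta (t * i.+1%:R / m%:R) w))%:~R)).
  move=> m; have [] // : bmf (fun w => \sum_(i < m)
    (phi x (eta (t * i%:R / m%:R) w) (eta (t * i.+1%:R / m%:R) w))%:~R : R).
  apply: bmf_sum => i.
  apply: (bmf_eta2 etaP (L := (absz x).+2)
    (G := fun e e' => (phi x e e')%:~R)) => // e1 e2 e1' e2' h1 h2.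
  by congr (_%:~R); apply: eq_phi; [apply: h1|apply: h1|apply: h2|apply: h2]; lia.
move=> w _; apply: cvg_near_cst.
have [m0 H] := current_fine_partition (process_cadlag etaP w) x t0.
near=> m; rewrite [in RHS](H m) ?raddf_sum//=; near: m.
  exact: nbhs_infty_ge.
exact: nbhs_infty_gt.
Unshelve. all: by end_near. Qed.

Lemma flux_partition w t : 0 <= t -> exists m0, forall m, (m0 <= m)%N ->
  (0 < m)%N ->
  (\sum_(i < N) current (eta^~ w) (a + 1 + i%:Z) t)%:~R =
  \sum_(i < m) fl (eta (t * i%:R / m%:R) w) (eta (t * i.+1%:R / m%:R) w).
Proof.
move=> t0; rewrite /flux.
have [m0 Hm] : exists m0, forall m i, (m0 <= m)%N -> (0 < m)%N -> (i < N)%N ->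
    current (eta^~ w) (a + 1 + i%:Z) t = \sum_(j < m) phi (a + 1 + i%:Z)
      (eta (t * j%:R / m%:R) w) (eta (t * j.+1%:R / m%:R) w).
  have /choice[k Hk] := fun i : nat =>
    current_fine_partition (process_cadlag etaP w) (a + 1 + i%:Z) t0.
  exists (\max_(i < N) k i)%N => m i km m0 iN.
  by apply: Hk => //; apply: leq_trans km; exact: (leq_bigmax (Ordinal iN)).
exists m0 => m mm m_gt0; rewrite raddf_sum/= exchange_big/=.
by apply: eq_bigr => i _; rewrite (Hm m)// raddf_sum.
Qed.

(** Chebyshev for the partition sums. Along each path they equal the total current from some
    fineness on, which depends on the path; hence [prob_liminf_le]. *)
Lemma current_avg_prob_le t x : 0 <= t -> 0 < x ->
  (P [set w | (x < `|(\sum_(i < N) current (eta^~ w) (a + 1 + i%:Z) t)%:~R|)%R]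
   <= ((c * N%:R + 1) * (t + t ^+ 2 * (D + 1)) / x ^+ 2)%:E)%E.
Proof.
rewrite le_eqVlt => /orP[/eqP <-|t0] x0.
  rewrite (_ : [set w | _] = set0) ?measure0 ?lee_fin.
    rewrite divr_ge0 ?sqr_ge0// mulr_ge0 ?addr_ge0 ?mulr_ge0//; first exact: c_ge0 rc.
    by rewrite addr_ge0//; apply: le_trans (rD (fun=> true)).
  rewrite -subset0 => w /=; rewrite big1 ?normr0//; last first.
    by move=> i _; rewrite (current0 (process_cadlag etaP w)).
  by rewrite ltNge ltW.
have [m0 Hm] := flux_sum_sq t0.
have s0 m i : 0 <= t * i%:R / m%:R by rewrite divr_ge0 ?mulr_ge0// ltW.
pose F m w := \sum_(i < m) fl (eta (t * i%:R / m%:R) w) (eta (t * i.+1%:R / m%:R) w).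
have bF m : bmf (F m) by apply: bmf_sum => i; exact: bmf_flux.
apply: (prob_liminf_le (A := fun m => [set w | x < `|F m w|]) (m0 := m0.+1)).
- by move=> m; apply: measurable_norm_gt; have [] := bF m.
- apply: (measurable_norm_gt (F := fun w =>
    (\sum_(i < N) current (eta^~ w) (a + 1 + i%:Z) t)%:~R)).
  rewrite (_ : (fun _ => _) = (fun w =>
    \sum_(i < N) (current (eta^~ w) (a + 1 + i%:Z) t)%:~R)); last first.
    by apply/funext => w; rewrite raddf_sum.
  by apply: measurable_sum => i; apply: measurable_current; exact: ltW.
- move=> w /= xw; have [k Hk] := flux_partition w (ltW t0).
  by exists k.+1 => m km; rewrite /F -Hk//; [exact: ltnW|exact: leq_trans km].
- move=> m mm; apply: (le_trans (prob_norm_gt_le _ (bF m) x0)).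
  rewrite lee_fin ler_wpM2r ?invr_ge0 ?sqr_ge0//.
  by apply: Hm; [exact: ltnW|exact: leq_trans mm].
Qed.

End flux_process.

(** * Effect of conditioning on one occupied site *)

Section multi_time.
Context {R : realType} (S : R -> (config -> R) -> config -> R).
Hypothesis Sm : markov_semigroup S.
Variables (r : int -> R) (c : R).
Hypothesis rc : forall b, 0 <= r b <= c.
Hypothesis Sg : has_generator S (gen r).

Definition local_multi (L k : nat) (G : (nat -> config) -> R) : Prop :=
  forall E E', (forall i, (i < k)%N -> agree L (E i) (E' i)) -> G E = G E'.

Definition upd (E : nat -> config) (k : nat) (e : config) : nat -> config :=
  fun i => if i == k then e else E i.

(** The default [[::]] of [nth] means that no exchange is made. *)
Definition multi_exchs (p : seq (seq int)) (e : config) : nat -> config :=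
  fun i => exchs (nth [::] p i) e.

Section one_process.
Context (mu : set config -> \bar R) d (T : measurableType d)
  (P : probability T R) (eta : R -> T -> config).
Hypothesis etaP : markov_process S mu P eta.

Lemma past_hist (t : nat -> R) L k (z : {ffun 'I_k.+1 -> (2 * L).-tuple bool}) :
  (forall i, (i <= k)%N -> 0 <= t i <= t k) ->
  past eta (t k) [set w | [ffun i : 'I_k.+1 => pat L (eta (t i) w)] = z].
Proof.
move=> tk.
pose G := [set A : set T | exists s x, 0 <= s <= t k /\ A = [set w | eta s w x]].
rewrite (_ : [set w | _] = \bigcap_(i in [set: 'I_k.+1])
    [set w | pat L (eta (t i) w) = z i]).
  apply: (@fin_bigcap_measurable _ (g_sigma_algebraType G)).
    exact: finite_finset.
  by move=> i _; apply: past_pat; apply: tk; rewrite -ltnS.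
apply/seteqP; split=> w /=.
  by move=> <- i _ /=; rewrite ffunE.
by move=> H; apply/ffunP => i; rewrite ffunE H.
Qed.

Lemma bmf_multi (t : nat -> R) L k (G : (nat -> config) -> R) :
  (forall i, 0 <= t i) -> local_multi L k G ->
  bmf (fun w => G (fun i => eta (t i) w)).
Proof.
move=> t0 GL.
pose H w := [ffun i : 'I_k => pat L (eta (t i) w)].
rewrite (_ : (fun _ => _) = (fun z : {ffun 'I_k -> (2 * L).-tuple bool} =>
    G (fun i => if insub i is Some j then ext (z j) else fun=> false)) \o H).
  apply: finvar_bmf => z; rewrite (_ : [set w | _] =
    \bigcap_(i in [set: 'I_k]) [set w | pat L (eta (t i) w) = z i]).
    apply: fin_bigcap_measurable; first exact: finite_finset.
    by move=> i _; exact: (measurable_eta_pat etaP).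
  apply/seteqP; split=> w /=.
    by move=> <- i _ /=; rewrite ffunE.
  by move=> h; apply/ffunP => i; rewrite ffunE h.
apply/funext => w /=; apply: GL => i ik.
by rewrite insubT ffunE; apply: agree_sym; exact: ext_pat.
Qed.

(** The last transition is replaced by a mixture, given the history at the times up to [t k],
    encoded by finitely many patterns for [markov_hist]. *)
Lemma multi_step (t : nat -> R) L k (G : (nat -> config) -> R)
    (q : seq (R * seq int)) eps :
  (forall i, 0 <= t i) -> (forall i, t i <= t i.+1) ->
  local_multi L k.+2 G ->
  (forall f, (exists E, f = fun e => G (upd E k.+1 e)) ->
    forall e, `|S (t k.+1 - t k) f e - mix q f e| <= eps) ->
  `|Ex P (fun w => G (fun i => eta (t i) w)) -
    Ex P (fun w => mix q (fun e => G (upd (fun i => eta (t i) w) k.+1 e))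
                         (eta (t k) w))| <= eps.
Proof.
move=> t0 tS GL Hq.
have tle i j : (i <= j)%N -> t i <= t j.
  elim: j => [|j IH]; first by rewrite leqn0 => /eqP ->.
  by rewrite leq_eqVlt => /orP[/eqP -> //|ij]; apply: le_trans (tS j); exact: IH.
pose K := {ffun 'I_k.+1 -> (2 * L).-tuple bool}.
pose H w : K := [ffun i : 'I_k.+1 => pat L (eta (t i) w)].
pose X (z : K) : nat -> config :=
  fun i => if insub i is Some j then ext (z j) else fun=> false.
pose F (z : K) e := G (upd (X z) k.+1 e).
have FL z : local_in L (F z).
  by move=> e e' ee'; apply: GL => i ik; rewrite /upd; case: eqVneq.
have HF w e : F (H w) e = G (upd (fun i => eta (t i) w) k.+1 e).
  apply: GL => i ik; rewrite /upd; case: eqVneq => [//|ik1].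
  have ik' : (i < k.+1)%N by rewrite ltn_neqAle ik1.
  by rewrite /X insubT ffunE; exact: ext_pat.
have D0 : 0 <= t k.+1 - t k by rewrite subr_ge0.
have pH z : past eta (t k) [set w | H w = z].
  by apply: past_hist => i ik; rewrite t0 tle.
have mH z : measurable [set w | H w = z] by exact: (past_measurable etaP (pH z)).
have -> : (fun w => G (fun i => eta (t i) w)) =
    (fun w => F (H w) (eta (t k + (t k.+1 - t k)) w)).
  apply/funext => w; rewrite HF subrKC; congr G; apply/funext => i.
  by rewrite /upd; case: eqVneq => // ->.
rewrite (markov_hist Sm rc Sg etaP (t0 k) D0 pH FL).
have b1 := bmf_semigroup_hist Sm rc Sg etaP (t0 k) D0 mH FL.
have b2 : bmf (fun w => mix q (fun e => G (upd (fun i => eta (t i) w) k.+1 e))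
                         (eta (t k) w)).
  have [L' LL' HL'] : exists2 L', (L <= L')%N & forall p, p \in q ->
      (L + size p.2 <= L')%N.
    exists (\max_(p <- q) (L + size p.2) + L)%N; first exact: leq_addl.
    move=> p pq; apply: leq_trans (leq_addr _ _).
    by rewrite (big_rem _ pq)/= leq_maxl.
  apply: (@bmf_multi t L' k.+1 (fun E => mix q (fun e => G (upd E k.+1 e)) (E k))) => //.
  move=> E E' EE'; rewrite /mix big_seq [RHS]big_seq; apply: eq_bigr => p pq.
  congr (_ * _); apply: GL => i ik; rewrite /upd; case: eqVneq => [_|ik1].
    by apply: agree_exchs; apply: (agree_leq (HL' p pq)); exact: EE'.
  by apply: (agree_leq LL'); apply: EE'; rewrite ltn_neqAle ik1.
rewrite -ExB//; apply: Ex_norm_le; first exact: bmfB.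
move=> w.
have -> : (fun e => G (upd (fun i => eta (t i) w) k.+1 e)) = F (H w).
  by apply/funext => e; rewrite HF.
by apply: Hq; exists (X (H w)).
Qed.

End one_process.

(** Induction on the number of times: the mixture for the last transition turns [G] into a function
    of one configuration fewer. The mixture is chosen before the initial law and the process, so
    that two processes can share it. *)
Lemma multi_mixture (t : nat -> R) k : t 0%N = 0 -> (forall i, t i <= t i.+1) ->
  forall L (G : (nat -> config) -> R) M eps, 0 <= M -> 0 < eps ->
  local_multi L k.+1 G -> (forall E, `|G E| <= M) ->
  exists2 q : seq (R * seq (seq int)), mixture q &
  forall mu d (T : measurableType d) (P : probability T R) (eta : R -> T -> config),
    markov_process S mu P eta ->
    `|Ex P (fun w => G (fun i => eta (t i) w)) -
      \sum_(p <- q) p.1 * Ex P (fun w => G (multi_exchs p.2 (eta 0 w)))| <= eps.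
Proof.
move=> t_0 tS.
have t0 i : 0 <= t i by elim: i => [|i IH]; [rewrite t_0|exact: le_trans (tS i)].
elim: k => [|k IH] L G M eps M0 eps0 GL GM.
  exists [:: (1, [::])].
    by split; [move=> p; rewrite inE => /eqP ->|rewrite big_seq1].
  move=> mu d T P eta etaP; rewrite big_seq1 mul1r.
  rewrite (_ : (fun w => _) = (fun w => G (multi_exchs [::] (eta 0 w)))).
    by rewrite subrr normr0 ltW.
  apply/funext => w; apply: GL => i; rewrite ltnS leqn0 => /eqP ->.
  by rewrite t_0.
have e20 : 0 < eps / 2 by rewrite divr_gt0.
have D0 : 0 <= t k.+1 - t k by rewrite subr_ge0.
have [q1 [q10 q11] Hq1] := mixture_approx Sm rc Sg L D0 M0 e20.
pose G' (E : nat -> config) := mix q1 (fun e => G (upd E k.+1 e)) (E k).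
have [L' LL' HL'] : exists2 L', (L <= L')%N & forall p, p \in q1 ->
    (L + size p.2 <= L')%N.
  exists (\max_(p <- q1) (L + size p.2) + L)%N; first exact: leq_addl.
  move=> p pq; apply: leq_trans (leq_addr _ _).
  by rewrite (big_rem _ pq)/= leq_maxl.
have G'L : local_multi L' k.+1 G'.
  move=> E E' EE'; rewrite /G' /mix big_seq [RHS]big_seq; apply: eq_bigr => p pq.
  congr (_ * _); apply: GL => i ik; rewrite /upd; case: eqVneq => [_|ik1].
    by apply: agree_exchs; apply: (agree_leq (HL' p pq)); exact: EE'.
  by apply: (agree_leq LL'); apply: EE'; rewrite ltn_neqAle ik1.
have G'M E : `|G' E| <= M by exact: mix_norm_le.
have [q2 [q20 q21] Hq2] := IH L' G' M (eps / 2) M0 e20 G'L G'M.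
(* The configuration at the last time is obtained by applying [p1.2] after the exchanges that lead
   to the preceding time. *)
exists [seq (p2.1 * p1.1, set_nth [::] p2.2 k.+1 (p1.2 ++ nth [::] p2.2 k))
    | p2 <- q2, p1 <- q1].
  split.
    by move=> p /allpairsP[[p2 p1] /= [/q20 h1 /q10 h2 ->]] /=; rewrite mulr_ge0.
  rewrite big_allpairs_dep/= -[RHS]q21; apply: eq_bigr => p2 _.
  by rewrite -mulr_sumr q11 mulr1.
move=> mu d T P eta etaP.
have H1 : `|Ex P (fun w => G (fun i => eta (t i) w)) -
    Ex P (fun w => G' (fun i => eta (t i) w))| <= eps / 2.
  apply: (multi_step etaP t0 tS GL) => f [E ->] e; apply: Hq1 => //.
  by move=> e1 e2 ee; apply: GL => i ik; rewrite /upd; case: eqVneq.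
rewrite big_allpairs_dep/=.
have -> : \sum_(p2 <- q2) \sum_(p1 <- q1) p2.1 * p1.1 *
      Ex P (fun w => G (multi_exchs
        (set_nth [::] p2.2 k.+1 (p1.2 ++ nth [::] p2.2 k)) (eta 0 w))) =
    \sum_(p <- q2) p.1 * Ex P (fun w => G' (multi_exchs p.2 (eta 0 w))).
  apply: eq_bigr => p2 _; rewrite /G' /mix Ex_sum; last first.
    move=> p1; apply: bmfZ.
    have [L2 L2P] : exists L2, local_in L2 (fun e =>
        G (upd (multi_exchs p2.2 e) k.+1 (exchs p1.2 (multi_exchs p2.2 e k)))).
      exists (L + size p1.2 + \max_(s <- p2.2) size s)%N => e1 e2 ee.
      have sz i : (size (nth [::] p2.2 i) <= \max_(s <- p2.2) size s)%N.
        have [ip|ip] := ltnP i (size p2.2); last by rewrite nth_default.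
        by rewrite (big_rem _ (mem_nth [::] ip))/= leq_maxl.
      apply: GL => i ik; rewrite /upd; case: eqVneq => [_|_]; rewrite /multi_exchs.
        apply: agree_exchs; apply: agree_exchs; apply: agree_leq ee.
        by rewrite leq_add2l.
      apply: agree_exchs; apply: agree_leq ee.
      by rewrite leq_add//; exact: leq_addr.
    exact: (bmf_local etaP _ L2P).
  rewrite mulr_sumr; apply: eq_bigr => p1 _.
  rewrite -mulrA; congr (_ * _); rewrite -ExZ.
    congr Ex; apply/funext => w; congr (_ * G _); apply/funext => i.
    rewrite /multi_exchs /upd nth_set_nth/=; case: eqVneq => // _.
    by rewrite exchs_cat.
  pose p := set_nth [::] p2.2 k.+1 (p1.2 ++ nth [::] p2.2 k).
  have [L2 L2P] : exists L2, local_in L2 (fun e => G (multi_exchs p e)).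
    exists (L + \max_(s <- p) size s)%N => e1 e2 ee.
    apply: GL => i ik; rewrite /multi_exchs; apply: agree_exchs.
    apply: agree_leq ee; rewrite leq_add2l.
    have [ip|ip] := ltnP i (size p); last by rewrite nth_default.
    by rewrite (big_rem _ (mem_nth [::] ip))/= leq_maxl.
  exact: (bmf_local etaP _ L2P).
have H2 := Hq2 _ _ _ _ _ etaP.
rewrite [eps]splitr.
set x := Ex P _ in H1 *; set y := Ex P _ in H1 H2; set z := \sum_(p <- q2) _ in H2 *.
by rewrite (_ : x - z = (x - y) + (y - z)) ?(le_trans (ler_normD _ _))// ?lerD//; ring.
Qed.

End multi_time.

Lemma exchs_flip s y e :
  exchs s (flip y e) = flip (foldr swap y s) (exchs s e).
Proof. by elim: s => [//|b s IH] /=; rewrite -exchange_flip -IH. Qed.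

(** [foldl], whereas a flipped site is transported by [foldr swap]: the two permutations are inverse
    to each other. *)
Definition swaps (s : seq int) (x : int) : int := foldl (fun x b => swap b x) x s.

Lemma exchsE s e x : exchs s e x = e (swaps s x).
Proof. by elim: s x => [//|b s IH] x /=; rewrite exchangeE IH. Qed.

Lemma swaps_inj s : injective (swaps s).
Proof. by elim: s => [//|b s IH] x y /= /IH /(inv_inj (swapK b)). Qed.

Lemma pat_ext L (z : (2 * L).-tuple bool) : pat L (ext z) = z.
Proof.
apply: eq_from_tnth => i; rewrite tnth_mktuple /ext (tnth_nth false).
have iL := ltn_ord i.
have -> : - L%:Z <= i%:Z - L%:Z < L%:Z by move: iL; clear; lia.
by rewrite subrK.
Qed.

Lemma pat_eqP L e (z : (2 * L).-tuple bool) :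
  pat L e = z <-> (forall x, x \in [fset x in window L]%fset -> e x = ext z x).
Proof.
split=> [<- x|H].
  by rewrite inE/= mem_window => xL; rewrite ext_pat.
rewrite -[RHS]pat_ext; apply: eq_pat => x xL; apply: H.
by rewrite inE/= mem_window.
Qed.

Section product_measure.
Context {R : realType} (S : R -> (config -> R) -> config -> R).
Hypothesis Sm : markov_semigroup S.
Variables (r : int -> R) (c : R).
Hypothesis rc : forall b, 0 <= r b <= c.
Hypothesis Sg : has_generator S (gen r).
Variable rho : R.
Hypothesis rho01 : 0 < rho < 1.
Variable nu : probability configM R.
Hypothesis nuP : is_nu rho nu.

Lemma measurable_site x : measurable ([set e | e x] : set configM).
Proof. by apply: sub_sigma_algebra; exists x. Qed.

Lemma measurable_pat_configM L z : measurable ([set e | pat L e = z] : set configM).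
Proof.
have := @measurable_pat _ configM id L z; apply => x; exact: measurable_site.
Qed.

Section any_initial.
Context (mu : set config -> \bar R) d (T : measurableType d)
  (P : probability T R) (eta : R -> T -> config).
Hypothesis etaP : markov_process S mu P eta.

Lemma Ex_initial L (F : config -> R) : local_in L F ->
  Ex P (fun w => F (eta 0 w)) =
  \sum_z F (ext z) * fine (mu [set e | pat L e = z]).
Proof.
move=> FL.
have mz z : measurable [set w | pat L (eta 0 w) == z].
  rewrite (_ : [set w | _] = [set w | pat L (eta 0 w) = z]).
    exact: (measurable_eta_pat etaP).
  by apply/seteqP; split=> w /= /eqP.
under eq_fun do rewrite (local_in_sum _ FL).
rewrite Ex_sum; last by move=> z; apply: bmfZ; exact: bmf_bool.
apply: eq_bigr => z _; rewrite ExZ; last exact: bmf_bool.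
rewrite Ex_bool//; congr (_ * fine _).
rewrite -(process_initial etaP); last exact: measurable_pat_configM.
by congr (P _); apply/seteqP; split=> w /= /eqP.
Qed.

End any_initial.

Context d0 (T0 : measurableType d0) (P0 : probability T0 R)
  (eta0 : R -> T0 -> config).
Hypothesis eta0P : markov_process S nu P0 eta0.

Let weight (e : config) (x : int) : R := if e x then rho else 1 - rho.

Lemma nu_pat L (z : (2 * L).-tuple bool) :
  fine (nu [set e | pat L e = z]) =
  \prod_(x <- [fset x in window L]%fset) weight (ext z) x.
Proof.
rewrite (_ : [set e | _] =
  [set e | forall x, x \in [fset x in window L]%fset -> e x = ext z x]).
  by rewrite nuP.
by apply/seteqP; split=> e /=; rewrite pat_eqP.
Qed.

(** Flipping the site [a] permutes the patterns of the window and turns each term of the sum into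
    its opposite, as [rho * (1 - rho)] appears with both signs. *)
Lemma nu_indep L (F : config -> R) a : local_in L F ->
  (forall e, F (flip a e) = F e) ->
  Ex P0 (fun w => F (eta0 0 w) * ((eta0 0 w a)%:R - rho)) = 0.
Proof.
move=> FL Fa; pose L' := maxn L (absz a).+1.
have aL' : - L'%:Z <= a < L'%:Z by rewrite /L'; clear; lia.
pose g (e : config) := F e * ((e a)%:R - rho).
have gL : local_in L' g.
  move=> e e' ee'; rewrite /g (FL e e') ?(ee' a)//.
  by apply: agree_leq ee'; exact: leq_maxl.
rewrite (Ex_initial eta0P gL).
pose h (z : (2 * L').-tuple bool) := pat L' (flip a (ext z)).
have agree_flip e e' : agree L' e e' -> agree L' (flip a e) (flip a e').
  by move=> H x xL; rewrite /flip; case: eqVneq => _; rewrite H.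
have flipK e : flip a (flip a e) = e.
  by apply/funext => x; rewrite /flip; case: eqVneq => // _; rewrite negbK.
have hK : involutive h.
  move=> z; rewrite /h -[RHS]pat_ext; apply: eq_pat.
  apply: (@agree_trans _ _ (flip a (flip a (ext z)))).
    by apply: agree_flip; exact: ext_pat.
  by rewrite flipK.
set s := \sum_z _.
have : s = - s.
  rewrite {1}/s (reindex_inj (inv_inj hK))/= -sumrN; apply: eq_bigr => z _.
  have -> : g (ext (h z)) = g (flip a (ext z)) by apply: gL; exact: ext_pat.
  rewrite /g Fa !nu_pat.
  have aA : a \in [fset x in window L']%fset by rewrite inE/= mem_window.
  rewrite !(bigD1_seq a aA)/= ?fset_uniq//.
  have -> : \prod_(i <- [fset x in window L']%fset | i != a) weight (ext (h z)) i =
      \prod_(i <- [fset x in window L']%fset | i != a) weight (ext z) i.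
    rewrite big_seq_cond [RHS]big_seq_cond; apply: eq_bigr => x /andP[].
    rewrite inE/= mem_window => xL xa; rewrite /weight (ext_pat _ xL) /flip.
    by rewrite (negbTE xa).
  have -> : weight (ext (h z)) a = if ext z a then 1 - rho else rho.
    by rewrite /weight (ext_pat _ aL') /flip eqxx; case: (ext z a).
  rewrite /flip eqxx /weight; case: (ext z a) => /=; ring.
by lra.
Qed.

(** Centred occupations of distinct sites are orthogonal by [nu_indep], and each has second moment
    at most 1. *)
Lemma nu_second_moment s : uniq s ->
  Ex P0 (fun w => (\sum_(x <- s) ((eta0 0 w x)%:R - rho)) ^+ 2) <= (size s)%:R.
Proof.
have bs x : bmf (fun w => (eta0 0 w x)%:R - rho).
  apply: bmfB; last exact: bmf_cst.
  by apply: bmf_bool; exact: (measurable_eta eta0P).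
elim: s => [|x s IH] /=.
  by under eq_fun do rewrite big_nil expr0n; rewrite Ex_cst.
move=> /andP[xs us].
have bS : bmf (fun w => \sum_(x <- s) ((eta0 0 w x)%:R - rho)).
  by apply: bmf_sum.
have E w : (\sum_(y <- x :: s) ((eta0 0 w y)%:R - rho)) ^+ 2 =
    ((eta0 0 w x)%:R - rho) ^+ 2 +
    (2 * ((\sum_(y <- s) ((eta0 0 w y)%:R - rho)) * ((eta0 0 w x)%:R - rho)) +
     (\sum_(y <- s) ((eta0 0 w y)%:R - rho)) ^+ 2).
  by rewrite big_cons; ring.
under eq_fun do rewrite E.
rewrite ExD; [|exact: bmfX|]; last first.
  by apply: bmfD; [apply: bmfZ; exact: bmfM|exact: bmfX].
rewrite ExD; [|by apply: bmfZ; exact: bmfM|exact: bmfX].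
rewrite ExZ; last exact: bmfM.
pose Fs (e : config) := \sum_(y <- s) ((e y)%:R - rho).
have FsL : local_in (\max_(y <- s) (absz y).+1) Fs.
  move=> e e' ee'; rewrite /Fs big_seq [RHS]big_seq; apply: eq_bigr => y ys.
  rewrite ee'//; suff : ((absz y).+1 <= \max_(y <- s) (absz y).+1)%N.
    by move: (\max_(y <- s) _)%N => m; clear; lia.
  by rewrite (big_rem _ ys)/= leq_maxl.
have Fsx e : Fs (flip x e) = Fs e.
  rewrite /Fs big_seq [RHS]big_seq; apply: eq_bigr => y ys; rewrite /flip.
  by case: eqVneq ys => [->|//]; rewrite (negbTE xs).
rewrite (nu_indep FsL Fsx) mulr0 add0r -[(size s).+1]add1n natrD; apply: lerD.
  rewrite -[leRHS](Ex_cst P0); apply: Ex_le; [exact: bmfX|exact: bmf_cst|].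
  by move=> w; have /andP[h0 h1] := rho01; case: (eta0 0 w x) => /=; nra.
exact: IH.
Qed.

Variable a : int.
Context d (T : measurableType d) (P : probability T R) (eta : R -> T -> config).
Hypothesis etaP : markov_process S (nu_cond nu a) P eta.

Lemma nu_site : fine (nu [set e | e a]) = rho.
Proof.
have := nuP [fset a]%fset (fun=> true); rewrite big_seq_fset1/= => E.
rewrite -[RHS]/(fine rho%:E) -E; congr (fine (nu _)).
apply/seteqP; split=> e /= H; last by rewrite H// inE.
by move=> x; rewrite inE => /eqP ->.
Qed.

Lemma Ex_cond L (F : config -> R) : local_in L F ->
  Ex P (fun w => F (eta 0 w)) =
  Ex P0 (fun w => F (eta0 0 w) * (eta0 0 w a)%:R) / rho.
Proof.
move=> FL; have rho0 : rho != 0 by rewrite gt_eqF//; case/andP: rho01.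
have ma : measurable [set w | eta0 0 w a] by exact: (measurable_eta eta0P).
rewrite (Ex_initial etaP FL).
under [in RHS]eq_fun do rewrite (local_in_sum _ FL) mulr_suml.
have mz z : measurable [set w | pat L (eta0 0 w) == z].
  rewrite (_ : [set w | _] = [set w | pat L (eta0 0 w) = z]).
    exact: (measurable_eta_pat eta0P).
  by apply/seteqP; split=> w /= /eqP.
have bz z : bmf (fun w => (pat L (eta0 0 w) == z)%:R : R) by exact: bmf_bool.
have ba : bmf (fun w => (eta0 0 w a)%:R : R) by exact: bmf_bool.
rewrite Ex_sum; last by move=> z; apply: bmfM => //; exact: bmfZ.
rewrite mulr_suml; apply: eq_bigr => z _.
rewrite /nu_cond/= nu_site; under [in RHS]eq_fun do rewrite -mulrA.
rewrite ExZ; last exact: bmfM.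
rewrite -mulrA; congr (_ * (_ / _)).
have -> : (fun w => (pat L (eta0 0 w) == z)%:R * (eta0 0 w a)%:R : R) =
    (fun w => ((pat L (eta0 0 w) == z) && eta0 0 w a)%:R).
  by apply/funext => w; rewrite mulr_natr; case: eqP; case: (eta0 0 w a).
rewrite Ex_bool; last first.
  rewrite (_ : [set w | _] =
    [set w | pat L (eta0 0 w) == z] `&` [set w | eta0 0 w a]).
    exact: measurableI.
  by apply/seteqP; split=> w /= /andP.
congr fine; rewrite -(process_initial eta0P).
  by congr (P0 _); apply/seteqP; split=> w /=; [move=> [-> ->]; rewrite eqxx|move=> /andP[/eqP]].
by apply: measurableI; [exact: measurable_pat_configM|exact: measurable_site].
Qed.

Lemma Ex_cond_le L (F : config -> R) : local_in L F -> (forall e, 0 <= F e) ->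
  Ex P (fun w => F (eta 0 w)) <= Ex P0 (fun w => F (eta0 0 w)) / rho.
Proof.
move=> FL F0; have /andP[rho0 _] := rho01.
rewrite (Ex_cond FL) ler_pM2r ?invr_gt0//.
have bF : bmf (fun w => F (eta0 0 w)) by exact: (bmf_local eta0P _ FL).
apply: Ex_le => //.
  by apply: bmfM => //; apply: bmf_bool; exact: (measurable_eta eta0P).
by move=> w; case: (eta0 0 w a); rewrite ?mulr1// mulr0.
Qed.

(** Conditioning a product law on an occupied site [a] amounts to setting that site to occupied,
    which is the identity or a flip. *)
Lemma Ex_cond_osc L (F : config -> R) kappa : local_in L F ->
  (forall e, `|F (flip a e) - F e| <= kappa) ->
  `|Ex P (fun w => F (eta 0 w)) - Ex P0 (fun w => F (eta0 0 w))| <= kappa.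
Proof.
move=> FL Fk; have rho0 : rho != 0 by rewrite gt_eqF//; case/andP: rho01.
pose F1 (e : config) := F (fun x => if x == a then true else e x).
have F1L : local_in L F1.
  by move=> e e' ee'; apply: FL => x xL; case: eqVneq => // _; exact: ee'.
have F1a e : F1 (flip a e) = F1 e.
  by congr F; apply/funext => x; rewrite /flip; case: eqVneq.
have b1 : bmf (fun w => F1 (eta0 0 w)) by exact: (bmf_local eta0P _ F1L).
have ba : bmf (fun w => (eta0 0 w a)%:R : R).
  by apply: bmf_bool; exact: (measurable_eta eta0P).
have -> : Ex P (fun w => F (eta 0 w)) = Ex P0 (fun w => F1 (eta0 0 w)).
  rewrite (Ex_cond FL).
  (* The centred part integrates to 0 by [nu_indep], as [F1] does not see the site [a]. *)
  have -> : (fun w => F (eta0 0 w) * (eta0 0 w a)%:R) =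
      (fun w => F1 (eta0 0 w) * ((eta0 0 w a)%:R - rho) + rho * F1 (eta0 0 w)).
    apply/funext => w; case ha : (eta0 0 w a).
      rewrite (_ : F1 (eta0 0 w) = F (eta0 0 w)); first by ring.
      by congr F; apply/funext => x; case: eqVneq => // ->.
    by rewrite sub0r mulr0; ring.
  rewrite ExD; [|by apply: bmfM => //; apply: bmfB => //; exact: bmf_cst|exact: bmfZ].
  by rewrite (nu_indep F1L F1a) add0r ExZ// mulrC mulrA mulVf ?mul1r.
have bF : bmf (fun w => F (eta0 0 w)) by exact: (bmf_local eta0P _ FL).
rewrite -ExB//; apply: Ex_norm_le; first exact: bmfB.
move=> w; case ha : (eta0 0 w a).
  rewrite (_ : F1 (eta0 0 w) = F (eta0 0 w)).
    by rewrite subrr normr0; apply: le_trans (Fk (fun=> true)).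
  by congr F; apply/funext => x; case: eqVneq => // ->.
rewrite (_ : F1 (eta0 0 w) = F (flip a (eta0 0 w))); first exact: Fk.
by congr F; apply/funext => x; rewrite /flip; case: eqVneq => // ->; rewrite ha.
Qed.

Lemma local_in_multi_exchs L k (G : (nat -> config) -> R) p :
  local_multi L k G -> exists L', local_in L' (fun e => G (multi_exchs p e)).
Proof.
move=> GL; exists (L + \max_(s <- p) size s)%N => e1 e2 ee.
apply: GL => i ik; rewrite /multi_exchs; apply: agree_exchs.
apply: agree_leq ee; rewrite leq_add2l.
have [ip|ip] := ltnP i (size p); last by rewrite nth_default.
by rewrite (big_rem _ (mem_nth [::] ip))/= leq_maxl.
Qed.

(* Up to a mixture, the later configurations are images of the initial one by
   products of exchanges, so that changing the initial configuration at [a]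
   changes each of them at a single site. *)
Lemma decorrelation (t : nat -> R) k L (G : (nat -> config) -> R) M kappa :
  t 0%N = 0 -> (forall i, t i <= t i.+1) -> local_multi L k.+1 G ->
  (forall E, `|G E| <= M) ->
  (forall E (y : nat -> int), `|G (fun i => flip (y i) (E i)) - G E| <= kappa) ->
  `|Ex P (fun w => G (fun i => eta (t i) w)) -
    Ex P0 (fun w => G (fun i => eta0 (t i) w))| <= kappa.
Proof.
move=> t0 tS GL GM Gk.
have M0 : 0 <= M by apply: le_trans (GM (fun _ => fun=> true)).
apply/ler_addgt0Pr => eps eps0; have e20 : 0 < eps / 2 by rewrite divr_gt0.
have [q [q0 q1] Hq] := multi_mixture Sm rc Sg t0 tS M0 e20 GL GM.
have H1 := Hq _ _ _ _ _ etaP; have H2 := Hq _ _ _ _ _ eta0P.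
set x := Ex P _ in H1 *; set y := Ex P0 _ in H2 *.
set x' := \sum_(p <- q) _ in H1; set y' := \sum_(p <- q) _ in H2.
have H3 : `|x' - y'| <= kappa.
  rewrite /x' /y' -sumrB; apply: (le_trans (ler_norm_sum _ _ _)).
  rewrite -[leRHS]mul1r -q1 mulr_suml big_seq [leRHS]big_seq.
  apply: ler_sum => p /q0 p0; rewrite -mulrBr normrM ger0_norm// ler_wpM2l//.
  have [L' GL'] := local_in_multi_exchs p.2 GL.
  apply: (Ex_cond_osc GL') => e.
  have -> : multi_exchs p.2 (flip a e) =
      fun i => flip (foldr swap a (nth [::] p.2 i)) (multi_exchs p.2 e i).
    by apply/funext => i; rewrite /multi_exchs exchs_flip.
  exact: Gk.
rewrite (_ : x - y = (x - x') + (x' - y') + (y' - y)); last by ring.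
have := ler_normD (x - x' + (x' - y')) (y' - y).
have := ler_normD (x - x') (x' - y').
by rewrite (distrC y' y); lra.
Qed.

(** Each component of the mixture reads the initial occupations at the images of the sites under a
    permutation. These are again distinct, so the bound for the initial law applies to each
    component, with the factor [1 / rho] for the conditioning. *)
Lemma second_moment t s : 0 <= t -> uniq s ->
  Ex P (fun w => (\sum_(x <- s) ((eta t w x)%:R - rho)) ^+ 2) <=
  (size s)%:R / rho.
Proof.
move=> t0 us; have /andP[rho0 _] := rho01.
pose f (e : config) := (\sum_(x <- s) ((e x)%:R - rho)) ^+ 2.
pose L := (\max_(y <- s) (absz y).+1)%N.
have fL : local_in L f.
  move=> e e' ee'; rewrite /f big_seq [in RHS]big_seq; congr (_ ^+ 2).
  apply: eq_bigr => y ys.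
  rewrite ee'//; suff : ((absz y).+1 <= L)%N.
    by move: L {ee'} => m; clear; lia.
  by rewrite /L (big_rem _ ys)/= leq_maxl.
have [M M0 fM] := local_in_bounded fL.
pose t' (i : nat) := if i is 0%N then 0 else t.
have t'0 : t' 0%N = 0 by [].
have t'S i : t' i <= t' i.+1 by case: i.
apply/ler_addgt0Pr => eps eps0.
have GL : local_multi L 2 (fun E => f (E 1%N)).
  by move=> E E' EE'; apply: fL; exact: EE'.
have [q [q0 q1] Hq] := multi_mixture Sm rc Sg t'0 t'S M0 eps0 GL (fun E => fM (E 1%N)).
have := Hq _ _ _ _ _ etaP; rewrite ler_distl => /andP[_ /le_trans]; apply.
rewrite lerD2r; set B := _ / rho.
rewrite -[leRHS]mul1r -q1 mulr_suml big_seq [leRHS]big_seq.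
apply: ler_sum => p /q0 p0; rewrite ler_wpM2l// {}/B.
have [L' GL'] := local_in_multi_exchs p.2 GL.
apply: (le_trans (Ex_cond_le GL' _)); first by move=> e; exact: sqr_ge0.
rewrite ler_pM2r ?invr_gt0//.
rewrite (_ : (fun w => _) = (fun w => (\sum_(x <- map (swaps (nth [::] p.2 1)) s)
    ((eta0 0 w x)%:R - rho)) ^+ 2)).
  have := @nu_second_moment (map (swaps (nth [::] p.2 1)) s).
  by rewrite size_map; apply; rewrite map_inj_uniq//; exact: swaps_inj.
apply/funext => w; rewrite /f big_map; congr (_ ^+ 2); apply: eq_bigr => x _.
by rewrite /multi_exchs exchsE.
Qed.

End product_measure.

(** * Convergence in law *)

Section uniform_functions.
Context {R : realType} (k : nat).

Definition modulus (g : 'rV[R]_k -> R) : Prop :=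
  forall eps, 0 < eps -> exists2 delta, 0 < delta &
    forall v v' : 'rV[R]_k, (forall i, `|v ord0 i - v' ord0 i| <= delta) ->
    `|g v - g v'| <= eps.

(** The continuous trapezoid equal to 1 up to [K] and to 0 beyond [K + 1]. *)
Definition clamp (K x : R) : R := Num.max 0 (Num.min 1 (K + 1 - `|x|)).

Definition cutoff (K : R) (v : 'rV[R]_k) : R := \prod_(i < k) clamp K (v ord0 i).

Lemma clamp01 K x : 0 <= clamp K x <= 1.
Proof. by rewrite /clamp le_max lexx/= ge_max ler01/= ge_min lexx. Qed.

Lemma clamp_eq0 K x : K + 1 <= `|x| -> clamp K x = 0.
Proof.
move=> Kx; rewrite /clamp; apply/max_idPl; rewrite ge_min.
by apply/orP; right; rewrite subr_le0.
Qed.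

Lemma clamp_eq1 K x : `|x| <= K -> clamp K x = 1.
Proof.
move=> xK; rewrite /clamp (_ : Num.min _ _ = 1).
  by apply/max_idPr.
by apply/min_idPl; lra.
Qed.

Lemma cutoff01 K v : 0 <= cutoff K v <= 1.
Proof.
apply/andP; split; first by apply: prodr_ge0 => i _; have /andP[] := clamp01 K (v ord0 i).
by apply: prodr_ile1 => i _; exact: clamp01.
Qed.

Lemma cutoff_eq0 K (v : 'rV[R]_k) i : K + 1 <= `|v ord0 i| -> cutoff K v = 0.
Proof. by move=> /clamp_eq0 H; rewrite /cutoff (bigD1 i)//= H mul0r. Qed.

Lemma cutoff_eq1 K (v : 'rV[R]_k) : (forall i, `|v ord0 i| <= K) -> cutoff K v = 1.
Proof. by move=> H; apply: big1 => i _; exact: clamp_eq1. Qed.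

Lemma continuous_clamp K : continuous (clamp K).
Proof.
move=> x; apply/cvgrPdist_le => eps eps0; near=> y.
have : `|x - y| <= eps by near: y; apply: filterS (nbhsx_ballx x eps eps0) => z; exact: ltW.
have h1 : `|x| <= `|x - y| + `|y| by rewrite -{1}[x](subrK y); exact: ler_normD.
have h2 : `|y| <= `|x - y| + `|x|.
  by rewrite distrC -{1}[y](subrK x); exact: ler_normD.
rewrite (ler_norml (clamp K x - clamp K y)) /clamp /Num.max /Num.min.
move: h1 h2; set a := `|x|; set b := `|y|; set e := `|x - y| => h1 h2 h3.
case: (ltP 1 (K + 1 - a)) => ha; case: (ltP 1 (K + 1 - b)) => hb;
  case: ltP => hc; case: ltP => hd; apply/andP; split; lra.
Unshelve. all: by end_near.
Qed.

Lemma continuous_cutoff K : continuous (cutoff K).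
Proof.
rewrite /cutoff; elim: (index_enum 'I_k) => [|i l IH].
  have -> : (fun v : 'rV[R]_k => \prod_(i <- [::]) clamp K (v ord0 i)) = cst 1.
    by apply/funext => x; rewrite big_nil.
  exact: cst_continuous.
have -> : (fun v : 'rV[R]_k => \prod_(j <- i :: l) clamp K (v ord0 j)) =
    (fun v : 'rV[R]_k => clamp K (v ord0 i) * \prod_(j <- l) clamp K (v ord0 j)).
  by apply/funext => x; rewrite big_cons.
have ci : continuous (fun v : 'rV[R]_k => clamp K (v ord0 i)).
  move=> v; apply: (@cvg_comp _ _ _ (fun v : 'rV[R]_k => v ord0 i) (clamp K)).
    exact: coord_continuous.
  exact: continuous_clamp.
by move=> v; exact: (cvgM (ci v) (IH v)).
Qed.

(** Uniform continuity of a continuous function with compact support. *)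
Lemma modulus_cutoff (g : 'rV[R]_k -> R) K : continuous g ->
  modulus (fun v => g v * cutoff K v).
Proof.
move=> cg eps eps0.
pose f v := g v * cutoff K v.
have cf : continuous f.
  by move=> v; exact: (cvgM (cg v) (@continuous_cutoff K v)).
(* The product vanishes once a coordinate exceeds [K + 1] in absolute value; the margin 1 keeps
   every point within distance 1 of the outside of the box off the support. *)
pose B : set 'rV[R]_k := [set v | forall i, `[- (K + 2), K + 2]%classic (v ord0 i)].
have cB : compact B.
  by apply: (rV_compact (A := fun=> `[- (K + 2), K + 2]%classic)) => i; exact: segment_compact.
have /compact_near_coveringP/(_ R 0^'+ (fun d v => forall v' : 'rV[R]_k,
    (forall i, `|v ord0 i - v' ord0 i| <= d) -> `|f v - f v'| <= eps)) := cB.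
move=> /(_ (at_right_proper_filter 0)) [].
  move=> v Bv.
  have /cvgrPdist_le/(_ (eps / 2)) := cf v.
  rewrite divr_gt0// => /(_ isT)/nbhs_ballP[e /= e0 He].
  exists (ball v (e / 2), [set d | d < e / 2]).
    split=> /=; first by apply: nbhsx_ballx; rewrite divr_gt0.
    by apply: nbhs_right_lt; rewrite divr_gt0.
  move=> [x d] [/= xv de] v' vv'.
  have h1 : `|f v - f x| <= eps / 2.
    by apply: He => /=; apply: le_ball xv; rewrite ler_pdivrMr// ler_peMr// ?ler1n// ltW.
  have h2 : `|f v - f v'| <= eps / 2.
    apply: He; split => // i j; rewrite /ball/= (splitr e).
    rewrite (_ : v i j - v' i j = (v i j - x i j) + (x i j - v' i j)); last by ring.
    apply: le_lt_trans (ler_normD _ _) _; apply: ltrD; first exact: xv.2.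
    by rewrite (ord1 i); apply: le_lt_trans de; exact: vv'.
  rewrite [eps]splitr (_ : f x - f v' = (f x - f v) + (f v - f v')); last by ring.
  apply: le_trans (ler_normD _ _) _; apply: lerD => //; by rewrite distrC.
move=> e /= e0 He.
exists (Num.min (e / 2) 1); first by rewrite lt_min divr_gt0/=.
move=> v v' vv'; rewrite -/(f v) -/(f v').
have [Bv|nBv] := pselect (B v).
  apply: (He (e / 2) _ _ v Bv) => //=.
  - by rewrite sub0r normrN gtr0_norm ?divr_gt0// ltr_pdivrMr// ltr_pMr// ltr1n.
  - by rewrite divr_gt0.
  - by move=> i; apply: le_trans (vv' i) _; rewrite ge_min lexx.
have [i Ki] : exists i, K + 2 < `|v ord0 i|.
  apply: contrapT => /forallNP H; apply: nBv => i /=; rewrite in_itv/=.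
  by have /negP := H i; rewrite -leNgt ler_norml.
have vi := vv' i.
have v'i : K + 1 <= `|v' ord0 i|.
  have : `|v ord0 i| <= `|v ord0 i - v' ord0 i| + `|v' ord0 i|.
    by rewrite -{1}[v ord0 i](subrK (v' ord0 i)); exact: ler_normD.
  have : Num.min (e / 2) 1 <= 1 by rewrite ge_min lexx orbT.
  lra.
rewrite /f (@cutoff_eq0 K v i); last by lra.
by rewrite (cutoff_eq0 v'i) !mulr0 subrr normr0 ltW.
Qed.

End uniform_functions.

Section random_vectors.
Context d (T : measurableType d) {R : realType} (P : probability T R).

Lemma measurable_floor_level (f : T -> R) (z : int) : measurable_fun [set: T] f ->
  measurable [set w | Num.floor (f w) = z].
Proof.
move=> mf.
have := mf measurableT `[z%:~R, (z + 1)%:~R[%classic (measurable_itv _).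
rewrite setTI (_ : _ @^-1` _ = [set w | Num.floor (f w) = z])//.
apply/seteqP; split=> w /=; rewrite in_itv/=.
  by move=> H; apply: floor_def.
by move=> <-; exact: floor_itv.
Qed.

(** Rounding the coordinates down to multiples of [1 / (m + 1)] gives a vector with countably many
    values, hence a measurable composition; continuity of [g] passes to the limit. *)
Lemma measurable_row k (f : 'I_k -> T -> R) (g : 'rV[R]_k -> R) :
  (forall i, measurable_fun [set: T] (f i)) -> continuous g ->
  measurable_fun [set: T] (fun w => g (\row_i f i w)).
Proof.
move=> mf cg.
apply: (measurable_fun_cvg (h := fun m w =>
   g (\row_i ((Num.floor (f i w * m.+1%:R))%:~R / m.+1%:R)))).
  move=> m.
  pose H w := [ffun i : 'I_k => Num.floor (f i w * m.+1%:R)].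
  rewrite (_ : (fun w => _) =
    (fun z : {ffun 'I_k -> int} => g (\row_i ((z i)%:~R / m.+1%:R))) \o H).
    apply: countvar_measurable => z; rewrite (_ : [set w | _] =
        \bigcap_(i in [set: 'I_k]) [set w | Num.floor (f i w * m.+1%:R) = z i]).
      apply: fin_bigcap_measurable; first exact: finite_finset.
      move=> i _; apply: measurable_floor_level.
      by apply: measurable_funM => //; exact: measurable_cst.
    apply/seteqP; split=> w /=.
      by move=> <- i _ /=; rewrite ffunE.
    by move=> h; apply/ffunP => i; rewrite ffunE h.
  by apply/funext => w /=; congr g; apply/rowP => i; rewrite !mxE ffunE.
move=> w _.
apply: (@cvg_comp _ _ _
  (fun m => \row_i ((Num.floor (f i w * m.+1%:R))%:~R / m.+1%:R)) g
  _ (nbhs (\row_i f i w))); last exact: cg.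
apply/cvg_ballP => e e0; near=> m; split => // i j; rewrite /ball/= !mxE.
have m0 : 0 < m.+1%:R :> R by rewrite ltr0n.
have /andP[h1 h2] := floor_itv (f j w * m.+1%:R).
rewrite [X in `|X|](_ : _ = (f j w * m.+1%:R - (Num.floor (f j w * m.+1%:R))%:~R) /
    m.+1%:R); last by field; rewrite addrC natr1 gt_eqF.
rewrite ger0_norm; last by rewrite divr_ge0 ?subr_ge0// ltW.
rewrite ltr_pdivrMr//; apply: (@lt_le_trans _ _ 1).
  by rewrite ltrBlDr -[1]/(1%:~R) -intrD addrC.
rewrite mulrC -ler_pdivrMr// mul1r; apply/ltW/(lt_le_trans (truncnS_gt _)).
by rewrite ler_nat ltnS; near: m; exact: nbhs_infty_ge.
Unshelve. all: by end_near. Qed.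

Lemma tail_small (f : T -> R) kappa : measurable_fun [set: T] f -> 0 < kappa ->
  exists K : nat, (P [set w | (K%:R < `|f w|)%R] <= kappa%:E)%E.
Proof.
move=> mf k0.
pose F n := [set w | n%:R < `|f w|].
have mF n : measurable (F n) by exact: measurable_norm_gt.
have F0 : \bigcap_n F n = set0.
  rewrite -subset0 => w /= H.
  have := H (Num.truncn `|f w|).+1 I; rewrite /F/=.
  by rewrite ltNge => /negP; apply; exact/ltW/truncnS_gt.
have mF0 : measurable (\bigcap_n F n) by rewrite F0.
have Fni : {homo F : n m / (n <= m)%N >-> (m <= n)%O}.
  move=> n m nm; apply/subsetPset => w /=; apply: le_lt_trans.
  by rewrite ler_nat.
have PF0 : (P (F 0%N) < +oo)%E.
  exact: le_lt_trans (probability_le1 P (mF 0%N)) (ltry _).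
have := @nonincreasing_cvg_mu _ _ _ P F PF0 mF mF0 Fni.
rewrite F0 measure0 => /fine_cvgP[_] /cvgrPdist_le/(_ _ k0)[n _ /(_ n (leqnn _))].
rewrite /= sub0r normrN ger0_norm ?fine_ge0// => H; exists n.
by rewrite -(fineK (fin_num_measure P _ (mF n))) lee_fin.
Qed.

(** Off an event of probability at most [k * kappa] all coordinates are within [delta]; on that
    event the trivial bound [2 * M] is used. *)
Lemma slutsky k (U V : 'I_k -> T -> R) (g : 'rV[R]_k -> R) M delta eps kappa :
  (forall i, measurable_fun [set: T] (U i)) ->
  (forall i, measurable_fun [set: T] (V i)) ->
  bmf (fun w => g (\row_i U i w)) -> bmf (fun w => g (\row_i V i w)) ->
  (forall v, `|g v| <= M) -> 0 <= eps ->
  (forall v v' : 'rV[R]_k, (forall i, `|v ord0 i - v' ord0 i| <= delta) ->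
    `|g v - g v'| <= eps) ->
  (forall i, (P [set w | (delta < `|U i w - V i w|)%R] <= kappa%:E)%E) ->
  `|Ex P (fun w => g (\row_i U i w)) - Ex P (fun w => g (\row_i V i w))| <=
  eps + 2 * M * k%:R * kappa.
Proof.
move=> mU mV bU bV gM eps0 gd Pk.
have M0 : 0 <= M by apply: le_trans (gM 0).
have mUV i : measurable [set w | delta < `|U i w - V i w|].
  by apply: (measurable_norm_gt (F := fun w => U i w - V i w)); exact: measurable_funB.
have bUV i : bmf (fun w => (delta < `|U i w - V i w|)%R%:R : R) by exact: bmf_bool.
rewrite -ExB//; apply: (le_trans (Ex_norm _ _)); first exact: bmfB.
apply: (@le_trans _ _ (Ex P (fun w => eps + 2 * M *
    \sum_(i < k) (delta < `|U i w - V i w|)%R%:R))).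
  apply: Ex_le; first by apply: bmf_norm; exact: bmfB.
    by apply: bmfD; [exact: bmf_cst|apply: bmfZ; exact: bmf_sum].
  move=> w; have [H|] := boolP [forall i, `|U i w - V i w| <= delta].
    apply: ler_wpDr.
      by rewrite mulr_ge0 ?mulr_ge0// sumr_ge0.
    by apply: gd => i; rewrite !mxE; exact: (forallP H).
  rewrite negb_forall => /existsP[i]; rewrite -ltNge => Hi.
  apply: ler_wpDl => //; apply: (@le_trans _ _ (2 * M)).
    rewrite [2 * M]mulrDl !mul1r; apply: (le_trans (ler_normB _ _)).
    exact: lerD.
  rewrite ler_peMr ?mulr_ge0// (bigD1 i)//= Hi lerDl; exact: sumr_ge0.
rewrite ExD; [|exact: bmf_cst|by apply: bmfZ; exact: bmf_sum].
rewrite Ex_cst lerD2l ExZ; last exact: bmf_sum.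
rewrite -mulrA ler_wpM2l ?mulr_ge0// Ex_sum//.
rewrite mulr_natl -[X in _ *+ X](card_ord k) -sumr_const; apply: ler_sum => i _.
rewrite Ex_bool// -lee_fin fineK//; exact: fin_num_measure.
Qed.

End random_vectors.

(** * Averaged counts, density on a grid, and the tagged particle *)

Section averaged_counts.
Context {R : realType}.

(* By conservation the current through {a - 1, a} is the variation of the number
   of particles in [a, a + k] plus the current through {a + k, a + k + 1}; both
   terms are averaged over [0 <= k < N]. *)
Definition avg_count (a : int) (N : nat) (e e0 : config) : R :=
  (\sum_(k < N) \sum_(j < k.+1) ((e (a + j%:Z))%:R - (e0 (a + j%:Z))%:R)) / N%:R.

Lemma current_avg (g : R -> config) a N t : (forall x, cadlag (g^~ x)) ->
  good_path g -> (0 < N)%N -> 0 <= t ->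
  (current g a t)%:~R = avg_count a N (g t) (g 0) +
    (\sum_(i < N) current g (a + 1 + i%:Z) t)%:~R / N%:R.
Proof.
move=> gc gg N0 t0; have NR : (N%:R : R) != 0 by rewrite pnatr_eq0 -lt0n.
apply: (mulIf NR); rewrite mulrDl !divfK// raddf_sum/= -big_split/=.
rewrite (eq_bigr (fun=> (current g a t)%:~R)).
  by rewrite sumr_const card_ord mulr_natr.
move=> k _; rewrite (current_add gc gg a k.+1 t0).
have -> : a + 1 + k%:Z = a + k.+1%:Z by lia.
rewrite [in RHS]intrD [LHS]addrC; congr (_ + _); rewrite raddf_sum/=.
by apply: eq_bigr => j _; rewrite rmorphB.
Qed.

Lemma sum_flip_le y (e : config) a m :
  `|\sum_(j < m) ((flip y e (a + j%:Z))%:R - (e (a + j%:Z))%:R : R)| <= 1.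
Proof.
have flip_id j : a + j%:Z != y ->
    (flip y e (a + j%:Z))%:R - (e (a + j%:Z))%:R = 0 :> R.
  by move=> /negbTE ay; rewrite /flip ay subrr.
have [ym|ym] := boolP (a <= y < a + m%:Z); last first.
  rewrite big1 ?normr0// => j _; apply: flip_id; apply: contra ym => /eqP <-.
  by have := ltn_ord j; lia.
have jm : (absz (y - a)%R < m)%N by lia.
rewrite (bigD1 (Ordinal jm))//= [X in _ + X]big1 ?addr0; last first.
  move=> j /eqP/val_eqP/= jy; apply: flip_id; apply: contra jy => /eqP.
  by move=> ayj; apply/eqP; lia.
by case: (flip _ _ _); case: (e _); rewrite ?subrr ?subr0 ?sub0r ?normrN ?normr0 ?normr1.
Qed.

(** Each count in the average changes by at most 1 for each of the two flips, so the bound does not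
    grow with [N]. *)
Lemma avg_count_flip a N y y0 e e0 : (0 < N)%N ->
  `|avg_count a N (flip y e) (flip y0 e0) - avg_count a N e e0| <= 2.
Proof.
move=> N0; have NR : 0 < (N%:R : R) by rewrite ltr0n.
rewrite /avg_count -mulrBl normrM [X in _ * X]ger0_norm ?invr_ge0//.
rewrite ler_pdivrMr// -sumrB; apply: (le_trans (ler_norm_sum _ _ _)).
rewrite mulr_natr -[X in _ *+ X](card_ord N) -sumr_const; apply: ler_sum => k _.
rewrite -sumrB (eq_bigr (fun j : 'I_k.+1 =>
  ((flip y e (a + j%:Z))%:R - (e (a + j%:Z))%:R) -
  ((flip y0 e0 (a + j%:Z))%:R - (e0 (a + j%:Z))%:R))); last by move=> j _; ring.
rewrite sumrB; apply: (le_trans (ler_normB _ _)).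
by rewrite -[2]/(1 + 1); apply: lerD; exact: sum_flip_le.
Qed.

Lemma agree_avg_count a N e1 e2 e1' e2' :
  agree (absz a + N).+1 e1 e2 -> agree (absz a + N).+1 e1' e2' ->
  avg_count a N e1 e1' = avg_count a N e2 e2'.
Proof.
move=> H H'; congr (_ / _); apply: eq_bigr => k _; apply: eq_bigr => j _.
have kN := ltn_ord k; have jk := ltn_ord j.
by rewrite H ?H'//; lia.
Qed.

End averaged_counts.

Section grid.
Context {R : realType}.

Lemma scount_le (e : config) a k k' : k <= k' -> scount e a k <= scount e a k'.
Proof.
move=> kk'; have -> : k' = k + (absz (k' - k))%:Z by lia.
elim: (absz _) => [|n IH]; first by rewrite addr0.
have -> : k + n.+1%:Z = k + n%:Z + 1 by lia.
by rewrite scountS; apply: (le_trans IH); rewrite lerDl.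
Qed.

(* [scount e a] is nondecreasing, so that its values on a grid of step [l]
   suffice. *)
Lemma scount_grid (e : config) a k (rho : R) (l K : nat) : 0 <= rho <= 1 ->
  (0 < l)%N ->
  (forall j : int, (absz j <= K)%N ->
    `|(scount e a (j * l%:Z))%:~R - rho * (j * l%:Z)%:~R| <= l%:R) ->
  `|(scount e a k)%:~R| <= (K%:R * rho - 2) * l%:R ->
  `|(scount e a k)%:~R - rho * k%:~R| <= 2 * l%:R.
Proof.
move=> /andP[rho0 rho1] l0 H Hk.
have lR : 0 < l%:R :> R by rewrite ltr0n.
have up j k' : k' <= j * l%:Z -> (absz j <= K)%N ->
    (scount e a k')%:~R <= rho * j%:~R * l%:R + l%:R.
  move=> kj jK; have := H j jK; rewrite ler_distl rmorphM/= mulrA => /andP[_].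
  by apply: le_trans; rewrite ler_int; exact: scount_le.
have dn j k' : j * l%:Z <= k' -> (absz j <= K)%N ->
    rho * j%:~R * l%:R - l%:R <= (scount e a k')%:~R.
  move=> kj jK; have := H j jK; rewrite ler_distl rmorphM/= mulrA => /andP[h _].
  by apply: (le_trans h); rewrite ler_int; exact: scount_le.
move: Hk; rewrite ler_norml => /andP[Hk1 Hk2].
(* From [K * l] on the count would be at least [(K * rho - 1) * l], above the assumed bound; so [k]
   lies inside the grid, and likewise on the left. *)
have kK : k < K%:Z * l%:Z.
  rewrite ltNge; apply/negP => h; have := dn _ _ h (leqnn _).
  by rewrite -pmulrn; nra.
have Kk : - K%:Z * l%:Z < k.
  rewrite ltNge; apply/negP => h; have := up _ _ h.
  rewrite abszN absz_nat => /(_ (leqnn _)); rewrite mulrNz -pmulrn; nra.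
(* [k] is between two neighbouring grid points: [l] for the deviation there and [rho * l <= l] for
   the mesh add up to [2 * l]. *)
pose j := (k %/ l%:Z)%Z.
have lZ : l%:Z != 0 by move: l0; clear; lia.
have jk : j * l%:Z <= k by rewrite /j lez_floor.
have kj : k < (j + 1) * l%:Z.
  rewrite mulrDl mul1r [X in X < _](divz_eq k l%:Z) ltrD2l.
  have -> : l%:Z = `|l%:Z| by rewrite ger0_norm.
  by rewrite ltz_mod// gt_eqF// normr_gt0.
have j1 : (absz j <= K)%N by move: l0 kK Kk jk kj; clear; nia.
have j2 : (absz (j + 1)%R <= K)%N by move: l0 kK Kk jk kj; clear; nia.
have h1 := dn _ _ jk j1; have h2 := up _ _ (ltW kj) j2.
have h3 : j%:~R * l%:R <= k%:~R :> R by rewrite pmulrn -intrM ler_int.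
have h4 : k%:~R <= (j%:~R + 1) * l%:R :> R.
  by rewrite pmulrn -[1]/(1%:~R) -intrD -intrM ler_int ltW.
move: h2; rewrite intrD => h2.
rewrite ler_norml; apply/andP; split; nra.
Qed.

Definition scount_seq (a k : int) : seq int :=
  match k with
  | Posz n => [seq a + i%:Z | i <- iota 0 n]
  | Negz n => [seq a - 1 - i%:Z | i <- iota 0 n.+1]
  end.

Lemma scount_seq_uniq a k : uniq (scount_seq a k).
Proof. by case: k => n; rewrite map_inj_uniq ?iota_uniq// => i j; lia. Qed.

Lemma size_scount_seq a k : size (scount_seq a k) = absz k.
Proof. by case: k => n; rewrite size_map size_iota. Qed.

(** The square hides the minus sign of the count for negative [k]. *)
Lemma scount_sq (e : config) a k (rho : R) :
  ((scount e a k)%:~R - rho * k%:~R) ^+ 2 =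
  (\sum_(x <- scount_seq a k) ((e x)%:R - rho)) ^+ 2.
Proof.
case: k => n.
  rewrite /scount/= raddf_sum/= big_map (_ : iota 0 n = index_iota 0 n); last first.
    by rewrite /index_iota subn0.
  rewrite big_mkord.
  by rewrite sumrB sumr_const card_ord mulr_natr.
rewrite /scount /scount_seq big_map (_ : iota 0 n.+1 = index_iota 0 n.+1); last first.
  by rewrite /index_iota subn0.
rewrite big_mkord -sqrrN; congr (_ ^+ 2).
rewrite sumrB sumr_const card_ord NegzE !rmorphN/= raddf_sum/=.
by rewrite mulrN opprB opprK addrC -pmulrn mulr_natr.
Qed.

End grid.

Lemma prob_ae_le d (T : measurableType d) (R : realType) (P : probability T R)
    (A B : set T) : measurable A -> measurable B ->
  {ae P, forall w, A w -> B w} -> (P A <= P B)%E.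
Proof.
move=> mA mB [N [mN N0 HN]].
apply: (@le_trans _ _ (P (B `|` N))).
  apply: le_measure; rewrite ?inE//; first exact: measurableU.
  move=> w Aw; have [Bw|nBw] := pselect (B w); first by left.
  by right; apply: HN => /= H; apply: nBw; exact: H.
by apply: (le_trans (measureU2 P mB mN)); rewrite [X in (_ + X)%E]N0 adde0.
Qed.

Section tagged_particle_law.
Context {R : realType} (S : R -> (config -> R) -> config -> R).
Hypothesis Sm : markov_semigroup S.
Variables (r : int -> R) (c : R).
Hypothesis rc : forall b, 0 <= r b <= c.
Hypothesis Sg : has_generator S (gen r).

Lemma bmf_avg_count (mu : set config -> \bar R) d (T : measurableType d)
    (P : probability T R) (eta : R -> T -> config) a N t :
  markov_process S mu P eta -> 0 <= t ->
  bmf (fun w => avg_count a N (eta t w) (eta 0 w) : R).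
Proof.
move=> etaP t0.
by apply: (bmf_eta2 etaP (L := (absz a + N).+1)) => //; exact: agree_avg_count.
Qed.

(** Along a good path the difference is the mean of [N] currents, by [current_avg]. *)
Lemma current_avg_close (mu : set config -> \bar R) d (T : measurableType d)
    (P : probability T R) (eta : R -> T -> config) a N D t x :
  markov_process S mu P eta ->
  (forall e : config, `|\sum_(i < N) r (a + i%:Z) *
     ((e (a + i%:Z))%:R - (e (a + i%:Z + 1))%:R)| <= D) ->
  (0 < N)%N -> 0 <= t -> 0 < x ->
  (P [set w | (x < `|(current (eta^~ w) a t)%:~R -
                     avg_count a N (eta t w) (eta 0 w)|)%R] <=
   ((c * N%:R + 1) * (t + t ^+ 2 * (D + 1)) / (N%:R * x) ^+ 2)%:E)%E.
Proof.
move=> etaP rD N0 t0 x0; have NR : 0 < (N%:R : R) by rewrite ltr0n.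
have H := current_avg_prob_le Sm rc Sg etaP rD t0 (mulr_gt0 NR x0).
apply: (le_trans _ H); apply: prob_ae_le.
- apply: (measurable_norm_gt (F := fun w => (current (eta^~ w) a t)%:~R -
     avg_count a N (eta t w) (eta 0 w))).
  apply: measurable_funB; first exact: (measurable_current etaP).
  by have [] := bmf_avg_count a N etaP t0.
- apply: (measurable_norm_gt (F := fun w =>
    (\sum_(i < N) current (eta^~ w) (a + 1 + i%:Z) t)%:~R)).
  rewrite (_ : (fun _ => _) = (fun w =>
    \sum_(i < N) (current (eta^~ w) (a + 1 + i%:Z) t)%:~R)); last first.
    by apply/funext => w; rewrite raddf_sum.
  by apply: measurable_sum => i; exact: (measurable_current etaP).
apply: filterS (good_path_ae Sm rc Sg etaP) => w gw /=.
rewrite (current_avg a (process_cadlag etaP w) gw N0 t0) addrAC subrr add0r.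
by rewrite normrM [X in _ * X]ger0_norm ?invr_ge0// ltr_pdivlMr// mulrC.
Qed.

Variables (rho : R) (nu : probability configM R) (a : int).
Hypothesis rho01 : 0 < rho < 1.
Hypothesis nuP : is_nu rho nu.
Context d0 (T0 : measurableType d0) (P0 : probability T0 R)
  (eta0 : R -> T0 -> config).
Hypothesis eta0P : markov_process S nu P0 eta0.
Context d (T : measurableType d) (P : probability T R) (eta : R -> T -> config).
Hypothesis etaP : markov_process S (nu_cond nu a) P eta.

Lemma scount_prob_le t (k : int) x : 0 <= t -> 0 < x ->
  (P [set w | (x < `|(scount (eta t w) a k)%:~R - rho * k%:~R|)%R] <=
   ((absz k)%:R / rho / x ^+ 2)%:E)%E.
Proof.
move=> t0 x0.
have bF : bmf (fun w => (scount (eta t w) a k)%:~R - rho * k%:~R : R).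
  apply: (bmf_local etaP (f := fun e => (scount e a k)%:~R - rho * k%:~R)
    (L := (absz a + absz k).+2)) => // e e' ee'.
  congr (_%:~R - _); apply: eq_scount => y; rewrite /scount_sites mem_cat.
  by move=> /orP[] /mapP[i]; rewrite mem_iota => ik ->; apply: ee'; lia.
apply: (le_trans (prob_norm_gt_le P bF x0)); rewrite lee_fin.
rewrite ler_pM2r ?invr_gt0 ?exprn_gt0//.
under eq_fun do rewrite scount_sq.
rewrite -[X in X%:R / _](size_scount_seq a).
by apply: (second_moment Sm rc Sg rho01 nuP eta0P etaP) => //; exact: scount_seq_uniq.
Qed.

(** By [current_tagged] the current is the count up to the tagged particle. Unless the current is
    large, [scount_grid] can only fail through a deviation of the density at one of the [2 * K + 1]
    grid points. *)
Lemma tagged_close (Y : R -> T -> int) t (l K : nat) : tagged_particle P eta a Y ->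
  0 <= t -> (0 < l)%N ->
  (P [set w | (2 * l%:R < `|rho * (Y t w - a)%:~R - (current (eta^~ w) a t)%:~R|)%R]
   <= P [set w | ((K%:R * rho - 2) * l%:R < `|(current (eta^~ w) a t)%:~R|)%R] +
      ((2 * K).+1%:R * (K%:R / (rho * l%:R)))%:E)%E.
Proof.
move=> [mY YP] t0 l0; have /andP[rho0 rho1] := rho01.
have lR : 0 < l%:R :> R by rewrite ltr0n.
have mJ : measurable_fun [set: T] (fun w => (current (eta^~ w) a t)%:~R : R).
  exact: (measurable_current etaP).
have mYR : measurable_fun [set: T] (fun w => rho * (Y t w - a)%:~R).
  apply: (countvar_measurable (H := Y t) (fun k => rho * (k - a)%:~R)) => k.
  exact: mY.
pose A := [set w | 2 * l%:R < `|rho * (Y t w - a)%:~R - (current (eta^~ w) a t)%:~R|].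
pose B := [set w | (K%:R * rho - 2) * l%:R < `|(current (eta^~ w) a t)%:~R|].
(* The index [j] in [[0, 2 * K]] stands for the grid point [j - K]. *)
pose kk (j : nat) : int := (j%:Z - K%:Z) * l%:Z.
pose C j := [set w | l%:R < `|(scount (eta t w) a (kk j))%:~R - rho * (kk j)%:~R|].
have mA : measurable A.
  apply: (measurable_norm_gt (F := fun w => rho * (Y t w - a)%:~R -
    (current (eta^~ w) a t)%:~R)); exact: measurable_funB.
have mB : measurable B by exact: measurable_norm_gt.
have mC j : measurable (C j).
  apply: (measurable_norm_gt (F := fun w => (scount (eta t w) a (kk j))%:~R -
    rho * (kk j)%:~R)).
  apply: (proj1 (bmf_local etaP (f := fun e => (scount e a (kk j))%:~R -
    rho * (kk j)%:~R) (L := (absz a + absz (kk j)).+2) t0 _)) => e e' ee'.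
  congr (_%:~R - _); apply: eq_scount => y; rewrite /scount_sites mem_cat.
  by move=> /orP[] /mapP[i]; rewrite mem_iota => ik ->; apply: ee'; lia.
pose U := \big[setU/set0]_(j < (2 * K).+1) C j.
have mU : measurable U by apply: bigsetU_measurable.
apply: (@le_trans _ _ (P (B `|` U))).
  apply: prob_ae_le => //; first exact: measurableU.
  apply: filterS2 (good_path_ae Sm rc Sg etaP) YP => w gw Yw /= Aw.
  have [Bw|nBw] := pselect (B w); first by left.
  right; rewrite /U -bigcup_mkord; apply: contrapT => nU.
  move: Aw; rewrite (current_tagged (process_cadlag etaP w) gw Yw t0).
  rewrite distrC ltNge => /negP; apply; apply: (@scount_grid R _ _ _ _ l K) => //.
  - by rewrite !ltW.
  - move=> j jK; rewrite leNgt; apply/negP => Cj; apply: nU.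
    exists (absz (j + K%:Z)%R) => /=; first by move: jK; clear; lia.
    rewrite /C /kk/=; have -> : (absz (j + K%:Z)%R)%:Z - K%:Z = j.
      by move: jK; clear; lia.
    exact: Cj.
  - rewrite leNgt; apply/negP => h; apply: nBw; rewrite /B/=.
    by rewrite (current_tagged (process_cadlag etaP w) gw Yw t0).
apply: (le_trans (measureU2 P mB mU)); apply: leeD2l.
apply: (le_trans (Boole_inequality P _)) => //.
apply: (@le_trans _ _ (\sum_(j < (2 * K).+1) (K%:R / (rho * l%:R))%:E)%E).
  apply: lee_sum => j _; apply: (le_trans (scount_prob_le _ t0 lR)).
  rewrite lee_fin; have jK := ltn_ord j.
  rewrite [leRHS](_ : _ = (K%:R * l%:R) / rho / l%:R ^+ 2); last first.
    by field; rewrite !gt_eqF.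
  rewrite ler_pM2r ?invr_gt0 ?exprn_gt0// ler_pM2r ?invr_gt0//.
  by rewrite -natrM ler_nat /kk; move: jK; clear; nia.
by rewrite sumEFin lee_fin sumr_const card_ord -[X in X <= _]mulr_natl.
Qed.

End tagged_particle_law.

(** Positive and negative parts are pushed forward separately, so that no integrability is
    assumed. *)
Lemma law_integral d d' dU (T : measurableType d) (T' : measurableType d')
    (U : measurableType dU) (R : realType) (P : probability T R)
    (P' : probability T' R) (xi : T -> U) (xi' : T' -> U) (h : U -> \bar R) :
  measurable_fun [set: T] xi -> measurable_fun [set: T'] xi' ->
  measurable_fun [set: U] h ->
  (forall B, measurable B -> P (xi @^-1` B) = P' (xi' @^-1` B)) ->
  (\int[P]_w h (xi w) = \int[P']_w h (xi' w))%E.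
Proof.
move=> mxi mxi' mh PP'.
have ge0 (f : U -> \bar R) : measurable_fun [set: U] f ->
    (forall y, 0 <= f y)%E ->
    (\int[P]_w f (xi w) = \int[P']_w f (xi' w))%E.
  move=> mf f0.
  have := ge0_integral_pushforward mxi P measurableT mf (fun y _ => f0 y).
  have := ge0_integral_pushforward mxi' P' measurableT mf (fun y _ => f0 y).
  rewrite !preimage_setT => <- <-.
  by apply: eq_measure_integral => A mA _; exact: PP'.
rewrite integralE [RHS]integralE; congr (_ - _)%E.
  rewrite (funepos_comp h xi : (fun w => h (xi w))^\+%E = _).
  rewrite (funepos_comp h xi' : (fun w => h (xi' w))^\+%E = _).
  exact: (ge0 (h^\+)%E (measurable_funepos mh) (funepos_ge0 h)).
rewrite (funeneg_comp h xi : (fun w => h (xi w))^\-%E = _).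
rewrite (funeneg_comp h xi' : (fun w => h (xi' w))^\-%E = _).
exact: (ge0 (h^\-)%E (measurable_funeneg mh) (funeneg_ge0 h)).
Qed.

Section cutoff_expectation.
Context d (T : measurableType d) {R : realType} (P : probability T R) (k : nat).
Variables (U : 'I_k -> T -> R) (K : R).
Hypothesis mU : forall i, measurable_fun [set: T] (U i).

Lemma bmf_cutoff : bmf (fun w => cutoff K (\row_i U i w)).
Proof.
split; first by apply: measurable_row => //; exact: continuous_cutoff.
exists 1 => w; have /andP[h0 h1] := cutoff01 K (\row_i U i w).
by rewrite ger0_norm.
Qed.

(** Together with [prob_gt_cutoff] this translates tail bounds into expectations of a continuous
    function and back, so that tightness passes through convergence of expectations. *)
Lemma Ex_cutoff_ge (kappa : R) :
  (forall i, (P [set w | (K < `|U i w|)%R] <= kappa%:E)%E) ->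
  1 - k%:R * kappa <= Ex P (fun w => cutoff K (\row_i U i w)).
Proof.
move=> H; have mi i : measurable [set w | K < `|U i w|] by exact: measurable_norm_gt.
have bi i : bmf (fun w => (K < `|U i w|)%R%:R : R) by exact: bmf_bool.
apply: (@le_trans _ _ (Ex P (fun w => 1 - \sum_(i < k) (K < `|U i w|)%R%:R))).
  rewrite ExB; [|exact: bmf_cst|exact: bmf_sum].
  rewrite Ex_cst lerD2l lerN2 Ex_sum//.
  rewrite mulr_natl -[X in _ *+ X](card_ord k) -sumr_const; apply: ler_sum => i _.
  by rewrite Ex_bool// -lee_fin fineK//; exact: fin_num_measure.
apply: Ex_le; [by apply: bmfB; [exact: bmf_cst|exact: bmf_sum]|exact: bmf_cutoff|].
move=> w; have [H1|] := boolP [forall i, `|U i w| <= K].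
  rewrite cutoff_eq1; last by move=> i; rewrite mxE; exact: (forallP H1).
  by rewrite gerBl sumr_ge0.
rewrite negb_forall => /existsP[i]; rewrite -ltNge => Hi.
have /andP[h0 _] := cutoff01 K (\row_i U i w); apply: le_trans h0.
by rewrite subr_le0 (bigD1 i)//= Hi lerDl sumr_ge0.
Qed.

Lemma prob_gt_cutoff i : (P [set w | (K + 1 < `|U i w|)%R] <=
  (1 - Ex P (fun w => cutoff K (\row_i U i w)))%:E)%E.
Proof.
have mi : measurable [set w | K + 1 < `|U i w|] by exact: measurable_norm_gt.
rewrite -(fineK (fin_num_measure P _ mi)) lee_fin -Ex_bool//.
rewrite -[X in X - _](Ex_cst P) -ExB; [|exact: bmf_cst|exact: bmf_cutoff].
apply: Ex_le; first exact: bmf_bool.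
  by apply: bmfB; [exact: bmf_cst|exact: bmf_cutoff].
move=> w; have /andP[h0 h1] := cutoff01 K (\row_i U i w).
have [Hi|_] := boolP (K + 1 < _); last by rewrite subr_ge0.
by rewrite (@cutoff_eq0 _ _ _ _ i) ?subr0// mxE ltW.
Qed.

End cutoff_expectation.

Lemma modulus_cutoff1 (R : realType) k (K : R) : modulus (@cutoff R k K).
Proof.
have -> : @cutoff R k K = fun v => (fun=> 1) v * cutoff K v.
  by apply/funext => v; rewrite mul1r.
by apply: modulus_cutoff; exact: cst_continuous.
Qed.

(** Finite-dimensional times come in any order, whereas the comparison of the processes needs a
    nondecreasing sequence starting at 0. *)
Lemma sorted_times (R : realType) k (t : 'I_k -> R) : (forall i, 0 <= t i) ->
  exists (tau : nat -> R) (idx : 'I_k -> nat) (m : nat),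
    [/\ tau 0%N = 0, (forall j, tau j <= tau j.+1),
        (forall i, (idx i <= m)%N) & forall i, tau (idx i) = t i].
Proof.
move=> t0; pose l := sort <=%R [seq t i | i <- enum 'I_k].
pose s := 0 :: l; pose x0 := last 0 l.
have ss : sorted <=%R s.
  rewrite /s/= path_min_sorted; first exact: sort_le_sorted.
  apply/allP => x; rewrite mem_sort => /mapP[i _ ->]; exact: t0.
(* The default of [nth] is the last time, which keeps the sequence nondecreasing beyond the list. *)
exists (nth x0 s), (fun i => index (t i) s), (size s); split => //.
- move=> j; have [js|js] := ltnP j.+1 (size s).
    by move/(sortedP x0): ss => /(_ j js).
  rewrite (nth_default _ js).
  have [js'|js'] := ltnP j (size s); last by rewrite nth_default.
  have -> : j = (size s).-1 by move: js js'; rewrite /s/=; clear; lia.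
  by rewrite nth_last.
- by move=> i; exact: index_size.
- move=> i; rewrite nth_index// inE mem_sort; apply/orP; right.
  by apply: map_f; rewrite mem_enum.
Qed.

Lemma near_le_sqrt (R : realType) (A : R) : \forall n \near \oo, A <= Num.sqrt n%:R.
Proof.
near=> n; apply: (le_trans (ler_norm A)); rewrite -sqrtr_sqr ler_wsqrtr//.
apply/ltW/(lt_le_trans (truncnS_gt _)); rewrite ler_nat; near: n.
exact: nbhs_infty_ge.
Unshelve. all: by end_near. Qed.

(** * Bounds for the accelerated rates and their drift *)

Section rates.
Context {R : realType} (alpha : R) (beta : \bar R) (alpha0 : 0 < alpha)
  (beta0 : (0 <= beta)%E).

Lemma rate_bound n x : (0 < n)%N -> 0 <= rate alpha beta n x <= 1 + alpha.
Proof.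
move=> n0; rewrite /rate; case: eqVneq => _; last first.
  by rewrite ler01 lerDl ltW.
case: beta beta0 => [b| |]//; last by rewrite lexx addr_ge0// ltW.
rewrite lee_fin => b0; rewrite mulr_ge0 ?powR_ge0 ?(ltW alpha0)//=.
apply: (@le_trans _ _ alpha); last by rewrite lerDr.
rewrite ler_piMr ?(ltW alpha0)//.
have : n%:R `^ (- b) <= n%:R `^ 0 :> R.
  by apply: ler_powR; rewrite ?ler1n// oppr_le0.
by rewrite powRr0.
Qed.

Definition fast_rate (n : nat) (x : int) : R := n%:R ^+ 2 * rate alpha beta n x.

Lemma fast_rate_bound n x : (0 < n)%N ->
  0 <= fast_rate n x <= n%:R ^+ 2 * (1 + alpha).
Proof.
move=> n0; have /andP[h0 h1] := rate_bound x n0.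
by rewrite /fast_rate mulr_ge0 ?sqr_ge0//= ler_wpM2l ?sqr_ge0.
Qed.

Lemma fast_generator n (S : R -> (config -> R) -> config -> R) :
  has_generator S (fun f e => n%:R ^+ 2 * generator alpha beta n f e) ->
  has_generator S (gen (fast_rate n)).
Proof.
move=> H f fl eps eps0; have := H f fl eps eps0.
have [L fL] := (local_funP f).1 fl.
have fL1 := local_in_leq (leqnSn L) fL.
apply: filterS => t Ht e; have := Ht e.
rewrite -[generator _ _ _ _ _]/(gen (rate alpha beta n) f e).
rewrite !(genE _ _ (ltn0Sn L) fL1) mulr_sumr.
by under eq_bigr do rewrite mulrA.
Qed.

(** With all rates equal to 1 the sum telescopes to a difference of two occupations. The slow bond
    occurs at most once, and its rate differs from 1 by at most [1 + alpha]. *)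
Lemma fast_drift n a N (e : config) : (0 < n)%N ->
  `|\sum_(i < N) fast_rate n (a + i%:Z) *
    ((e (a + i%:Z))%:R - (e (a + i%:Z + 1))%:R)| <= n%:R ^+ 2 * (2 + alpha).
Proof.
move=> n0; pose d i : R := (e (a + i%:Z))%:R - (e (a + i%:Z + 1))%:R.
have d1 i : `|d i| <= 1.
  rewrite /d; case: (e _); case: (e _);
    by rewrite ?subrr ?subr0 ?sub0r ?normrN ?normr0 ?normr1.
rewrite (eq_bigr (fun i : 'I_N => n%:R ^+ 2 * (d i +
    (rate alpha beta n (a + i%:Z) - 1) * d i))); last first.
  by move=> i _; rewrite /fast_rate /d; ring.
rewrite -mulr_sumr normrM ger0_norm ?sqr_ge0// ler_wpM2l ?sqr_ge0//.
rewrite big_split/=; apply: (le_trans (ler_normD _ _)).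
rewrite -[2]/(1 + 1) -addrA; apply: lerD.
  have -> : \sum_(i < N) d i = (e a)%:R - (e (a + N%:Z))%:R.
    elim: N => [|m IH]; first by rewrite big_ord0 addr0 subrr.
    rewrite big_ord_recr/= IH /d.
    have -> : a + m.+1%:Z = a + m%:Z + 1 by lia.
    by ring.
  case: (e _); case: (e _);
    by rewrite ?subrr ?subr0 ?sub0r ?normrN ?normr0 ?normr1.
apply: (le_trans (ler_norm_sum _ _ _)).
have H i : `|(rate alpha beta n (a + i%:Z) - 1) * d i| <=
    (1 + alpha) * (a + i%:Z == -1)%:R.
  rewrite normrM; have [ai|ai] := eqVneq (a + i%:Z) (-1); last first.
    by rewrite /rate (negbTE ai) subrr normr0 mul0r mulr0.
  rewrite ler_pM//; have /andP[h0 h1] := rate_bound (a + i%:Z) n0.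
  move: (rate _ _ _ _) h0 h1 => q h0 h1; have := alpha0.
  by rewrite ler_norml => ?; apply/andP; split; lra.
apply: (@le_trans _ _ (\sum_(i < N) (1 + alpha) * (a + i%:Z == -1)%:R)).
  by apply: ler_sum => i _; exact: H.
rewrite -mulr_sumr ler_piMr ?addr_ge0 ?(ltW alpha0)//.
have [aN|aN] := boolP (a <= -1 < a + N%:Z); last first.
  rewrite big1// => i _; have := ltn_ord i.
  by case: eqVneq => // ai; move: aN; lia.
have jN : (absz (-1 - a)%R < N)%N by lia.
rewrite (bigD1 (Ordinal jN))//= [X in _ + X]big1 ?addr0; last first.
  move=> j /eqP/val_eqP/= jy; case: eqVneq => // ai; exfalso.
  by move/eqP: jy; apply; lia.
by case: eqVneq.
Qed.

End rates.

(** * The scaling limit *)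

Lemma normM_le_sqrD (R : realType) (x y : R) : `|x * y| <= x ^+ 2 + y ^+ 2.
Proof. by rewrite ler_norml; apply/andP; split; nra. Qed.

Section scaling_limit.
Context {R : realType} (alpha rho : R) (beta : \bar R) (u : R).
Hypotheses (alpha0 : 0 < alpha) (rho01 : 0 < rho < 1) (beta0 : (0 <= beta)%E).
Context (nu : probability configM R) (nuP : is_nu rho nu).
Context (S : nat -> R -> (config -> R) -> config -> R).
Hypothesis S_markov : forall n, (0 < n)%N -> markov_semigroup (S n).
Hypothesis S_generator : forall n, (0 < n)%N ->
  has_generator (S n) (fun f e => n%:R ^+ 2 * generator alpha beta n f e).

Let a n : int := Num.floor (u * n%:R).
Let r n := fast_rate alpha beta n.
Let rP n (n0 : (0 < n)%N) b : 0 <= r n b <= n%:R ^+ 2 * (1 + alpha) :=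
  fast_rate_bound alpha0 beta0 b n0.
Let Sg n (n0 : (0 < n)%N) : has_generator (S n) (gen (r n)) :=
  fast_generator (S_generator n0).

Definition cur n (g : R -> config) (t : R) : R :=
  (current g (a n) t)%:~R / Num.sqrt n%:R.

(* The mean of N rescaled currents has variance O(n^3 / N). *)
Definition avc n (g : R -> config) (t : R) : R :=
  avg_count (a n) (n ^ 4) (g t) (g 0) / Num.sqrt n%:R.

Section family.
Context (mu : nat -> set config -> \bar R) (d : nat -> measure_display)
  (T : forall n, measurableType (d n)) (P : forall n, probability (T n) R)
  (eta : forall n, R -> T n -> config).
Hypothesis etaP : forall n, (0 < n)%N -> markov_process (S n) (mu n) (P n) (@eta n).

Lemma measurable_cur n t : (0 < n)%N -> 0 <= t ->
  measurable_fun [set: T n] (fun w => cur n ((@eta n)^~ w) t).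
Proof.
move=> n0 t0; apply: measurable_funM; last exact: measurable_cst.
exact: (measurable_current (etaP n0)).
Qed.

Lemma measurable_avc n t : (0 < n)%N -> 0 <= t ->
  measurable_fun [set: T n] (fun w => avc n ((@eta n)^~ w) t).
Proof.
move=> n0 t0; apply: measurable_funM; last exact: measurable_cst.
by have [] := bmf_avg_count (a n) (n ^ 4) (etaP n0) t0.
Qed.

Lemma bmf_cur k (g : 'rV[R]_k -> R) M (t : 'I_k -> R) n : (0 < n)%N ->
  continuous g -> (forall v, `|g v| <= M) -> (forall i, 0 <= t i) ->
  bmf (fun w => g (\row_i cur n ((@eta n)^~ w) (t i))).
Proof.
move=> n0 cg gM t0; split; last by exists M.
by apply: measurable_row => // i; exact: measurable_cur.
Qed.

Lemma bmf_avc k (g : 'rV[R]_k -> R) M (t : 'I_k -> R) n : (0 < n)%N ->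
  continuous g -> (forall v, `|g v| <= M) -> (forall i, 0 <= t i) ->
  bmf (fun w => g (\row_i avc n ((@eta n)^~ w) (t i))).
Proof.
move=> n0 cg gM t0; split; last by exists M.
by apply: measurable_row => // i; exact: measurable_avc.
Qed.

Lemma cur_avc_close t delta kappa : 0 <= t -> 0 < delta -> 0 < kappa ->
  \forall n \near \oo, (P n [set w | (delta <
    `|cur n ((@eta n)^~ w) t - avc n ((@eta n)^~ w) t|)%R] <= kappa%:E)%E.
Proof.
move=> t0 delta0 kappa0.
pose C := (2 + alpha) * (t + t ^+ 2 * (3 + alpha)).
have al0 := ltW alpha0.
have C0 : 0 <= C by rewrite mulr_ge0 ?addr_ge0 ?mulr_ge0 ?sqr_ge0 ?addr_ge0.
near=> n.
have n0 : (0 < n)%N by near: n; exact: nbhs_infty_gt.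
have nC : C / (delta ^+ 2 * kappa) <= n%:R.
  apply/ltW/(lt_le_trans (truncnS_gt _)); rewrite ler_nat; near: n.
  exact: nbhs_infty_ge.
have nR : 1 <= n%:R :> R by rewrite ler1n.
have nR0 : 0 < n%:R :> R by exact: lt_le_trans nR.
have s0 : 0 < Num.sqrt n%:R :> R by rewrite sqrtr_gt0.
have N0 : (0 < n ^ 4)%N by rewrite expn_gt0 n0.
have x0 : 0 < delta * Num.sqrt n%:R by rewrite mulr_gt0.
have := current_avg_close (S_markov n0) (rP n0) (Sg n0) (etaP n0)
  (fun e => fast_drift alpha0 beta0 (a n) (n ^ 4) e n0) N0 t0 x0.
rewrite (_ : [set w | _] = [set w | delta <
    `|cur n ((@eta n)^~ w) t - avc n ((@eta n)^~ w) t|]); last first.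
  apply/seteqP; split=> w /=; rewrite /cur /avc -mulrBl normrM normfV;
    by rewrite (gtr0_norm s0) ltr_pdivlMr.
move=> /le_trans; apply; rewrite lee_fin natrX.
set v := n%:R in nR nR0 nC s0 *.
have v20 : 1 <= v ^+ 2 by rewrite exprn_ege1.
have v60 : 1 <= v ^+ 6 by rewrite exprn_ege1.
have sq : Num.sqrt v ^+ 2 = v by rewrite sqr_sqrtr// ltW.
have -> : (v ^+ 4 * (delta * Num.sqrt v)) ^+ 2 = v ^+ 8 * (v * delta ^+ 2).
  by transitivity (v ^+ 8 * (Num.sqrt v ^+ 2 * delta ^+ 2)); [ring|rewrite sq].
rewrite ler_pdivrMr; last by rewrite !mulr_gt0// exprn_gt0.
apply: (@le_trans _ _ (v ^+ 8 * C)).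
  rewrite (_ : v ^+ 8 * C = ((2 + alpha) * v ^+ 6) *
     (v ^+ 2 * (t + t ^+ 2 * (3 + alpha)))); last by rewrite /C; ring.
  apply: ler_pM.
  - by rewrite addr_ge0// !mulr_ge0 ?sqr_ge0 ?addr_ge0// exprn_ge0// ltW.
  - by rewrite addr_ge0// mulr_ge0 ?sqr_ge0// addr_ge0// mulr_ge0 ?sqr_ge0// addr_ge0.
  - rewrite (_ : v ^+ 2 * (1 + alpha) * v ^+ 4 = (1 + alpha) * v ^+ 6); last by ring.
    rewrite (_ : (2 + alpha) * v ^+ 6 = (1 + alpha) * v ^+ 6 + v ^+ 6); last by ring.
    by rewrite lerD2l.
  - rewrite [leRHS]mulrDr; apply: lerD; first by rewrite ler_peMl.
    rewrite [leRHS]mulrCA ler_wpM2l ?sqr_ge0//.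
    rewrite (_ : v ^+ 2 * (3 + alpha) = v ^+ 2 * (2 + alpha) + v ^+ 2); last by ring.
    by rewrite lerD2l.
rewrite (_ : kappa * _ = v ^+ 8 * (v * (delta ^+ 2 * kappa))); last by ring.
rewrite ler_pM2l ?exprn_gt0// -ler_pdivrMr//.
by rewrite mulr_gt0// exprn_gt0.
Unshelve. all: by end_near. Qed.

Lemma Ex_cur_avc k (g : 'rV[R]_k -> R) M (t : 'I_k -> R) eps :
  continuous g -> (forall v, `|g v| <= M) -> modulus g -> (forall i, 0 <= t i) ->
  0 < eps -> \forall n \near \oo,
  `|Ex (P n) (fun w => g (\row_i cur n ((@eta n)^~ w) (t i))) -
    Ex (P n) (fun w => g (\row_i avc n ((@eta n)^~ w) (t i)))| <= eps.
Proof.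
move=> cg gM gm t0 eps0.
have M0 : 0 <= M by apply: le_trans (gM 0).
have [delta delta0 Hd] := gm (eps / 2) (divr_gt0 eps0 (ltr0Sn _ 1)).
pose kappa := eps / 2 / (2 * M * k%:R + 1).
have D0 : 0 < 2 * M * k%:R + 1 by rewrite ltr_wpDl// !mulr_ge0.
have kappa0 : 0 < kappa by rewrite !divr_gt0.
have H : \forall n \near \oo, forall i, (P n [set w | (delta <
    `|cur n ((@eta n)^~ w) (t i) - avc n ((@eta n)^~ w) (t i)|)%R] <= kappa%:E)%E.
  by apply: filter_forall => i; exact: cur_avc_close.
near=> n.
have n0 : (0 < n)%N by near: n; exact: nbhs_infty_gt.
have Hn := near H n.
apply: (le_trans (slutsky (U := fun i w => cur n ((@eta n)^~ w) (t i))
  (V := fun i w => avc n ((@eta n)^~ w) (t i)) (M := M) (delta := delta)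
  (eps := eps / 2) (kappa := kappa) _ _ _ _ gM _ Hd _)).
- by move=> i; exact: measurable_cur.
- by move=> i; exact: measurable_avc.
- exact: bmf_cur gM t0.
- exact: bmf_avc gM t0.
- by rewrite divr_ge0// ltW.
- exact: Hn.
rewrite [leRHS]splitr lerD2l /kappa mulrCA ler_piMr ?divr_ge0 ?(ltW eps0)//.
by rewrite ler_pdivrMr// mul1r lerDl.
Unshelve. all: by end_near. Qed.

End family.

Context (d0 : nat -> measure_display) (T0 : forall n, measurableType (d0 n))
  (P0 : forall n, probability (T0 n) R) (eta0 : forall n, R -> T0 n -> config).
Hypothesis eta0P : forall n, (0 < n)%N -> markov_process (S n) nu (P0 n) (@eta0 n).
Context (d : nat -> measure_display) (T : forall n, measurableType (d n))
  (P : forall n, probability (T n) R) (eta : forall n, R -> T n -> config).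
Hypothesis etaP : forall n, (0 < n)%N ->
  markov_process (S n) (nu_cond nu (a n)) (P n) (@eta n).

(** A flip in every configuration moves each coordinate by at most [2 / sqrt n], below [delta] for
    large [n]; the modulus of [g] then gives the oscillation bound of [decorrelation]. *)
Lemma Ex_avc_decorrelation k (g : 'rV[R]_k -> R) M (t : 'I_k -> R) eps :
  continuous g -> (forall v, `|g v| <= M) -> modulus g -> (forall i, 0 <= t i) ->
  0 < eps -> \forall n \near \oo,
  `|Ex (P n) (fun w => g (\row_i avc n ((@eta n)^~ w) (t i))) -
    Ex (P0 n) (fun w => g (\row_i avc n ((@eta0 n)^~ w) (t i)))| <= eps.
Proof.
move=> cg gM gm t0 eps0.
have [delta delta0 Hd] := gm eps eps0.
have [tau [idx [m [tau0 tauS idxm tauE]]]] := sorted_times t0.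
near=> n.
have n0 : (0 < n)%N by near: n; exact: nbhs_infty_gt.
have sn : 2 / delta <= Num.sqrt n%:R by near: n; exact: near_le_sqrt.
have s0 : 0 < Num.sqrt n%:R :> R by rewrite sqrtr_gt0 ltr0n.
have N0 : (0 < n ^ 4)%N by rewrite expn_gt0 n0.
pose G (E : nat -> config) := g (\row_i
  (avg_count (a n) (n ^ 4) (E (idx i)) (E 0%N) / Num.sqrt n%:R)).
have GL : local_multi (absz (a n) + n ^ 4).+1 m.+1 G.
  move=> E E' EE'; congr g; apply/rowP => i; rewrite !mxE; congr (_ / _).
  by apply: agree_avg_count; apply: EE'; rewrite ?ltnS.
have := @decorrelation _ _ (S_markov n0) _ _ (rP n0) (Sg n0) _ rho01 _ nuP
  _ _ _ _ (eta0P n0) _ _ _ _ _ (etaP n0) tau m _ G M eps tau0 tauS GL.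
have -> : (fun w => G (fun i => @eta n (tau i) w)) =
    (fun w => g (\row_i avc n ((@eta n)^~ w) (t i))).
  apply/funext => w; congr g; apply/rowP => i; rewrite !mxE /avc.
  by rewrite tauE tau0.
have -> : (fun w => G (fun i => @eta0 n (tau i) w)) =
    (fun w => g (\row_i avc n ((@eta0 n)^~ w) (t i))).
  apply/funext => w; congr g; apply/rowP => i; rewrite !mxE /avc.
  by rewrite tauE tau0.
apply; first by move=> E; exact: gM.
move=> E y; apply: Hd => i; rewrite !mxE -mulrBl normrM.
rewrite [X in _ * X]ger0_norm ?invr_ge0 ?sqrtr_ge0// ler_pdivrMr//.
apply: (le_trans (avg_count_flip _ _ _ _ _ N0)).
by rewrite mulrC -ler_pdivrMr.
Unshelve. all: by end_near. Qed.

Lemma Ex_cur_decorrelation k (g : 'rV[R]_k -> R) M (t : 'I_k -> R) eps :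
  continuous g -> (forall v, `|g v| <= M) -> modulus g -> (forall i, 0 <= t i) ->
  0 < eps -> \forall n \near \oo,
  `|Ex (P n) (fun w => g (\row_i cur n ((@eta n)^~ w) (t i))) -
    Ex (P0 n) (fun w => g (\row_i cur n ((@eta0 n)^~ w) (t i)))| <= eps.
Proof.
move=> cg gM gm t0 eps0.
have e30 : 0 < eps / 3 by rewrite divr_gt0.
have H1 := Ex_cur_avc etaP cg gM gm t0 e30.
have H2 := Ex_cur_avc (mu := fun=> nu) eta0P cg gM gm t0 e30.
have H3 := Ex_avc_decorrelation cg gM gm t0 e30.
near=> n.
rewrite (_ : eps = eps / 3 + eps / 3 + eps / 3); last by field.
apply: (le_trans (ler_distD (Ex (P0 n)
  (fun w => g (\row_i avc n ((@eta0 n)^~ w) (t i)))) _ _)); apply: lerD.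
  apply: (le_trans (ler_distD (Ex (P n)
    (fun w => g (\row_i avc n ((@eta n)^~ w) (t i)))) _ _)); apply: lerD.
    by near: n.
  by near: n.
by rewrite distrC; near: n.
Unshelve. all: by end_near. Qed.


Context (dJ : measure_display) (TJ : measurableType dJ) (PJ : probability TJ R)
  (J : R -> TJ -> R) (JP : limit_current alpha rho beta u P0 eta0 PJ J).

Lemma measurable_J t : 0 <= t -> measurable_fun [set: TJ] (J t).
Proof. exact: (limit_current_process JP). Qed.

Lemma bmf_J k (g : 'rV[R]_k -> R) M (t : 'I_k -> R) :
  continuous g -> (forall v, `|g v| <= M) -> (forall i, 0 <= t i) ->
  bmf (fun w => g (\row_i J (t i) w)).
Proof.
move=> cg gM t0; split; last by exists M.
by apply: measurable_row => // i; exact: measurable_J.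
Qed.

Lemma Ex_cur_cvg k (g : 'rV[R]_k -> R) M (t : 'I_k -> R) eps :
  continuous g -> (forall v, `|g v| <= M) -> modulus g -> (forall i, 0 <= t i) ->
  0 < eps -> \forall n \near \oo,
  `|Ex (P n) (fun w => g (\row_i cur n ((@eta n)^~ w) (t i))) -
    Ex PJ (fun w => g (\row_i J (t i) w))| <= eps.
Proof.
move=> cg gM gm t0 eps0; have e20 : 0 < eps / 2 by rewrite divr_gt0.
have H1 := Ex_cur_decorrelation cg gM gm t0 e20.
have := limit_current_cvg JP t0 cg (ex_intro _ M gM).
rewrite (expectation_Ex PJ (bmf_J cg gM t0)) => /fine_cvgP[_].
move=> /cvgrPdist_le/(_ _ e20) H2.
near=> n; rewrite (splitr eps).
apply: (le_trans (ler_distD (Ex (P0 n)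
  (fun w => g (\row_i cur n ((@eta0 n)^~ w) (t i)))) _ _)); apply: lerD.
  by near: n.
by rewrite distrC; near: n.
Unshelve. all: by end_near. Qed.

(** Tightness under the conditioned law is borrowed from the limit: a tail of [J t] is turned into
    the expectation of a cutoff, which converges. The margin 1 is the width of the slope of the
    cutoff. *)
Lemma cur_tight t kappa : 0 <= t -> 0 < kappa ->
  exists2 K : R, 0 <= K & \forall n \near \oo,
    (P n [set w | (K < `|cur n ((@eta n)^~ w) t|)%R] <= kappa%:E)%E.
Proof.
move=> t0 k0; have k20 : 0 < kappa / 2 by rewrite divr_gt0.
have [K HK] := tail_small PJ (measurable_J t0) k20.
exists (K%:R + 1); first by rewrite addr_ge0.
pose g := @cutoff R 1 K%:R.
have cg : continuous g by exact: continuous_cutoff.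
have g1 v : `|g v| <= 1.
  by have /andP[h0 h1] := cutoff01 K%:R v; rewrite ger0_norm.
have t0' (i : 'I_1) : 0 <= t by [].
have H := Ex_cur_cvg cg g1 (@modulus_cutoff1 R 1 K%:R) t0' k20.
near=> n.
have n0 : (0 < n)%N by near: n; exact: nbhs_infty_gt.
have mc (i : 'I_1) : measurable_fun [set: T n] (fun w => cur n ((@eta n)^~ w) t).
  exact: (measurable_cur etaP n0 t0).
apply: (le_trans (prob_gt_cutoff (P n) K%:R mc ord0)); rewrite lee_fin.
have HJ := @Ex_cutoff_ge _ _ _ PJ 1 (fun=> J t) K%:R (fun=> measurable_J t0)
  _ (fun=> HK).
have : `|Ex (P n) (fun w => g (\row_(i < 1) cur n ((@eta n)^~ w) t)) -
    Ex PJ (fun w => g (\row_(i < 1) J t w))| <= kappa / 2 by near: n.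
move: HJ; rewrite /g mul1r; set x := Ex PJ _; set y := Ex (P n) _ => h1.
rewrite ler_distl => /andP[h2 _]; rewrite lerBlDl -lerBlDr.
by rewrite (splitr kappa) opprD addrA (le_trans _ h2)// lerD2r.
Unshelve. all: by end_near. Qed.

Context (Y : forall n, R -> T n -> int).
Hypothesis YP : forall n, (0 < n)%N ->
  tagged_particle (P n) (@eta n) (a n) (@Y n).

Definition disp n (t : R) (w : T n) : R := (@Y n t w - a n)%:~R / Num.sqrt n%:R.

Lemma measurable_disp n t : (0 < n)%N -> 0 <= t ->
  measurable_fun [set: T n] (@disp n t).
Proof.
move=> n0 t0; have [mY _] := YP n0.
exact: (countvar_measurable (fun k => (k - a n)%:~R / Num.sqrt n%:R : R)
  (fun k => mY t k t0)).
Qed.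

(** The grid has a step [l] of order [sqrt n] and a fixed number of points: tightness keeps the
    current below the range of the grid, and each point fails with probability of order
    [1 / sqrt n]. *)
Lemma disp_cur_close t delta kappa : 0 <= t -> 0 < delta -> 0 < kappa ->
  \forall n \near \oo, (P n [set w | (delta <
    `|disp t w - cur n ((@eta n)^~ w) t / rho|)%R] <= kappa%:E)%E.
Proof.
move=> t0 delta0 k0; have k20 : 0 < kappa / 2 by rewrite divr_gt0.
have /andP[rho0 _] := rho01.
have [K0 K00 HK0] := cur_tight t0 k20.
(* For large [n], [l <= th * s + 1 <= 2 * (th * s)], so that the factor 4 gives
   [2 * l <= delta * (rho * s)]. *)
pose th := rho * delta / 4.
have th0 : 0 < th by rewrite divr_gt0// mulr_gt0.
(* The grid reaches beyond the tightness level [K0] of the current. *)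
pose K := (Num.truncn ((K0 / th + 2) / rho)).+1.
have HK : K0 <= (K%:R * rho - 2) * th.
  rewrite -ler_pdivrMr// lerBrDr -ler_pdivrMr//; exact/ltW/truncnS_gt.
have K20 : 0 <= K%:R * rho - 2 by rewrite -(pmulr_lge0 _ th0) (le_trans K00).
(* Once [sqrt n] exceeds [D], the union bound over the grid points is at most [kappa / 2]. *)
pose D := (2 * K).+1%:R * (K%:R / (rho * th)) / (kappa / 2).
near=> n.
have n0 : (0 < n)%N by near: n; exact: nbhs_infty_gt.
have s1 : th^-1 <= Num.sqrt n%:R by near: n; exact: near_le_sqrt.
have s2 : D <= Num.sqrt n%:R by near: n; exact: near_le_sqrt.
set s := Num.sqrt n%:R : R in s1 s2.
have s0 : 0 < s by rewrite sqrtr_gt0 ltr0n.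
pose l := (Num.truncn (th * s)).+1.
have lR : 0 < l%:R :> R by rewrite ltr0n.
have l1 : th * s <= l%:R by exact/ltW/truncnS_gt.
have l2 : 2 * l%:R <= delta * (rho * s).
  have h1 : 1 <= th * s by rewrite mulrC -ler_pdivrMr// div1r.
  have h2 : l%:R <= th * s + 1.
    by rewrite -natr1 lerD2r truncn_le// mulr_ge0// ltW.
  apply: (@le_trans _ _ (2 * (th * s + th * s))).
    by rewrite ler_pM2l// (le_trans h2)// lerD2l.
  by rewrite [leLHS](_ : _ = delta * (rho * s)) // /th; field.
have mc : measurable_fun [set: T n] (fun w => cur n ((@eta n)^~ w) t).
  exact: (measurable_cur etaP n0 t0).
have md := measurable_disp n0 t0.
have mJ : measurable_fun [set: T n] (fun w => (current ((@eta n)^~ w) (a n) t)%:~R : R).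
  exact: (measurable_current (etaP n0)).
have [mY _] := YP n0.
have mYR : measurable_fun [set: T n] (fun w => rho * (@Y n t w - a n)%:~R).
  exact: (countvar_measurable (fun k => rho * (k - a n)%:~R) (fun k => mY t k t0)).
apply: (@le_trans _ _ (P n [set w | (2 * l%:R < `|rho * (@Y n t w - a n)%:~R -
    (current ((@eta n)^~ w) (a n) t)%:~R|)%R])).
  apply: le_measure; rewrite ?inE.
  - apply: (measurable_norm_gt (F := fun w => disp t w - cur n ((@eta n)^~ w) t / rho)).
    by apply: measurable_funB => //; apply: measurable_funM.
  - apply: (measurable_norm_gt (F := fun w => rho * (@Y n t w - a n)%:~R -
      (current ((@eta n)^~ w) (a n) t)%:~R)); exact: measurable_funB.
  - move=> w /=; rewrite /disp /cur -/s => h; apply: (le_lt_trans l2).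
    have rs0 : 0 < rho * s by rewrite mulr_gt0.
    rewrite -ltr_pdivlMr//; apply: (lt_le_trans h).
    rewrite ler_pdivlMr// -[X in _ * X](gtr0_norm rs0) -normrM.
    rewrite le_eqVlt; apply/orP; left.
    by apply/eqP; congr `|_|; field; rewrite !gt_eqF.
apply: (le_trans (tagged_close (S_markov n0) (rP n0) (Sg n0) rho01 nuP
  (eta0P n0) (etaP n0) K (YP n0) t0 (ltn0Sn _))).
rewrite (splitr kappa) EFinD; apply: leeD; last first.
  rewrite lee_fin; move: s2; rewrite /D ler_pdivrMr// => s2.
  apply: (@le_trans _ _ ((2 * K).+1%:R * (K%:R / (rho * th)) / s)).
    rewrite -mulrA ler_wpM2l// -mulrA ler_wpM2l// -invfM lef_pV2 ?posrE ?mulr_gt0//.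
    by rewrite -mulrA ler_wpM2l// ltW.
  by rewrite ler_pdivrMr// [kappa / 2 * s]mulrC.
apply: (@le_trans _ _ (P n [set w | (K0 < `|cur n ((@eta n)^~ w) t|)%R])); last first.
  by near: n.
apply: le_measure; rewrite ?inE; [exact: measurable_norm_gt..|].
move=> w /= h; rewrite normrM normfV (gtr0_norm s0) ltr_pdivlMr//.
apply: le_lt_trans h; apply: (le_trans (ler_wpM2r (ltW s0) HK)).
by rewrite -mulrA ler_wpM2l.
Unshelve. all: by end_near. Qed.


Lemma bmf_disp k (g : 'rV[R]_k -> R) M (t : 'I_k -> R) n : (0 < n)%N ->
  continuous g -> (forall v, `|g v| <= M) -> (forall i, 0 <= t i) ->
  bmf (fun w : T n => g (\row_i disp (t i) w)).
Proof.
move=> n0 cg gM t0; split; last by exists M.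
by apply: measurable_row => // i; exact: measurable_disp.
Qed.

Lemma Ex_disp_cvg_modulus k (g : 'rV[R]_k -> R) M (t : 'I_k -> R) eps :
  continuous g -> (forall v, `|g v| <= M) -> modulus g -> (forall i, 0 <= t i) ->
  0 < eps -> \forall n \near \oo,
  `|Ex (P n) (fun w => g (\row_i disp (t i) w)) -
    Ex PJ (fun w => g (\row_i (J (t i) w / rho)))| <= eps.
Proof.
move=> cg gM gm t0 eps0; have e20 : 0 < eps / 2 by rewrite divr_gt0.
have /andP[rho0 _] := rho01.
have M0 : 0 <= M by apply: le_trans (gM 0).
pose g' v := g (rho^-1 *: v).
have cg' : continuous g'.
  by move=> v; apply: continuous_comp; [exact: scaler_continuous|exact: cg].
have g'M v : `|g' v| <= M by exact: gM.
have g'm : modulus g'.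
  move=> e e0; have [dl dl0 Hd] := gm e e0.
  exists (rho * dl); first by rewrite mulr_gt0.
  move=> v v' vv'; apply: Hd => i; rewrite !mxE -mulrBr normrM.
  by rewrite gtr0_norm ?invr_gt0// ler_pdivrMl.
have rowE (x : 'I_k -> R) : g (\row_i (x i / rho)) = g' (\row_i x i).
  by congr g; apply/rowP => i; rewrite !mxE mulrC.
have [dl dl0 Hd] := gm (eps / 2 / 2) (divr_gt0 e20 (ltr0Sn _ 1)).
pose kappa := eps / 2 / 2 / (2 * M * k%:R + 1).
have D0 : 0 < 2 * M * k%:R + 1 by rewrite ltr_wpDl// !mulr_ge0.
have kappa0 : 0 < kappa by rewrite !divr_gt0.
have H1 := Ex_cur_cvg cg' g'M g'm t0 e20.
have H2 : \forall n \near \oo, forall i, (P n [set w | (dl <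
    `|disp (t i) w - cur n ((@eta n)^~ w) (t i) / rho|)%R] <= kappa%:E)%E.
  by apply: filter_forall => i; exact: disp_cur_close.
near=> n.
have n0 : (0 < n)%N by near: n; exact: nbhs_infty_gt.
rewrite (splitr eps); apply: (le_trans (ler_distD (Ex (P n)
  (fun w => g (\row_i (cur n ((@eta n)^~ w) (t i) / rho)))) _ _)); apply: lerD.
  apply: (le_trans (slutsky (U := fun i w => disp (t i) w)
    (V := fun i w => cur n ((@eta n)^~ w) (t i) / rho) (M := M) (delta := dl)
    (eps := eps / 2 / 2) (kappa := kappa) _ _ _ _ gM _ Hd _)).
  - by move=> i; exact: measurable_disp.
  - move=> i; apply: measurable_funM; last exact: measurable_cst.
    exact: (measurable_cur etaP n0 (t0 i)).
  - exact: bmf_disp gM t0.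
  - by under eq_fun do rewrite rowE; exact: (bmf_cur etaP n0 cg' g'M t0).
  - by rewrite ltW// divr_gt0.
  - by near: n.
  rewrite [leRHS]splitr lerD2l /kappa mulrCA ler_piMr ?(divr_ge0 (ltW e20))//.
  by rewrite ler_pdivrMr// mul1r lerDl.
under eq_fun do rewrite rowE; under [X in _ - Ex PJ X]eq_fun do rewrite rowE.
by near: n.
Unshelve. all: by end_near. Qed.

(** A cutoff reduces [g] to a function with a modulus. The mass cut off from the displacement is
    small because the expectation of the cutoff itself converges to that for [J / rho]. *)
Lemma Ex_disp_cvg k (g : 'rV[R]_k -> R) M (t : 'I_k -> R) eps :
  continuous g -> (forall v, `|g v| <= M) -> (forall i, 0 <= t i) ->
  0 < eps -> \forall n \near \oo,
  `|Ex (P n) (fun w => g (\row_i disp (t i) w)) -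
    Ex PJ (fun w => g (\row_i (J (t i) w / rho)))| <= eps.
Proof.
move=> cg gM t0 eps0; have e20 : 0 < eps / 2 by rewrite divr_gt0.
have M0 : 0 <= M by apply: le_trans (gM 0).
have mJ i : measurable_fun [set: TJ] (fun w => J (t i) w / rho).
  by apply: measurable_funM; [exact: measurable_J|exact: measurable_cst].
(* The truncation errors of the two sides add up to [M * (2 * k%:R + 1) * kappa]; the final 1 keeps
   the denominator positive. *)
pose kappa := eps / 2 / (M * (2 * k%:R + 1) + 1).
have D0 : 0 < M * (2 * k%:R + 1) + 1 by rewrite ltr_wpDl// mulr_ge0// addr_ge0// mulr_ge0.
have kappa0 : 0 < kappa by rewrite divr_gt0.
have [K0 HK0] := choice (fun i => tail_small PJ (mJ i) kappa0).
(* One level for all coordinates; the sum dominates each [K0 i]. *)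
pose K := (\sum_i K0 i)%N.
have HK i : (PJ [set w | (K%:R < `|J (t i) w / rho|)%R] <= kappa%:E)%E.
  apply: le_trans (HK0 i); apply: le_measure; rewrite ?inE;
    [exact: measurable_norm_gt..|move=> w /=; apply: le_lt_trans].
  by rewrite ler_nat /K (bigD1 i)//= leq_addr.
pose c := @cutoff R k K%:R.
have cc : continuous c by exact: continuous_cutoff.
have c01 v : 0 <= c v <= 1 by exact: cutoff01.
have c1 v : `|c v| <= 1 by have /andP[h0 h1] := c01 v; rewrite ger0_norm.
pose gc v := g v * c v.
have cgc : continuous gc by move=> v; exact: (cvgM (cg v) (cc v)).
have gcM v : `|gc v| <= M by rewrite normrM -[leRHS]mulr1 ler_pM.
have gcm : modulus gc by exact: modulus_cutoff.
have trunc dd (U : measurableType dd) (Q : probability U R) (F : U -> 'rV[R]_k) :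
    bmf (fun w => g (F w)) -> bmf (fun w => gc (F w)) -> bmf (fun w => c (F w)) ->
    `|Ex Q (fun w => g (F w)) - Ex Q (fun w => gc (F w))| <=
    M * (1 - Ex Q (fun w => c (F w))).
  move=> bg bgc bc; rewrite -ExB//; apply: (le_trans (Ex_norm Q (bmfB bg bgc))).
  rewrite -[X in X - _](Ex_cst Q) -ExB//; last exact: bmf_cst.
  have b1c : bmf (fun w => 1 - c (F w)) by apply: bmfB => //; exact: bmf_cst.
  rewrite -ExZ//; apply: Ex_le; first by apply: bmf_norm; exact: bmfB.
    exact: bmfZ.
  move=> w; rewrite /gc -[X in X - _]mulr1 -mulrBr normrM.
  have /andP[_ h1] := c01 (F w).
  by rewrite [X in _ * X]ger0_norm ?subr_ge0// ler_wpM2r// subr_ge0.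
have rowJ g1 M1 : continuous g1 -> (forall v, `|g1 v| <= M1) ->
    bmf (fun w => g1 (\row_i (J (t i) w / rho) : 'rV[R]_k) : R).
  by move=> cg1 g1M; split; [exact: measurable_row|exists M1].
have HJ := @Ex_cutoff_ge _ _ _ PJ k _ K%:R mJ kappa HK.
have H1 := Ex_disp_cvg_modulus cgc gcM gcm t0 e20.
have H2 := Ex_disp_cvg_modulus cc c1 (@modulus_cutoff1 R k K%:R) t0 kappa0.
near=> n.
have n0 : (0 < n)%N by near: n; exact: nbhs_infty_gt.
have Hc : `|Ex (P n) (fun w => c (\row_i disp (t i) w)) -
    Ex PJ (fun w => c (\row_i (J (t i) w / rho)))| <= kappa by near: n.
have Hg : `|Ex (P n) (fun w => gc (\row_i disp (t i) w)) -
    Ex PJ (fun w => gc (\row_i (J (t i) w / rho)))| <= eps / 2 by near: n.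
have Tn := trunc _ _ (P n) (fun w => \row_i disp (t i) w)
  (bmf_disp n0 cg gM t0) (bmf_disp n0 cgc gcM t0) (bmf_disp n0 cc c1 t0).
have TJ' := trunc _ _ PJ (fun w => \row_i (J (t i) w / rho))
  (rowJ _ _ cg gM) (rowJ _ _ cgc gcM) (rowJ _ _ cc c1).
apply: (@le_trans _ _ (M * (k%:R * kappa + kappa) + eps / 2 + M * (k%:R * kappa))).
  apply: (le_trans (ler_distD (Ex PJ (fun w => gc (\row_i (J (t i) w / rho)))) _ _)).
  apply: lerD.
    apply: (le_trans (ler_distD (Ex (P n) (fun w => gc (\row_i disp (t i) w))) _ _)).
    apply: lerD => //; apply: (le_trans Tn); rewrite ler_wpM2l//.
    move: Hc; rewrite ler_distl => /andP[h2 _]; rewrite lerBlDl -lerBlDr.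
    by rewrite opprD addrA (le_trans _ h2)// lerD2r.
  rewrite distrC; apply: (le_trans TJ'); rewrite ler_wpM2l//.
  by rewrite lerBlDl -lerBlDr.
rewrite (_ : _ + _ = eps / 2 + M * (2 * k%:R + 1) * kappa); last by ring.
rewrite [leRHS]splitr lerD2l /kappa mulrCA ler_piMr ?(ltW e20)//.
by rewrite ler_pdivrMr// mul1r lerDl.
Unshelve. all: by end_near. Qed.

Context (dX : measure_display) (TX : measurableType dX) (PX : probability TX R)
  (X : R -> TX -> R) (X_process : random_process X)
  (X_law : fdd_eq PX X PJ (fun t w => J t w / rho)).

Lemma integral_X k (h : k.-tuple R -> \bar R) (t : 'I_k -> R) :
  (forall i, 0 <= t i) -> measurable_fun [set: k.-tuple R] h ->
  (\int[PX]_w h [tuple X (t i) w | i < k] =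
   \int[PJ]_w h [tuple (J (t i) w / rho)%R | i < k])%E.
Proof.
move=> t0 mh; apply: law_integral => //.
- apply/measurable_fun_tnthP => i.
  rewrite (_ : _ \o _ = X (t i)); first exact: X_process.
  by apply/funext => w /=; rewrite tnth_mktuple.
- apply/measurable_fun_tnthP => i.
  rewrite (_ : _ \o _ = (fun w => J (t i) w / rho)).
    by apply: measurable_funM; [exact: measurable_J|exact: measurable_cst].
  by apply/funext => w /=; rewrite tnth_mktuple.
- by move=> B mB; exact: X_law.
Qed.

Lemma Ex_X k (g : 'rV[R]_k -> R) (t : 'I_k -> R) : (forall i, 0 <= t i) ->
  continuous g ->
  ('E_PX[fun w => g (\row_i X (t i) w)] =
   'E_PJ[fun w => g (\row_i (J (t i) w / rho)%R)])%E.
Proof.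
move=> t0 cg; rewrite unlock.
have mh : measurable_fun [set: k.-tuple R] (fun v => (g (\row_i tnth v i))%:E).
  apply/measurable_EFinP; apply: measurable_row => // i; exact: measurable_tnth.
have := integral_X t0 mh.
have rowE (x : 'I_k -> R) : \row_i tnth [tuple x i | i < k] i = \row_i x i.
  by apply/rowP => i; rewrite !mxE tnth_mktuple.
under eq_integral do rewrite rowE.
by under [X in _ = X -> _]eq_integral do rewrite rowE.
Qed.

Lemma fdd_cvg_disp : fdd_cvg P (fun n t w => disp t w : R) PX X.
Proof.
move=> k t t0 g cg [M gM]; rewrite Ex_X//.
have rowJ : bmf (fun w => g (\row_i (J (t i) w / rho))).
  split; [apply: measurable_row => // i|by exists M].
  by apply: measurable_funM; [exact: measurable_J|exact: measurable_cst].
rewrite expectation_Ex//; apply/fine_cvgP; split.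
  near=> n; have n0 : (0 < n)%N by near: n; exact: nbhs_infty_gt.
  by rewrite expectation_Ex//; exact: bmf_disp gM t0.
apply/cvgrPdist_le => eps eps0; have H := Ex_disp_cvg cg gM t0 eps0.
by near=> n; rewrite distrC; near: n.
Unshelve. all: by end_near. Qed.

(** The integral of the product is determined by the law at the two times. Extracting [rho ^- 2]
    uses the integrability of [J t \* J s], which follows from finite second moments by
    [normM_le_sqrD]. *)
Lemma covariance_X s t : 0 <= s -> 0 <= t ->
  ('E_PX[X t \* X s] = (rho ^- 2)%:E * 'E_PJ[J t \* J s])%E.
Proof.
move=> s0 t0; rewrite unlock.
have /andP[rho0 _] := rho01.
pose tt (i : 'I_2) := if i == ord0 then t else s.
have tt0 i : 0 <= tt i by rewrite /tt; case: ifP.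
have mh : measurable_fun [set: 2.-tuple R]
    (fun v => (tnth v ord0 * tnth v ord_max)%:E).
  by apply/measurable_EFinP; apply: measurable_funM; exact: measurable_tnth.
have := integral_X tt0 mh.
under eq_integral do rewrite !tnth_mktuple /tt/=.
under [X in _ = X -> _]eq_integral do rewrite !tnth_mktuple /tt/=.
move=> ->.
have mJt := measurable_J t0; have mJs := measurable_J s0.
(* The covariance formula at two equal times gives a finite second moment. *)
have sqi r0 : 0 <= r0 -> PJ.-integrable [set: TJ] (EFin \o (J r0 \* J r0)).
  move=> r00; have := limit_current_cov JP (s := r0) (t := r0).
  rewrite lexx r00 => /(_ isT); rewrite unlock => E.
  have mJ2 : measurable_fun [set: TJ] (J r0 \* J r0).
    by apply: measurable_funM; exact: measurable_J.
  apply/integrableP; split; first exact/measurable_EFinP.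
  rewrite (eq_integral (fun w => ((J r0 \* J r0) w)%:E)) ?E ?ltry// => w _ /=.
  by rewrite ger0_norm// -expr2 sqr_ge0.
have ti : PJ.-integrable [set: TJ] (EFin \o (J t \* J s)).
  have := integrableD measurableT (sqi _ t0) (sqi _ s0).
  apply: le_integrable => //.
    by apply/measurable_EFinP; exact: measurable_funM.
  move=> w _ /=; rewrite lee_fin.
  rewrite [leRHS]ger0_norm ?addr_ge0 -?expr2 ?sqr_ge0//.
  exact: normM_le_sqrD.
rewrite -integralZl//; apply: eq_integral => w _ /=; rewrite -EFinM; congr EFin.
by field; rewrite gt_eqF.
Qed.

End scaling_limit.

Theorem theorem2p10 (R : realType) (alpha rho : R) (beta : \bar R) (u : R)
  (alpha_gt0 : 0 < alpha) (rho01 : 0 < rho < 1) (beta_ge0 : (0 <= beta)%E)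
  (nu : probability configM R) (nuP : is_nu rho nu)
  (* the semigroups with generators n^2 L_n *)
  (S : nat -> R -> (config -> R) -> config -> R)
  (S_markov : forall n, (0 < n)%N -> markov_semigroup (S n))
  (S_generator : forall n, (0 < n)%N ->
     has_generator (S n)
       (fun f e => n%:R ^+ 2 * generator alpha beta n f e))
  (* the processes started from nu_rho, and the limit J_u of their currents *)
  (d0 : nat -> measure_display) (T0 : forall n, measurableType (d0 n))
  (P0 : forall n, probability (T0 n) R)
  (eta0 : forall n, R -> T0 n -> config)
  (eta0P : forall n, (0 < n)%N -> markov_process (S n) nu (P0 n) (eta0 n))
  (dJ : measure_display) (TJ : measurableType dJ) (PJ : probability TJ R)
  (J : R -> TJ -> R)
  (JP : limit_current alpha rho beta u P0 eta0 PJ J)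
  (* a process X_u equal to J_u / rho in law *)
  (dX : measure_display) (TX : measurableType dX) (PX : probability TX R)
  (X : R -> TX -> R) (X_process : random_process X)
  (X_law : fdd_eq PX X PJ (fun t w => J t w / rho))
  (* the processes started from nu_rho^u, with the position Y n of the tagged
     particle initially at floor(u n) *)
  (d : nat -> measure_display) (T : forall n, measurableType (d n))
  (P : forall n, probability (T n) R)
  (eta : forall n, R -> T n -> config)
  (etaP : forall n, (0 < n)%N ->
     markov_process (S n) (nu_cond nu (Num.floor (u * n%:R))) (P n) (eta n))
  (Y : forall n, R -> T n -> int)
  (YP : forall n, (0 < n)%N ->
     tagged_particle (P n) (eta n) (Num.floor (u * n%:R)) (Y n)) :
  fdd_cvg P
    (fun n t w => (Y n t w - Num.floor (u * n%:R))%:~R / Num.sqrt n%:R)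
    PX X /\
  (forall s t, 0 <= s -> 0 <= t ->
     ('E_PX[X t \* X s] = (rho ^- 2)%:E * 'E_PJ[J t \* J s])%E).
Proof.
split.
  exact: (fdd_cvg_disp alpha_gt0 rho01 beta_ge0 nuP S_markov S_generator eta0P
    etaP JP YP X_process X_law).
by move=> s t; exact: (covariance_X rho01 JP X_process X_law).
Qed.
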